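(* Let $\mathcal G=(\mathcal V,\mathcal E)$ be an infinite, connected, locally finite metric graph with $j:=\sup_{e\in\mathcal E}l_e<\infty$ and $r:=\inf_{e\in\mathcal E}l_e>0$. Let $x_0\in\mathcal V$ be such that there is a sequence $\{x_n\}\subset\mathcal V$ with $d(x_0,x_n)\to+\infty$ and such that for every $R>0$ the ball $B_R=B_R(x_0)$ is finite (consists of finitely many vertices and edges), and assume there is a constant $C_0>0$ with $\sum_{y\sim x}\omega(x,y)\le C_0\,\mu_{\mathcal V}(x)$ for all $x\in\mathcal V$. Put $R_0:=\max\{2j,1\}$. Let $h:\mathcal G\times[0,\infty)\to\mathbb R$ be positive, $\sigma>1$, and let $\theta_1\ge2$, $\theta_2\ge2$, $\theta_1\ge\theta_2/2$. For $R>0$ set $$E_R:=\{(x,t)\in\mathcal G\times[0,\infty): R^{\theta_1}\le d(x,x_0)^{\theta_1}+t^{\theta_2}\le 2R^{\theta_1}\}.$$ Suppose there exists a constant $C>0$ such that for every $R\ge R_0$ $$\int_0^\infty\Big\{\sum_{x\in\mathcal V}\mu_{\mathcal V}(x)h^{-\frac1{\sigma-1}}(x,t)\mathbf 1_{E_R}(x,t)\Big\}dt\le CR^{\frac{\sigma}{\sigma-1}},\qquad \int_0^\infty\Big\{\sum_{e\in\mathcal E}\int_0^{l_e}h_e^{-\frac1{\sigma-1}}(x,t)\mathbf 1_{E_R}(x,t)\,dx\Big\}dt\le CR^{\frac{\sigma}{\sigma-1}}.$$ Let $u$ be a nonnegative very weak solution of $$u_{tt}\ge\Delta_{\mathcal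 G}u+h|u|^\sigma\ \text{ on }\mathcal G\times(0,\infty),\qquad u(x,0)=u_0(x),\quad u_t(x,0)=u_1(x),\ x\in\mathcal G,$$ where $$\liminf_{R\to\infty}\Big\{\int_{B_{R-j}}u_1^+(x)\,d\mu_{\mathcal G}+\int_{B_{2^{1/\theta_1}R+j}}u_1^-(x)\,d\mu_{\mathcal G}\Big\}\ge0.$$ Then $u\equiv0$ on $\mathcal G\times[0,\infty)$.
   Context: Metric graph: $\mathcal V$ and $\mathcal E$ are countable sets of vertices and edges. Each edge $e$ has a length $l_e\in(0,\infty)$ and is identified with $I_e=(0,l_e)$, its closure with $[0,l_e]$, where $0$ corresponds to the initial vertex $i(e)$ and $l_e$ to the final vertex $j(e)$ (the number $j$ and the map $j(\cdot)$ are different objects); the intervals are glued at the vertices. $e\ni x$ means that the vertex $x$ is an endpoint of $e$; $x\sim y$ means that $x,y$ are joined by an edge. Locally finite: every vertex has finite degree. $d$ is the path metric (infimum of lengths of connecting paths), $B_R(x_0)=\{x\in\mathcal G:d(x,x_0)<R\}$. A function $f$ on $\mathcal G$ is identified with the family $(f_e)_{e\in\mathcal E}$, $f_e:[0,l_e]\to\mathbb R$, with values agreeing at common vertices; $f\in C(\mathcal G)$ if each $f_e$ is continuous. Primes denote derivatives in the space variable. $v^+:=\max\{v,0\}$, $v^-:=\min\{v,0\}$. $\mu_{\mathcal V}:\mathcal V\to(0,\infty)$ is a vertex measure, and $\omega:\mathcal V\times\mathcal V\to[0,\infty)$ is symmetric with $\omega(x,y)>0$ iff $x\sim y$. Integrals: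 $\int_{\mathcal G}f\,d\mu_{\mathcal G}:=\sum_{x\in\mathcal V}\mu_{\mathcal V}(x)f(x)+\sum_{e\in\mathcal E}\int_0^{l_e}f_e(x)\,dx$ and $\int_\Omega f\,d\mu_{\mathcal G}:=\int_{\mathcal G}f\mathbf 1_\Omega\,d\mu_{\mathcal G}$. Laplacian: $\Delta_{\mathcal V}f(x)=\frac1{\mu_{\mathcal V}(x)}\sum_{y\sim x}\omega(x,y)(f(y)-f(x))$ for $x\in\mathcal V$; $\Delta_{\mathcal E}f=f_e''$ on each $I_e$; $\Delta_{\mathcal G}f$ is understood through $\int_{\mathcal G}g\,\Delta_{\mathcal G}f\,d\mu_{\mathcal G}:=\sum_{x\in\mathcal V}\mu_{\mathcal V}(x)g(x)\Delta_{\mathcal V}f(x)+\sum_{e\in\mathcal E}\int_0^{l_e}g_e f_e''\,dx$. $\mathcal D(\mathcal G)$ is the set of $f\in C(\mathcal G)$ with $f_e\in C^2(I_e)\cap C^1([0,l_e])$ and $f_e''\in L^\infty(I_e)$ for all $e$. The Kirchhoff operator at $x\in\mathcal V$ is $[\mathcal K(f)](x)=\sum_{e\ni x}\frac{df_e(x)}{dn}$, where $\frac{df_e(x)}{dn}=f_e'(x)$ if $j(e)=x$ and $-f_e'(x)$ if $i(e)=x$. Very weak solution of the hyperbolic problem: $u:\mathcal G\times[0,\infty)\to\mathbb R$ such that (1) for every $x\in\mathcal G$, $u(x,\cdot)\in L^1_{\rm loc}([0,\infty))\cap L^\sigma_{\rm loc}([0,\infty),h(x,\cdot)dt)$; (2)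 for every $t\ge0$, $u(\cdot,t)\in\mathcal D(\mathcal G)$ and $[\mathcal K(u)](x,t)=0$ for all $x\in\mathcal V$; (3) for every nonnegative $\varphi:\mathcal G\times[0,\infty)\to\mathbb R$ with $\mathrm{supp}\,\varphi\subset A\times[0,T]$ for some $T>0$ and compact $A\subset\mathcal G$, and $\varphi(x,\cdot)\in C^2([0,\infty))$ for all $x\in\mathcal G$, $$-\int_0^\infty\!\!\int_{\mathcal G}\varphi_{tt}u\,d\mu_{\mathcal G}dt+\int_0^\infty\!\!\int_{\mathcal G}\varphi\,\Delta_{\mathcal G}u\,d\mu_{\mathcal G}dt+\int_0^\infty\!\!\int_{\mathcal G}h|u|^\sigma\varphi\,d\mu_{\mathcal G}dt+\int_{\mathcal G}u_1(x)\varphi(x,0)\,d\mu_{\mathcal G}-\int_{\mathcal G}u_0(x)\varphi_t(x,0)\,d\mu_{\mathcal G}\le0.$$ Here $u_0,u_1:\mathcal G\to\mathbb R$ are the given initial data.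
   Formalization: The conclusion is proved for almost every t≥0 (and then all x in G): the definition sees u only up to null sets of t (u=1 at t=5, 0 otherwise, is a very weak solution). Also h is taken measurable and the integrals in (3) are assumed to exist. *)

(* Defs.v *)
From HB Require Import structures.
From mathcomp Require Import all_boot all_order all_algebra.
From mathcomp Require Import all_classical all_reals all_analysis.

Set Implicit Arguments.
Unset Strict Implicit.
Unset Printing Implicit Defensive.

Import Order.TTheory GRing.Theory Num.Theory.
Import numFieldNormedType.Exports.

Local Open Scope classical_set_scope.
Local Open Scope ring_scope.

(** * Metric graphs *)

(** Loops and multiple edges are allowed. *)
Record metric_graph (R : realType) := MetricGraph {
  vertex : countType ;
  edge : countType ;
  ini : edge -> vertex ;
  fin : edge -> vertex ;
  len : edge -> R ;
  len_gt0 : forall e, 0 < len e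
}.

Definition incident (R : realType) (G : metric_graph R) (e : edge G)
    (x : vertex G) : Prop :=
  ini e = x \/ fin e = x.

Definition gadjacent (R : realType) (G : metric_graph R) (x y : vertex G) :
    Prop :=
  exists e : edge G, (ini e = x /\ fin e = y) \/ (ini e = y /\ fin e = x).

Definition locally_finite (R : realType) (G : metric_graph R) : Prop :=
  forall x : vertex G, finite_set [set e : edge G | incident e x].

Record graph_weights (R : realType) (G : metric_graph R) := GraphWeights {
  vmu : vertex G -> R ;
  vmu_gt0 : forall x, 0 < vmu x ;
  omega : vertex G -> vertex G -> R ;
  omega_ge0 : forall x y, 0 <= omega x y ;
  omega_sym : forall x y, omega x y = omega y x ;
  omega_gt0 : forall x y, 0 < omega x y <-> gadjacent x y
}.

(** A point is a vertex, or a pair [(e, s)] with [s] in the open interval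
    [I_e]; so a function on the graph is automatically consistent at the
    vertices. *)
Definition gpoint (R : realType) (G : metric_graph R) : Type :=
  (vertex G + {es : edge G * R | 0 < es.2 < len es.1})%type.

Definition vpt (R : realType) (G : metric_graph R) (x : vertex G) : gpoint G :=
  inl x.

(** Parametrization of the closed edge [e] by [[0, len e]], extended to the
    whole line by constants; [f \o ept e] is the function written [f_e]. *)
Definition ept (R : realType) (G : metric_graph R) (e : edge G) (s : R) :
    gpoint G :=
  match insub (e, s) with
  | Some q => inr q
  | None => vpt (if s <= 0 then ini e else fin e)
  end.

(** [joined x y L]: some path of length [L] along the edges joins [x] to [y]. *)
Inductive joined (R : realType) (G : metric_graph R) :
    gpoint G -> gpoint G -> R -> Prop :=
| joined_refl x : joined x x 0
| joined_edge (e : edge G) s t :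
    0 <= s <= len e -> 0 <= t <= len e -> joined (ept e s) (ept e t) `|s - t|
| joined_cat x y z L L' : joined x y L -> joined y z L' -> joined x z (L + L').

Definition graph_connected (R : realType) (G : metric_graph R) : Prop :=
  forall x y : gpoint G, exists L : R, joined x y L.

Definition dist (R : realType) (G : metric_graph R) (x y : gpoint G) : R :=
  inf [set L : R | joined x y L].

(** The topology of the path metric.  On a connected graph [ball x e y] is
    equivalent to [dist x y < e]; written as below it is a pseudometric ball
    also without connectedness. *)
Definition path_ball (R : realType) (G : metric_graph R) (x : gpoint G)
    (e : R) : set (gpoint G) :=
  [set y | exists2 L : R, joined x y L & L < e].

Lemma joined_sym (R : realType) (G : metric_graph R) (x y : gpoint G) (L : R) :
  joined x y L -> joined y x L.
Proof.
elim=> {x y L} [x|e s t hs ht|x y z L L' _ xy _ yz].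
- exact: joined_refl.
- by rewrite distrC; apply: joined_edge.
- by rewrite addrC; apply: joined_cat yz xy.
Qed.

Lemma path_ball_center (R : realType) (G : metric_graph R) (x : gpoint G)
  (e : R) : 0 < e -> path_ball x e x.
Proof. by move=> e0; exists 0 => //; exact: joined_refl. Qed.

Lemma path_ball_sym (R : realType) (G : metric_graph R) (x y : gpoint G)
  (e : R) : path_ball x e y -> path_ball y e x.
Proof. by case=> L /joined_sym; exists L. Qed.

Lemma path_ball_triangle (R : realType) (G : metric_graph R)
  (x y z : gpoint G) (e1 e2 : R) :
  path_ball x e1 y -> path_ball y e2 z -> path_ball x (e1 + e2) z.
Proof.
move=> [L xy Le1] [L' yz Le2]; exists (L + L'); first exact: joined_cat yz.
exact: ltrD.
Qed.

Definition graph_entourage (R : realType) (G : metric_graph R) :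
    set_system (gpoint G * gpoint G) :=
  entourage_ (@path_ball R G).

HB.instance Definition _ (R : realType) (G : metric_graph R) :=
  Choice.copy (gpoint G)
    (vertex G + {es : edge G * R | 0 < es.2 < len es.1})%type.

HB.instance Definition _ (R : realType) (G : metric_graph R) :=
  hasNbhs.Build (gpoint G) (nbhs_ (@graph_entourage R G)).

HB.instance Definition _ (R : realType) (G : metric_graph R) :=
  Nbhs_isPseudoMetric.Build R (gpoint G) erefl
    (@path_ball_center R G) (@path_ball_sym R G) (@path_ball_triangle R G)
    erefl.

Definition gball (R : realType) (G : metric_graph R) (x0 : gpoint G) (r : R) :
    set (gpoint G) :=
  [set x | dist x x0 < r].

Definition meets_finitely_many (R : realType) (G : metric_graph R)
    (A : set (gpoint G)) : Prop :=
  finite_set [set x : vertex G | A (vpt x)] /\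
  finite_set [set e : edge G | exists2 s, 0 < s < len e & A (ept e s)].

(** * Integration with respect to [mu_G] *)

Definition gmeasurable (R : realType) (G : metric_graph R)
    (f : gpoint G -> R) : Prop :=
  forall e : edge G, measurable_fun `]0, len e[ (f \o ept e).

Definition gintegral_ge0 (R : realType) (G : metric_graph R)
    (W : graph_weights G) (f : gpoint G -> \bar R) : \bar R :=
  (\esum_(x in [set: vertex G]) ((vmu W x)%:E * f (vpt x)) +
   \esum_(e in [set: edge G])
     \int[lebesgue_measure]_(s in `]0%R, len e[) f (ept e s))%E.

Definition gintegral (R : realType) (G : metric_graph R)
    (W : graph_weights G) (f : gpoint G -> R) : \bar R :=
  (gintegral_ge0 W ((EFin \o f)^\+) - gintegral_ge0 W ((EFin \o f)^\-))%E.

Definition gintegrable (R : realType) (G : metric_graph R)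
    (W : graph_weights G) (f : gpoint G -> R) : Prop :=
  gmeasurable f /\ (gintegral_ge0 W (fun x => `|f x|%:E) < +oo)%E.

(** Iterated integral over the graph, then over [t] in [[0, +oo[]. *)
Definition time_gintegral (R : realType) (G : metric_graph R)
    (W : graph_weights G) (F : gpoint G -> R -> R) : \bar R :=
  (\int[lebesgue_measure]_(t in `[0%R, +oo[) gintegral W (F ^~ t))%E.

Definition time_gintegrable (R : realType) (G : metric_graph R)
    (W : graph_weights G) (F : gpoint G -> R -> R) : Prop :=
  {ae (@lebesgue_measure R), forall t, 0 <= t -> gintegrable W (F ^~ t)} /\
  (@lebesgue_measure R).-integrable `[0, +oo[ (fun t => gintegral W (F ^~ t)).

(** * Differentiation *)

(** Derivative relative to [D]; it is one-sided at the endpoints of a closed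
    interval [D]. *)
Definition slope_at (R : realType) (f : R -> R) (s z : R) : R :=
  (f z - f s) / (z - s).

Definition derivable_in (R : realType) (D : set R) (f : R -> R) (s : R) :
    Prop :=
  cvg (slope_at f s z @[z --> within D s^']).

Definition derive_in (R : realType) (D : set R) (f : R -> R) (s : R) : R :=
  lim (slope_at f s z @[z --> within D s^']).

Definition C1_on (R : realType) (D : set R) (f : R -> R) : Prop :=
  (forall s, D s -> derivable_in D f s) /\
  {within D, continuous (derive_in D f)}.

Definition C2_on (R : realType) (D : set R) (f : R -> R) : Prop :=
  C1_on D f /\ C1_on D (derive_in D f).

(** * Laplacian, Kirchhoff operator and the class [D(G)] *)

Definition vlaplacian (R : realType) (G : metric_graph R)
    (W : graph_weights G) (f : gpoint G -> R) (x : vertex G) : R :=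
  (vmu W x)^-1 *
  \sum_(y \in [set y | gadjacent x y]) omega W x y * (f (vpt y) - f (vpt x)).

(** The vertex Laplacian at the vertices and [f_e''] inside the edges, so that
    [gintegral W (fun x => g x * glaplacian W f x)] is the integral of
    [g Delta_G f]. *)
Definition glaplacian (R : realType) (G : metric_graph R)
    (W : graph_weights G) (f : gpoint G -> R) (p : gpoint G) : R :=
  match p with
  | inl x => vlaplacian W f x
  | inr q => derive1 (derive1 (f \o ept (val q).1)) (val q).2
  end.

Definition closed_edge_derive (R : realType) (G : metric_graph R)
    (f : gpoint G -> R) (e : edge G) : R -> R :=
  derive_in `[0, len e] (f \o ept e).

(** A loop at [x] contributes through both of its ends. *)
Definition normal_derivative (R : realType) (G : metric_graph R)
    (f : gpoint G -> R) (e : edge G) (x : vertex G) : R :=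
  (if fin e == x then closed_edge_derive f e (len e) else 0) -
  (if ini e == x then closed_edge_derive f e 0 else 0).

Definition kirchhoff (R : realType) (G : metric_graph R)
    (f : gpoint G -> R) (x : vertex G) : R :=
  \sum_(e \in [set e | incident e x]) normal_derivative f e x.

Definition C2_edge (R : realType) (G : metric_graph R)
    (f : gpoint G -> R) (e : edge G) : Prop :=
  [/\ {in `]0, len e[, forall s, derivable (f \o ept e) s 1},
      {in `]0, len e[, forall s, derivable (derive1 (f \o ept e)) s 1} &
      {in `]0, len e[, continuous (derive1 (derive1 (f \o ept e)))}].

Definition domain_DG (R : realType) (G : metric_graph R)
    (f : gpoint G -> R) : Prop :=
  forall e : edge G,
  [/\ {within `[0, len e], continuous (f \o ept e)},
      C2_edge f e,
      C1_on `[0, len e] (f \o ept e) &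
      ('N[@lebesgue_measure R]_+oo
         [EFin \o ((derive1 (derive1 (f \o ept e))) \_ `]0%R, len e[)] < +oo)%E].

(** * Very weak solutions *)

(** Functions on [G x [0, +oo[] are curried functions of [(x, t)] whose values
    at [t < 0] are irrelevant. *)
Definition measurable_xt (R : realType) (G : metric_graph R)
    (F : gpoint G -> R -> R) : Prop :=
  (forall x : vertex G, measurable_fun `[(0 : R), +oo[ (F (vpt x))) /\
  (forall e : edge G, measurable_fun (`]0, len e[ `*` `[(0 : R), +oo[)
     (fun p : R * R => F (ept e p.1) p.2)).

Definition dt (R : realType) (G : metric_graph R) (F : gpoint G -> R -> R) :
    gpoint G -> R -> R :=
  fun x => derive_in `[0, +oo[ (F x).

(** The last two clauses make the integrals of the weak inequality meaningful:
    an arbitrary function of [x] need not be measurable or integrable against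
    [u]. *)
Definition test_function (R : realType) (G : metric_graph R)
    (phi : gpoint G -> R -> R) : Prop :=
  [/\ forall x t, 0 <= t -> 0 <= phi x t,
      exists (A : set (gpoint G)) (T : R), [/\ compact A, 0 < T &
        closure [set p : gpoint G * R | 0 <= p.2 /\ phi p.1 p.2 != 0]
          `<=` A `*` `[0, T]],
      forall x, C2_on `[0, +oo[ (phi x),
      measurable_xt phi &
      exists M : R, forall x t, 0 <= t ->
        `|phi x t| <= M /\ `|dt (dt phi) x t| <= M].

Record very_weak_solution (R : realType) (G : metric_graph R)
    (W : graph_weights G) (h : gpoint G -> R -> R) (sigma : R)
    (u0 u1 : gpoint G -> R) (u : gpoint G -> R -> R) : Prop := {
  vws_L1loc : forall x (T : R), 0 < T ->
    (@lebesgue_measure R).-integrable `[0, T] (EFin \o u x) ;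
  vws_Lsigmaloc : forall x (T : R), 0 < T ->
    (@lebesgue_measure R).-integrable `[0, T]
      (fun t => (h x t * `|u x t| `^ sigma)%:E) ;
  vws_domain : forall t, 0 <= t -> domain_DG (u ^~ t) ;
  vws_kirchhoff : forall t, 0 <= t -> forall x, kirchhoff (u ^~ t) x = 0 ;
  vws_integrable : forall phi, test_function phi ->
    [/\ time_gintegrable W (fun x t => dt (dt phi) x t * u x t),
        time_gintegrable W (fun x t => phi x t * glaplacian W (u ^~ t) x),
        time_gintegrable W (fun x t => h x t * `|u x t| `^ sigma * phi x t),
        gintegrable W (fun x => u1 x * phi x 0) &
        gintegrable W (fun x => u0 x * dt phi x 0)] ;
  vws_ineq : forall phi, test_function phi ->
    (- time_gintegral W (fun x t => (dt (dt phi) x t * u x t)%R)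
     + time_gintegral W (fun x t => (phi x t * glaplacian W (u ^~ t) x)%R)
     + time_gintegral W (fun x t => (h x t * `|u x t| `^ sigma * phi x t)%R)
     + gintegral W (fun x => (u1 x * phi x 0)%R)
     - gintegral W (fun x => (u0 x * dt phi x 0)%R) <= 0)%E
}.

(** * Quantities appearing in the theorem *)

Definition sup_len (R : realType) (G : metric_graph R) : R :=
  sup (range (@len R G)).

Definition inf_len (R : realType) (G : metric_graph R) : R :=
  inf (range (@len R G)).

Definition E_set (R : realType) (G : metric_graph R) (x0 : vertex G)
    (theta1 theta2 rho : R) : set (gpoint G * R) :=
  [set p | 0 <= p.2 /\
    rho `^ theta1 <= dist p.1 (vpt x0) `^ theta1 + p.2 `^ theta2
      <= 2 * rho `^ theta1].

(** The integral over [A] of the positive part [v^+ = max(v, 0)], and of the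
    nonpositive function [v^- = min(v, 0)]. *)
Definition gintegral_pos (R : realType) (G : metric_graph R)
    (W : graph_weights G) (A : set (gpoint G)) (v : gpoint G -> R) : \bar R :=
  gintegral W (fun x => Num.max (v x) 0 * \1_A x).

Definition gintegral_neg (R : realType) (G : metric_graph R)
    (W : graph_weights G) (A : set (gpoint G)) (v : gpoint G -> R) : \bar R :=
  gintegral W (fun x => Num.min (v x) 0 * \1_A x).

(* Main.v *)
Require Import Defs.
From mathcomp Require Import all_boot all_order all_algebra.
From mathcomp Require Import all_classical all_reals all_analysis.
From mathcomp Require Import measurable_realfun ess_sup_inf.
From mathcomp Require Import ring lra.

(** The theorem is a test function argument. Write [j] for the largest length of
    an edge, [q = sigma / (sigma - 1)] and [T = rho ^ (theta1 / theta2)]. At the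
    scale [rho] the test function [cutoff] is a power of a cutoff in space,
    passing from [1] to [0] between the distances [rho] and
    [2^(1/theta1) * rho] (up to [j]), times a power of a cutoff in time, passing
    from [1] to [0] between [T] and [2 * T]. The space cutoff is prescribed at the
    vertices and interpolated along the edges with zero slope at the vertices.
    Integrating by parts on an edge thus leaves only the slopes of the solution at
    the ends, and these cancel by the Kirchhoff condition ([green_formula]): the
    Laplacian passes to the test function without any defect at the vertices.

    Let [mass rho] be the integral of [h * u ^ sigma] against the test function.
    The weak inequality bounds [mass rho] plus the contribution of [u1] by the
    integral of [u] against the wave operator applied to the test function. The
    latter is at most of order [1 / rho]: in space because the lengths of the edges are
    bounded from above and below and the vertex Laplacian is bounded, in time
    because [theta1 >= theta2 / 2] means [T ^ 2 >= rho]. It is positive only on a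
    region where the test function of the scale [rho / 4] vanishes and which is
    covered by a fixed number of the annuli [E_set] of radii comparable to [rho]
    ([annuli_ge1]). Young's inequality with a parameter [Lam]
    ([young_absorption], [slice_point]) splits the integral into
    [Lam * (mass rho - mass (rho / 4))] and [Lam ^ (- 1 / (sigma - 1))] times the
    integral of [(c / rho) ^ q * h ^ (- 1 / (sigma - 1))] over these annuli, which
    the hypothesis bounds independently of [rho]. This is [time_step]: for every
    [Lam],
    [[
      mass rho <= Lam * (mass rho - mass (rho / 4))
                  + massC * Lam ^ (- 1 / (sigma - 1)) - initial_mass rho
    ]]
    where the lower limit of [initial_mass rho] is nonnegative
    ([initial_mass_liminf]). Along the scales [4 ^ n] the masses are nonnegative
    and nondecreasing; [Lam = 1/2] bounds them, so their increments tend to zero,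
    and a large [Lam] shows that their limit is zero ([seq_vanish]). Hence
    [h * u ^ sigma] vanishes, and so does [u].

    The estimate is first proved at a fixed time ([slice_integral]), where all the
    integrals over the graph are finite sums, and is then integrated in time with
    [le_integral_lower]. The time integral of its last term is compared with the
    integrals of the hypothesis in [weight_integral_le]. *)

Set Implicit Arguments.
Unset Strict Implicit.
Unset Printing Implicit Defensive.

Import Order.TTheory GRing.Theory Num.Theory.
Import numFieldNormedType.Exports.

Local Open Scope classical_set_scope.
Local Open Scope ring_scope.

(** * Derivatives relative to a set *)

Lemma is_derive_slope (R : realType) (f : R -> R) (s df : R) :
  is_derive s 1 f df -> slope_at f s z @[z --> s^'] --> df.
Proof.
move=> [dv dfE].
have hc : h^-1 *: (f (h *: 1 + s) - f s) @[h --> 0^'] --> df.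
  by rewrite -dfE; exact: dv.
apply/cvgrPdist_lt => e e0.
move/cvgrPdist_lt : hc => /(_ e e0) [d /= d0 hd].
exists d => //= z /= zs zns.
have := hd (z - s); rewrite /= sub0r normrN distrC => /(_ zs).
rewrite subr_eq0 => /(_ zns).
by rewrite scaler1 /= subrK /slope_at [_ *: _]mulrC.
Qed.

Lemma derive_in_is_derive (R : realType) (D : set R) (f : R -> R) (s df : R) :
  ProperFilter (within D s^') -> is_derive s 1 f df ->
  derivable_in D f s /\ derive_in D f s = df.
Proof.
move=> PF /is_derive_slope fdf.
have h : slope_at f s z @[z --> within D s^'] --> df.
  apply: cvg_trans fdf; apply: cvg_app; exact: cvg_within.
by split; [apply/cvg_ex; exists df|exact: cvg_lim].
Qed.

(** The limit in [derive_in] is determined only if [s] is an accumulation point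
    of [D]. *)
Lemma proper_within_right (R : realType) (D : set R) (s e : R) : 0 < e ->
  (forall z, s < z < s + e -> D z) -> ProperFilter (within D s^').
Proof.
move=> e0 De; split; last exact: within_filter.
move=> [d /= d0 hd].
pose z := s + Num.min (e / 2) (d / 2).
have m0 : 0 < Num.min (e / 2) (d / 2) by rewrite lt_min !divr_gt0.
have me : Num.min (e / 2) (d / 2) < e.
  by rewrite gt_min [e / 2 < e]ltr_pdivrMr ?ltr_pMr ?ltr1n.
have md : Num.min (e / 2) (d / 2) < d.
  by rewrite gt_min [d / 2 < d]ltr_pdivrMr ?ltr_pMr ?ltr1n ?orbT.
apply: (hd z).
- by rewrite /= /z opprD addNKr normrN gtr0_norm.
- by rewrite /= /z gt_eqF// ltrDl.
- by apply: De; rewrite /z ltrDl m0 ltrD2l.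
Qed.

(** * Truncated powers and the time profile *)

(** For [0 < n] the powers of the positive part are of class C^(n-1), so that
    the cutoffs made from them glue smoothly with [0]. *)
Definition ppow (R : realType) (n : nat) (x : R) : R := (Num.max 0 x) ^+ n.

Lemma ppow_pos (R : realType) n (x : R) : 0 <= x -> ppow n x = x ^+ n.
Proof. by move=> x0; rewrite /ppow max_r. Qed.

Lemma ppow_neg (R : realType) n (x : R) : x <= 0 -> ppow n.+1 x = 0.
Proof. by move=> x0; rewrite /ppow max_l// expr0n. Qed.

Lemma ppow_ge0 (R : realType) n (x : R) : 0 <= ppow n x.
Proof. by rewrite /ppow exprn_ge0// le_max lexx. Qed.

Lemma continuous_ppow (R : realType) n : continuous (@ppow R n).
Proof.
move=> x; rewrite /ppow.
apply: (@continuous_comp _ _ _ (fun x : R => Num.max 0 x) (fun y => y ^+ n)).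
  by apply: continuous_max; [exact: cvg_cst|exact: cvg_id].
exact: exprn_continuous.
Qed.

Global Instance is_derive_ppow (R : realType) n (x : R) :
  is_derive x 1 (@ppow R n.+2) (n.+2%:R * ppow n.+1 x).
Proof.
have [x0|x0|->] := ltgtP x 0.
- rewrite ppow_neg ?ltW// mulr0.
  have h : is_derive x 1 (cst 0 : R -> R) 0 by exact: is_derive_cst.
  apply: near_eq_is_derive h.
  near do rewrite /= ppow_neg//.
  by near=> y; rewrite ltW//; near: y; exact: lt_nbhsl.
- rewrite ppow_pos ?ltW//.
  have h : is_derive x 1 (fun x : R => x ^+ n.+2) (n.+2%:R * x ^+ n.+1).
    have := @is_deriveX R R^o id n.+2 x 1 1 (is_derive_id (x : R^o) 1).
    by rewrite exprfctE /= [_ *: _]mulr1.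
  apply: near_eq_is_derive h.
  near=> y; rewrite ppow_pos// ltW//.
  by near: y; exact: lt_nbhsr.
- have h0 : h^-1 *: (ppow n.+2 (h *: 1 + 0 : R) - ppow n.+2 (0 : R))
     @[h --> (0:R)^'] --> (0 : R).
    rewrite (ppow_neg n.+1 (lexx 0)).
    apply: (@cvg_trans _ (@ppow R n.+1 h @[h --> (0:R)^'])).
      apply: near_eq_cvg; near=> h.
      rewrite addr0 subr0 [h *: 1]mulr1 [RHS]mulrC.
      have [hp|hn] := leP 0 h.
        rewrite !ppow_pos// [X in _ = X / _]exprSr mulfK//.
        by near: h; exact: nbhs_dnbhs_neq.
      by rewrite !ppow_neg ?ltW// mul0r.
    have := @continuous_ppow R n.+1 0.
    rewrite /continuous_at ppow_neg// => h.
    by apply: cvg_trans h; apply: cvg_app; exact: nbhs_dnbhs.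
  rewrite ppow_neg// mulr0.
  apply: DeriveDef; first by apply/cvg_ex; exists 0.
  exact: cvg_lim h0.
Unshelve. all: by end_near. Qed.

(** The profile is [1] up to time [T] and nonpositive from [2 * T] on, so its
    truncated power [tcut] decreases from [1] to [0] on [[T, 2 * T]]; the suffixes
    [1] and [2] mark the first and second derivatives. *)
Definition tprof (R : realType) (T t : R) : R := 1 - ppow 3 (t / T - 1).
Definition tprof1 (R : realType) (T t : R) : R :=
  - (3 * ppow 2 (t / T - 1) / T).
Definition tprof2 (R : realType) (T t : R) : R :=
  - (3 * (2 * ppow 1 (t / T - 1) / T) / T).

Definition tcut (R : realType) (k : nat) (T t : R) : R :=
  ppow k.+3 (tprof T t).
Definition tcut1 (R : realType) (k : nat) (T t : R) : R :=
  k.+3%:R * ppow k.+2 (tprof T t) * tprof1 T t.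
Definition tcut2 (R : realType) (k : nat) (T t : R) : R :=
  k.+3%:R * (k.+2%:R * ppow k.+1 (tprof T t) * tprof1 T t) * tprof1 T t
  + k.+3%:R * ppow k.+2 (tprof T t) * tprof2 T t.

(** The next rules are those of the general theory on functions written with an
    explicit variable, the shape of all the profiles below. *)
Lemma is_derive1D (R : realType) (f g : R -> R) (x a b : R) :
  is_derive x 1 f a -> is_derive x 1 g b ->
  is_derive x 1 (fun z => f z + g z) (a + b).
Proof. by move=> fa gb; exact: (is_deriveD fa gb). Qed.

Lemma is_derive1M (R : realType) (f g : R -> R) (x a b : R) :
  is_derive x 1 f a -> is_derive x 1 g b ->
  is_derive x 1 (fun z => f z * g z) (a * g x + f x * b).
Proof.
move=> fa gb; have h := is_deriveM fa gb.
by apply: is_derive_eq; rewrite addrC [_ *: b]/GRing.scale/= mulrC [_ *: a]mulrC.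
Qed.

Lemma is_derive1_cst (R : realType) (c x : R) :
  is_derive x 1 (fun=> c) (0 : R).
Proof. exact: is_derive_cst. Qed.

Lemma is_derive1_id (R : realType) (x : R) : is_derive x 1 (fun z : R => z) (1 : R).
Proof. exact: is_derive_id. Qed.

Lemma is_derive1Ml (R : realType) (f : R -> R) (c x a : R) :
  is_derive x 1 f a -> is_derive x 1 (fun z => c * f z) (c * a).
Proof.
move=> fa; have := is_derive1M (is_derive1_cst c x) fa.
by rewrite mul0r add0r.
Qed.

Lemma is_derive1_expn (R : realType) (f : R -> R) (n : nat) (x a : R) :
  is_derive x 1 f a ->
  is_derive x 1 (fun z => f z ^+ n.+1) (n.+1%:R * f x ^+ n * a).
Proof. by move=> fa; have := is_deriveX n.+1 fa; rewrite exprfctE. Qed.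

Lemma is_derive_continuous (R : realType) (f df : R -> R) :
  (forall x : R, is_derive x 1 f (df x)) -> continuous f.
Proof.
move=> fd t; apply/differentiable_continuous/derivable1_diffP.
by case: (fd t).
Qed.

Lemma is_derive_affine_div (R : realType) (T t : R) :
  is_derive t 1 (fun t : R => t / T - 1) T^-1.
Proof.
have := is_derive1D (is_derive1M (is_derive1_id t) (is_derive1_cst T^-1 t))
  (is_derive1_cst (-1) t).
by rewrite mul1r mulr0 !addr0.
Qed.

Lemma is_derive_ppow_affine (R : realType) n (T t : R) :
  is_derive t 1 (fun t : R => ppow n.+2 (t / T - 1))
    (n.+2%:R * ppow n.+1 (t / T - 1) / T).
Proof.
have h := is_derive_affine_div T t.
exact: (@is_derive1_comp R (@ppow R n.+2) (fun t : R => t / T - 1)).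
Qed.

Lemma is_derive_tprof (R : realType) (T t : R) :
  is_derive t 1 (tprof T) (tprof1 T t).
Proof.
have := is_derive1D (is_derive1_cst 1 t)
  (is_derive1Ml (-1) (is_derive_ppow_affine 1 T t)).
rewrite add0r mulN1r (_ : (fun z => _) = tprof T)//.
by apply/funext => z; rewrite /tprof mulN1r.
Qed.

Lemma is_derive_tprof1 (R : realType) (T t : R) :
  is_derive t 1 (tprof1 T) (tprof2 T t).
Proof.
have h := is_derive1Ml (- (3 / T)) (is_derive_ppow_affine 0 T t).
rewrite (_ : tprof1 T = (fun t => - (3 / T) * ppow 2 (t / T - 1))).
  by apply: is_derive_eq; rewrite /tprof2; ring.
by apply/funext => z; rewrite /tprof1; ring.
Qed.

Lemma is_derive_tcut (R : realType) k (T t : R) :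
  is_derive t 1 (tcut k T) (tcut1 k T t).
Proof.
exact: (is_derive1_comp (is_derive_ppow k.+1 _) (is_derive_tprof T t)).
Qed.

Lemma is_derive_tcut1 (R : realType) k (T t : R) :
  is_derive t 1 (tcut1 k T) (tcut2 k T t).
Proof.
have h : is_derive t 1 (fun z => ppow k.+2 (tprof T z))
    (k.+2%:R * ppow k.+1 (tprof T t) * tprof1 T t).
  exact: (is_derive1_comp (is_derive_ppow k _) (is_derive_tprof T t)).
exact: (is_derive1M (is_derive1Ml k.+3%:R h) (is_derive_tprof1 T t)).
Qed.

Lemma continuous_ppow_comp (R : realType) n (f : R -> R) :
  continuous f -> continuous (fun t => ppow n (f t)).
Proof.
by move=> cf t; apply: continuous_comp; [exact: cf|exact: continuous_ppow].
Qed.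

Lemma continuous1M (R : realType) (f g : R -> R) :
  continuous f -> continuous g -> continuous (fun x => f x * g x).
Proof. by move=> cf cg x; apply: cvgM; [exact: cf|exact: cg]. Qed.

Lemma continuous1D (R : realType) (f g : R -> R) :
  continuous f -> continuous g -> continuous (fun x => f x + g x).
Proof. by move=> cf cg x; apply: cvgD; [exact: cf|exact: cg]. Qed.

Lemma continuous1_cst (R : realType) (c : R) : continuous (fun _ : R => c).
Proof. by move=> x; exact: cvg_cst. Qed.

Lemma continuous_tcut2 (R : realType) k (T : R) : continuous (tcut2 k T).
Proof.
have c0 := is_derive_continuous (is_derive_tprof T).
have c1 := is_derive_continuous (is_derive_tprof1 T).
have ct := @continuous1_cst R.
have c2 : continuous (tprof2 T).
  have hc := is_derive_continuous (is_derive_affine_div T).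
  rewrite (_ : tprof2 T = fun t => - 1 * (3 * (2 * ppow 1 (t / T - 1) / T) / T)).
    do ![apply: continuous1M => //]; exact: continuous_ppow_comp.
  by apply/funext => t; rewrite mulN1r.
apply: continuous1D.
  apply: continuous1M => //; apply: continuous1M => //.
  by apply: continuous1M => //; apply: continuous1M => //; exact: continuous_ppow_comp.
by apply: continuous1M => //; apply: continuous1M => //; exact: continuous_ppow_comp.
Qed.

(** * Functions of class C2 on the half-line *)

Lemma slope_in_eq (R : realType) (D : set R) (f g : R -> R) (s : R) :
  (forall z, D z -> f z = g z) -> D s ->
  (slope_at f s z @[z --> within D s^']) =
  (slope_at g s z @[z --> within D s^']).
Proof.
move=> fg Ds; rewrite eqEsubset; split; apply: near_eq_cvg;
  near=> z; rewrite /slope_at !fg//; near: z; exact: withinT.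
Unshelve. all: by end_near. Qed.

Lemma derive_in_eq (R : realType) (D : set R) (f g : R -> R) (s : R) :
  (forall z, D z -> f z = g z) -> D s -> derive_in D f s = derive_in D g s.
Proof. by move=> fg Ds; rewrite /derive_in (slope_in_eq fg Ds). Qed.

Lemma derivable_in_eq (R : realType) (D : set R) (f g : R -> R) (s : R) :
  (forall z, D z -> f z = g z) -> D s ->
  derivable_in D f s -> derivable_in D g s.
Proof. by move=> fg Ds; rewrite /derivable_in (slope_in_eq fg Ds). Qed.

Lemma proper_within_ray (R : realType) (s : R) : 0 <= s ->
  ProperFilter (within `[0, +oo[ s^').
Proof.
move=> s0; apply: (@proper_within_right _ _ s 1) => // z /andP[sz _].
by rewrite /= in_itv/= andbT (le_trans s0)// ltW.
Qed.

Lemma derive_in_ray (R : realType) (f f1 : R -> R) :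
  (forall x : R, is_derive x 1 f (f1 x)) ->
  forall t : R, 0 <= t ->
    derivable_in `[0, +oo[ f t /\ derive_in `[0, +oo[ f t = f1 t.
Proof.
move=> df t t0; apply: derive_in_is_derive (df t).
exact: proper_within_ray.
Qed.

(** For a function of class C2 on the whole line, the derivatives relative to
    the half-line are the usual ones, at [0] too. *)
Lemma C2_on_ray (R : realType) (f f1 f2 : R -> R) :
  (forall x : R, is_derive x 1 f (f1 x)) ->
  (forall x : R, is_derive x 1 f1 (f2 x)) -> continuous f2 ->
  [/\ C2_on `[0, +oo[ f,
      forall t, 0 <= t -> derive_in `[0, +oo[ f t = f1 t &
      forall t, 0 <= t ->
        derive_in `[0, +oo[ (derive_in `[0, +oo[ f) t = f2 t].
Proof.
move=> df df1 cf2; set D := `[0, +oo[%classic.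
have E1 t : 0 <= t -> derive_in D f t = f1 t.
  by move=> t0; rewrite (derive_in_ray df t0).2.
have E1' : forall z, D z -> f1 z = derive_in D f z.
  by move=> z; rewrite /D /= in_itv/= andbT => z0; rewrite E1.
have E2 t : 0 <= t -> derive_in D (derive_in D f) t = f2 t.
  move=> t0; rewrite -(derive_in_eq E1'); last by rewrite /D /= in_itv/= t0.
  by rewrite (derive_in_ray df1 t0).2.
split => //; split; split.
- by move=> s; rewrite /D /= in_itv/= andbT => s0; exact: (derive_in_ray df s0).1.
- apply: (@subspace_eq_continuous _ _ _ f1).
    by move=> z /set_mem zD; exact: E1'.
  by apply: continuous_subspaceT; exact: is_derive_continuous df1.
- move=> s Ds; apply: (derivable_in_eq E1' Ds).
  by move: Ds; rewrite /D /= in_itv/= andbT => s0; exact: (derive_in_ray df1 s0).1.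
- apply: (@subspace_eq_continuous _ _ _ f2).
    move=> z /set_mem; rewrite /D /= in_itv/= andbT => z0; exact/esym/E2.
  exact: continuous_subspaceT.
Qed.

(** * Integration on an interval *)

(** The derivative is merely integrable near the ends of the interval. The
    difference of [F] and of the primitive of [f] is continuous up to the ends
    with zero derivative inside, hence constant by the mean value theorem. *)
Lemma FTC2_open (R : realType) (F f : R -> R) (l : R) : 0 < l ->
  {within `[0, l], continuous F} ->
  (forall x : R, 0 < x < l -> is_derive x 1 F (f x)) ->
  (forall x : R, 0 < x < l -> {for x, continuous f}) ->
  (@lebesgue_measure R).-integrable `]0, l[ (EFin \o f) ->
  (\int[@lebesgue_measure R]_(x in `]0, l[) f x = F l - F 0)%R.
Proof.
move=> l0 cF dF cf intf.
(* The primitive is formed on the closed interval, to which [fb] extends [f] by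
   zero. *)
pose fb := f \_ `]0, l[.
have sub : `]0, l[%classic `<=` (`[0, l]%classic : set R).
  by apply: subset_itv_oo_cc.
have intfb : (@lebesgue_measure R).-integrable `[0, l] (EFin \o fb).
  rewrite /fb -restrict_EFin; apply/integrable_restrict => //=.
  by rewrite setIidr.
pose Phi x := (\int[@lebesgue_measure R]_(t in `[0, x]) fb t)%R.
have cPhi : {within `[0, l], continuous Phi}.
  exact: (parameterized_integral_continuous (ltW l0) intfb).
have dPhi x : 0 < x < l -> is_derive x 1 Phi (f x).
  move=> /andP[x0 xl].
  have cfb : {for x, continuous fb}.
    have nx : \forall y \near x, f y = fb y.
      near=> y; rewrite /fb patchE mem_set//= in_itv/=; apply/andP; split.
        by near: y; exact: lt_nbhsr.
      by near: y; exact: lt_nbhsl.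
    have h := cf x; rewrite x0 xl in h; have {}h := h isT.
    rewrite /prop_for /continuous_at -(nbhs_singleton nx).
    by apply: cvg_trans h; apply: near_eq_cvg; apply: filterS nx => y ->.
  have [dv E] := continuous_FTC1_closed xl intfb x0 cfb.
  apply: DeriveDef => //; rewrite -derive1E E /fb patchE mem_set//=.
  by rewrite in_itv/= x0 xl.
have dG x : x \in `]0, l[%R -> is_derive x 1 (fun z => F z + -1 * Phi z) (0:R).
  rewrite in_itv/= => xl.
  have := is_derive1D (dF _ xl) (is_derive1Ml (-1) (dPhi _ xl)).
  by rewrite mulN1r subrr.
have cG : {within `[0, l], continuous (fun z => F z + -1 * Phi z)}.
  move=> x; apply: cvgD; first exact: cF.
  by apply: cvgM; [exact: cvg_cst|exact: cPhi].
have [c _] := MVT l0 dG cG.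
rewrite mul0r => /eqP; rewrite subr_eq0 => /eqP.
have -> : Phi 0 = 0 by rewrite /Phi set_itv1 Rintegral_set1.
have -> : Phi l = (\int[@lebesgue_measure R]_(x in `]0, l[) f x)%R.
  by rewrite /Phi /fb -Rintegral_mkcondr setIidr.
rewrite mulr0 addr0 mulN1r => <-; ring.
Unshelve. all: by end_near. Qed.

(** A bound of the essential supremum holds almost everywhere, and constants are
    integrable on a bounded interval. *)
Lemma Linfty_integrable (R : realType) (f : R -> R) (l : R) :
  (forall x : R, 0 < x < l -> {for x, continuous f}) ->
  ('N[@lebesgue_measure R]_+oo [EFin \o (f \_ `]0%R, l[)] < +oo)%E ->
  (@lebesgue_measure R).-integrable `]0, l[ (EFin \o f).
Proof.
move=> cf; rewrite unlock ifT; last first.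
  apply: (@lt_le_trans _ _ (@lebesgue_measure R `]0%R, 1%R[)).
    by rewrite lebesgue_measure_itv/= lte01 sube0 lte_fin ltr01.
  by apply: le_measure; rewrite ?inE//; exact: subsetT.
move=> hN.
have mf : measurable_fun `]0, l[ f.
  apply: open_continuous_measurable_fun; first exact: interval_open.
  by move=> x /set_mem; rewrite /= in_itv/=; exact: cf.
have [M hM] : exists M : R,
    {ae (@lebesgue_measure R), forall x, `|(f \_ `]0, l[) x| <= M}.
  have [M hM] : exists M : R, (ess_sup (@lebesgue_measure R)
      (abse \o (EFin \o (f \_ `]0%R, l[))) <= M%:E)%E.
    move: hN; set N := ess_sup _ _; case: N => [r| |] // _; first by exists r.
    by exists 0; rewrite leNye.
  by exists M; move/ess_supP : hM; apply: filterS.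
apply/integrableP; split; first exact/measurable_EFinP.
apply: (@le_lt_trans _ _ (\int[@lebesgue_measure R]_(x in `]0%R, l[) `|M|%:E)%E).
  apply: ae_ge0_le_integral => //.
  - by apply/measurable_EFinP; apply: measurableT_comp.
  - move: hM; apply: (@filterS _ _ (ae_filter_ringOfSetsType _)) => x.
    rewrite patchE => hx xl; move: hx.
    by rewrite mem_set//= lee_fin => /le_trans; apply; exact: ler_norm.
rewrite integral_cst//= lebesgue_measure_itv/=.
by case: ifP => _; rewrite ?mule0// -EFinB -EFinM ltry.
Qed.

Lemma continuous_within_integrable_oo (R : realType) (f : R -> R) (l : R) :
  {within `[0, l], continuous f} ->
  (@lebesgue_measure R).-integrable `]0, l[ (EFin \o f).
Proof.
move=> cf; apply: (integrableS (mu := @lebesgue_measure R) (E := `[0, l]%classic)) => //.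
  exact: subset_itv_oo_cc.
by apply: continuous_compact_integrable => //; exact: segment_compact.
Qed.

(** The integral of a nonnegative function is the supremum of the integrals of
    the simple functions below it, so monotonicity is an inclusion between two
    sets of simple functions, whether or not [f] and [g] are measurable. *)
Lemma ge0_le_lower_integral d (T : measurableType d) (R : realType)
    (mu : {measure set T -> \bar R}) (D : set T) (f g : T -> \bar R) :
  (forall x, D x -> (0 <= f x)%E) -> (forall x, D x -> (f x <= g x)%E) ->
  (\int[mu]_(x in D) f x <= \int[mu]_(x in D) g x)%E.
Proof.
move=> f0 fg.
have g0 x : D x -> (0 <= g x)%E by move=> Dx; exact: le_trans (f0 _ Dx) (fg _ Dx).
rewrite !ge0_integralE//; apply: ereal_sup_le => _ [h hf <-]; exists h => //.
by move=> x; apply: le_trans (hf x) _; exact: lee_restrict.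
Qed.

(** Outside a null set the positive part of [f] lies below [g], and discarding a
    null set does not change the integral of the measurable function [f]. *)
Lemma le_integral_lower (R : realType) (D : set R) (f g : R -> \bar R) :
  measurable D ->
  (@lebesgue_measure R).-integrable D f ->
  (forall x, D x -> (0 <= g x)%E) ->
  {ae (@lebesgue_measure R), forall x, D x -> (f x <= g x)%E} ->
  (\int[@lebesgue_measure R]_(x in D) f x <=
   \int[@lebesgue_measure R]_(x in D) g x)%E.
Proof.
move=> mD intf g0 [N [mN N0 hN]].
have mf := measurable_int _ intf.
rewrite integralE; apply: (@le_trans _ _ (\int[@lebesgue_measure R]_(x in D) f^\+ x)%E).
  by rewrite -[leRHS]sube0; apply: leeB => //; apply: integral_ge0.
rewrite (ge0_negligible_integral mN)//; last first.
  exact: measurable_funepos.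
apply: (@le_trans _ _ (\int[@lebesgue_measure R]_(x in D `\` N) g x)%E).
  apply: ge0_le_lower_integral => // x [Dx nNx].
  rewrite funeposE ge_max g0// andbT.
  by apply: contrapT => h; apply: nNx; apply: hN => /= /(_ Dx).
rewrite [leLHS]integral_mkcond [leRHS]integral_mkcond.
apply: ge0_le_lower_integral => x _.
  by rewrite patchE; case: ifPn => // /set_mem [Dx _]; exact: g0.
rewrite !patchE; case: ifPn => [/set_mem [Dx _]|_]; first by rewrite mem_set.
by case: ifPn => // /set_mem; exact: g0.
Qed.

(** * Integration by parts on an edge *)

Lemma derive_in_interior (R : realType) (w : R -> R) (l s : R) :
  0 < s < l -> derivable w s 1 -> derive_in `[0, l] w s = derive1 w s.
Proof.
move=> /andP[s0 sl] dw.
have [] // := @derive_in_is_derive R `[0, l]%classic w s (derive1 w s).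
  apply: (@proper_within_right _ _ s (l - s)); first by rewrite subr_gt0.
  move=> z /andP[sz zl]; rewrite /= in_itv/= (le_trans (ltW s0) (ltW sz))/=.
  by rewrite ltW// (lt_le_trans zl)// addrC subrK.
by rewrite derive1E; exact: derivableP.
Qed.

(** This is the fundamental theorem of calculus for [A w' - A' w]. Since the
    slopes of [A] vanish at both ends, the boundary terms contain [w] only
    through its slopes, which is what the Kirchhoff condition can cancel. *)
Lemma edge_green (R : realType) (l : R) (w A A1 A2 : R -> R) : 0 < l ->
  {within `[0, l], continuous w} ->
  (forall s : R, 0 < s < l -> derivable w s 1) ->
  (forall s : R, 0 < s < l -> derivable (derive1 w) s 1) ->
  (forall s : R, 0 < s < l -> {for s, continuous (derive1 (derive1 w))}) ->
  {within `[0, l], continuous (derive_in `[0, l] w)} ->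
  ('N[@lebesgue_measure R]_+oo
     [EFin \o ((derive1 (derive1 w)) \_ `]0%R, l[)] < +oo)%E ->
  (forall s : R, is_derive s 1 A (A1 s)) ->
  (forall s : R, is_derive s 1 A1 (A2 s)) -> continuous A2 ->
  A1 0 = 0 -> A1 l = 0 ->
  (\int[@lebesgue_measure R]_(s in `]0, l[) (A s * derive1 (derive1 w) s) =
   A l * derive_in `[0, l] w l - A 0 * derive_in `[0, l] w 0 +
   \int[@lebesgue_measure R]_(s in `]0, l[) (A2 s * w s))%R.
Proof.
move=> l0 cw dw ddw cddw cg hN dA dA1 cA2 A10 A1l.
set g := derive_in `[0, l] w in cg *.
have cA := is_derive_continuous dA.
have cA1 := is_derive_continuous dA1.
have gE s : 0 < s < l -> g s = derive1 w s.
  by move=> sl; apply: derive_in_interior => //; exact: dw.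
have iA2w : (@lebesgue_measure R).-integrable `]0, l[
    (EFin \o (fun s => A2 s * w s)).
  apply: continuous_within_integrable_oo => s; apply: cvgM; last exact: cw.
  exact: (continuous_subspaceT cA2).
have iAw2 : (@lebesgue_measure R).-integrable `]0, l[
    (EFin \o (fun s => A s * derive1 (derive1 w) s)).
  have iw2 := Linfty_integrable cddw hN.
  rewrite (_ : _ \o _ = (EFin \o A) \* (EFin \o derive1 (derive1 w)))%E; last first.
    by apply/funext => s /=; rewrite EFinM.
  apply: integrableMr => //.
    by apply: measurable_funTS; exact: continuous_measurable_fun.
  have /compact_bounded[M [Mr hM]] : compact (A @` `[0, l]).
    apply: continuous_compact; last exact: segment_compact.
    exact: continuous_subspaceT.
  exists M; split => // x Mx y /= yl; apply: hM => //.
  by exists y => //; exact: subset_itv_oo_cc yl.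
pose F s := A s * g s + -1 * (A1 s * w s).
pose f s := A s * derive1 (derive1 w) s - A2 s * w s.
have FTC : (\int[@lebesgue_measure R]_(s in `]0, l[) f s = F l - F 0)%R.
  apply: FTC2_open => //.
- move=> s; apply: cvgD; apply: cvgM.
  + exact: (continuous_subspaceT cA).
  + exact: cg.
  + exact: cvg_cst.
  + by apply: cvgM; [exact: (continuous_subspaceT cA1)|exact: cw].
- move=> s sl.
  have dg : is_derive s 1 g (derive1 (derive1 w) s).
    have h : is_derive s 1 (derive1 w) (derive1 (derive1 w) s).
      by rewrite (derive1E (derive1 w)); apply: derivableP; exact: ddw.
    apply: near_eq_is_derive h.
    have /andP[s0 s1] := sl.
    near=> z; rewrite gE//; apply/andP; split.
      by near: z; exact: lt_nbhsr.
    by near: z; exact: lt_nbhsl.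
  have dw' : is_derive s 1 w (derive1 w s).
    by rewrite derive1E; apply: derivableP; exact: dw.
  apply: is_derive_eq (is_derive1D (is_derive1M (dA s) dg)
    (is_derive1Ml (-1) (is_derive1M (dA1 s) dw'))) _.
  by rewrite /f (gE _ sl); ring.
- move=> s sl; apply: cvgB; apply: cvgM.
  + exact: cA.
  + exact: cddw.
  + exact: cA2.
  + have /differentiable_continuous // : differentiable w s.
    by apply/derivable1_diffP; exact: dw.
  by apply: (integrableB _ iAw2 iA2w).
move: FTC; rewrite /f RintegralB// /F A1l A10 !mul0r !mulr0 !addr0.
by move=> <-; rewrite subrK.
Unshelve. all: by end_near. Qed.

(** * The path metric *)

Section Geometry.
Context {R : realType} {G : metric_graph R}.
Implicit Types (x y z : gpoint G) (v : vertex G) (e : edge G).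

Lemma ept_itv e (s : R) (H : 0 < s < len e) :
  ept e s = inr (exist _ (e, s) H).
Proof.
rewrite /ept; case: insubP => [q _ qE|]; last by rewrite H.
by congr inr; apply/val_inj; rewrite /= qE.
Qed.

Lemma ept_ini e (s : R) : s <= 0 -> ept e s = vpt (ini e).
Proof.
move=> s0; rewrite /ept insubF; last by rewrite /= ltNge s0.
by rewrite s0.
Qed.

Lemma ept_fin e (s : R) : len e <= s -> ept e s = vpt (fin e).
Proof.
move=> s0; rewrite /ept insubF; last by rewrite /= [s < _]ltNge s0 andbF.
by rewrite leNgt (lt_le_trans (len_gt0 e)).
Qed.

Variant gpoint_spec : gpoint G -> Prop :=
| GVertex v : gpoint_spec (vpt v)
| GInner e (s : R) of 0 < s < len e : gpoint_spec (ept e s).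

Lemma gpointP x : gpoint_spec x.
Proof.
case: x => [v|[[e s] H]]; first exact: GVertex.
by rewrite -(ept_itv H); exact: GInner.
Qed.

Lemma joined_ge0 x y (L : R) : joined x y L -> 0 <= L.
Proof. by elim=> {x y L} // x y z L L' _ ? _ ?; exact: addr_ge0. Qed.

Lemma dist_ge0 x y : 0 <= dist x y.
Proof.
rewrite /dist; have [[L h]|n0] := pselect ([set L | joined x y L] !=set0).
  by apply: lb_le_inf; [exists L|move=> M /= /joined_ge0].
by rewrite inf_out// => -[].
Qed.

Lemma joined_dist x y (L : R) : joined x y L -> dist x y <= L.
Proof.
by move=> h; apply: ge_inf => //; exists 0 => M /= /joined_ge0.
Qed.

Hypothesis conn : graph_connected G.

Lemma dist_triangle x y z (L : R) : joined x y L -> dist x z <= L + dist y z.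
Proof.
move=> xy; rewrite -lerBlDl; apply: lb_le_inf.
  by have [M h] := conn y z; exists M.
move=> M /= yz; rewrite lerBlDl; apply: joined_dist; exact: joined_cat xy yz.
Qed.

Lemma dist_lipschitz x y z (L : R) : joined x y L ->
  `|dist x z - dist y z| <= L.
Proof.
move=> xy; rewrite ler_norml; apply/andP; split.
  rewrite lerBrDl lerBlDl.
  exact: (dist_triangle z (joined_sym xy)).
by rewrite lerBlDr; exact: dist_triangle.
Qed.

Lemma dist_edge e (s t : R) z : 0 <= s <= len e -> 0 <= t <= len e ->
  `|dist (ept e s) z - dist (ept e t) z| <= `|s - t|.
Proof. by move=> hs ht; apply: dist_lipschitz; exact: joined_edge. Qed.

Lemma dist_continuous z : continuous (fun x : gpoint G => dist x z).
Proof.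
move=> x A /nbhs_ballP[eps /= eps0 hA]; apply/nbhs_ballP; exists eps => //= y.
move=> [L xy Le]; apply: hA.
exact: le_lt_trans (dist_lipschitz z xy) Le.
Qed.

Lemma ept_continuous e : {within `[0, len e], continuous (@ept R G e)}.
Proof.
apply/subspace_continuousP => s sl A /nbhs_ballP[eps /= eps0 epsA].
exists eps => // t /= st tl.
apply: epsA; exists `|s - t| => //.
by apply: joined_edge; [move: sl|move: tl]; rewrite /= in_itv.
Qed.

Lemma dist_ept_continuous e z : {within `[0, len e], continuous (fun s : R => dist (ept e s) z)}.
Proof.
apply/subspace_continuousP => s sl.
have /subspace_continuousP/(_ s sl) h := @ept_continuous e.
exact: (cvg_comp _ _ h (@dist_continuous z (ept e s))).
Qed.

Lemma closed_cball z (rho : R) : closed [set x : gpoint G | dist x z <= rho].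
Proof.
rewrite (_ : mkset _ = (fun x : gpoint G => dist x z) @^-1` [set r | r <= rho])//.
apply: preimage_closed; first by move=> x _; exact: dist_continuous.
exact: closed_le.
Qed.

(** The ball lies in the union of finitely many vertices and finitely many closed
    edges, the latter being continuous images of segments. *)
Lemma compact_cball z (rho : R) : meets_finitely_many (gball z (rho + 1)) ->
  compact [set x : gpoint G | dist x z <= rho].
Proof.
move=> [fV fE].
pose K := (\bigcup_(v in [set v | gball z (rho + 1) (vpt v)]) [set vpt v]) `|`
  (\bigcup_(e in [set e | exists2 s, 0 < s < len e & gball z (rho + 1) (ept e s)])
     (@ept R G e @` `[0, len e])).
apply: (@subclosed_compact _ _ K); first exact: closed_cball.
- apply: compactU.
    rewrite -bigsetU_fset_set//; apply: bigsetU_compact => v _; exact: compact_set1.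
  rewrite -bigsetU_fset_set//; apply: bigsetU_compact => e _; apply: continuous_compact.
    exact: ept_continuous.
  exact: segment_compact.
- move=> x; case: (gpointP x) => [v|e s sl] /= hx.
    left; exists v => //=; rewrite /gball /=.
    by rewrite (le_lt_trans hx)// ltrDl.
  right; exists e.
    by exists s => //; rewrite /gball /= (le_lt_trans hx)// ltrDl.
  exists s => //=; rewrite in_itv/=.
  by case/andP: sl => s0 s1; rewrite !ltW.
Qed.

End Geometry.

(** * The cutoff in space *)

(** The cubic that takes the values [0] at [0] and [1] at [1] with zero slope at
    both points. *)
Definition smoothstep (R : realType) (x : R) : R := 3 * x ^+ 2 - 2 * x ^+ 3.

Lemma smoothstep_itv (R : realType) (x : R) : 0 <= x <= 1 ->
  0 <= smoothstep x <= 1.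
Proof.
move=> /andP[x0 x1]; rewrite /smoothstep; apply/andP; split.
  rewrite (_ : _ - _ = x ^+ 2 * (3 - 2 * x)); last by ring.
  by rewrite mulr_ge0 ?sqr_ge0//; lra.
rewrite -subr_ge0 (_ : _ - _ = (1 - x) ^+ 2 * (1 + 2 * x)); last by ring.
by rewrite mulr_ge0 ?sqr_ge0//; lra.
Qed.

Definition edgeprof (R : realType) (p q l s : R) : R :=
  p + (q - p) * smoothstep (s / l).
Definition edgeprof1 (R : realType) (p q l s : R) : R :=
  (q - p) * (6 * (s / l) - 6 * (s / l) ^+ 2) / l.
Definition edgeprof2 (R : realType) (p q l s : R) : R :=
  (q - p) * (6 - 12 * (s / l)) / l ^+ 2.

Lemma edgeprofE (R : realType) (p q l s : R) :
  edgeprof p q l s = (1 - smoothstep (s / l)) * p + smoothstep (s / l) * q.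
Proof. by rewrite /edgeprof; ring. Qed.

Lemma is_derive_scale (R : realType) (l s : R) :
  is_derive s 1 (fun s : R => s / l) l^-1.
Proof.
have := is_derive1M (is_derive1_id s) (is_derive1_cst l^-1 s).
by rewrite mul1r mulr0 addr0.
Qed.

Lemma is_derive_edgeprof (R : realType) (p q l s : R) :
  is_derive s 1 (edgeprof p q l) (edgeprof1 p q l s).
Proof.
have d1 := is_derive_scale l s.
have d2 := is_derive1Ml 3 (is_derive1_expn 1 d1).
have d3 := is_derive1Ml (-2) (is_derive1_expn 2 d1).
have := is_derive1D (is_derive1_cst p s) (is_derive1Ml (q - p) (is_derive1D d2 d3)).
rewrite (_ : (fun z => _) = edgeprof p q l); last first.
  by apply/funext => z; rewrite /edgeprof /smoothstep mulNr.
by move=> h; apply: is_derive_eq; rewrite /edgeprof1; ring.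
Qed.

Lemma is_derive_edgeprof1 (R : realType) (p q l s : R) :
  is_derive s 1 (edgeprof1 p q l) (edgeprof2 p q l s).
Proof.
have d1 := is_derive_scale l s.
have d2 := is_derive1Ml (-6) (is_derive1_expn 1 d1).
have := is_derive1Ml ((q - p) / l) (is_derive1D (is_derive1Ml 6 d1) d2).
rewrite (_ : (fun z => _) = edgeprof1 p q l); last first.
  by apply/funext => z; rewrite /edgeprof1; ring.
move=> h; apply: is_derive_eq; rewrite /edgeprof2 -exprVn; ring.
Qed.

Lemma edgeprof_itv (R : realType) (p q l s : R) : 0 < l -> 0 <= s <= l ->
  0 <= p <= 1 -> 0 <= q <= 1 -> 0 <= edgeprof p q l s <= 1.
Proof.
move=> l0 /andP[s0 sl] /andP[p0 p1] /andP[q0 q1].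
have /andP[a0 a1] : 0 <= smoothstep (s / l) <= 1.
  by apply: smoothstep_itv; rewrite divr_ge0 ?(ltW l0)//= ler_pdivrMr// mul1r.
rewrite edgeprofE; move: (smoothstep _) a0 a1 => a a0 a1.
by apply/andP; split; nra.
Qed.

(** Equal to [1] up to the distance [rho], to [0] from [kap * rho] on, and affine
    in between. *)
Definition cutd (R : realType) (kap rho d : R) : R :=
  Num.min 1 (Num.max 0 ((kap - d / rho) / (kap - 1))).

Section Cutd.
Context {R : realType}.
Variables (kap : R) (kap1 : 1 < kap).

Lemma cutd_itv (rho d : R) : 0 <= cutd kap rho d <= 1.
Proof. by rewrite /cutd le_min ler01 le_max lexx/= ge_min lexx. Qed.

Lemma cutd_eq1 (rho d : R) : 0 < rho -> d <= rho -> cutd kap rho d = 1.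
Proof.
move=> r0 dr; rewrite /cutd min_l// le_max; apply/orP; right.
rewrite ler_pdivlMr ?subr_gt0// mul1r lerB//.
by rewrite ler_pdivrMr// mul1r.
Qed.

Lemma cutd_eq0 (rho d : R) : 0 < rho -> kap * rho <= d -> cutd kap rho d = 0.
Proof.
move=> r0 dr; rewrite /cutd max_l ?min_r ?ler01//.
rewrite pmulr_lle0 ?invr_gt0 ?subr_gt0// subr_le0.
by rewrite ler_pdivlMr.
Qed.

Lemma cutd_mono (rho rho' d : R) : 0 < rho' -> rho' <= rho -> 0 <= d ->
  cutd kap rho' d <= cutd kap rho d.
Proof.
move=> r0 rr d0; rewrite /cutd le_min2 ?le_max2//.
rewrite ler_wpM2r ?invr_ge0 ?subr_ge0 ?(ltW kap1)// lerB//.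
by rewrite ler_wpM2l// lef_pV2// posrE// (lt_le_trans r0).
Qed.

Lemma clamp_lip (a b : R) :
  `|Num.min 1 (Num.max 0 a) - Num.min 1 (Num.max 0 b)| <= `|a - b|.
Proof.
wlog ab : a b / a <= b.
  move=> H; have [/H//|/ltW/H] := leP a b.
  by rewrite distrC [in leRHS]distrC.
have h : Num.min 1 (Num.max 0 a) <= Num.min 1 (Num.max 0 b) by rewrite le_min2// le_max2.
rewrite distrC ger0_norm ?subr_ge0// distrC ger0_norm ?subr_ge0//.
rewrite /Num.min /Num.max.
by case: (ltP 0 a) => ?; case: (ltP 0 b) => ?; case: ltP => ?; case: ltP => ?; lra.
Qed.

Lemma cutd_lip (rho d d' : R) : 0 < rho ->
  `|cutd kap rho d - cutd kap rho d'| <= `|d - d'| / ((kap - 1) * rho).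
Proof.
move=> r0; apply: (le_trans (clamp_lip _ _)).
have k0 : 0 < kap - 1 by rewrite subr_gt0.
rewrite (_ : _ - _ = - (d - d') / ((kap - 1) * rho)); last first.
  by field; rewrite !gt_eqF.
by rewrite normrM normrN [X in _ * X]gtr0_norm// invr_gt0 mulr_gt0.
Qed.
End Cutd.

Definition vcut (R : realType) (G : metric_graph R) (x0 : vertex G)
    (kap rho : R) (v : vertex G) : R :=
  cutd kap rho (dist (vpt v) (vpt x0)).

(** The distance is used at the vertices only: along an edge the cutoff is
    interpolated, with zero slope at both ends. A cutoff of the distance itself
    would have corners, and its slopes at the vertices would enter Green's
    formula. *)
Definition gcut (R : realType) (G : metric_graph R) (x0 : vertex G)
    (kap rho : R) (x : gpoint G) : R :=
  match x with
  | inl v => vcut x0 kap rho v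
  | inr q => edgeprof (vcut x0 kap rho (ini (val q).1))
               (vcut x0 kap rho (fin (val q).1)) (len (val q).1) (val q).2
  end.

Section Gcut.
Context {R : realType} {G : metric_graph R}.
Variables (x0 : vertex G) (kap : R) (kap1 : 1 < kap).
Hypothesis conn : graph_connected G.
Variables (j : R).
Hypothesis j0 : 0 <= j.
Hypothesis lenj : forall e : edge G, len e <= j.

Local Notation delta x := (dist x (vpt x0)).
Local Notation vc := (vcut x0 kap).
Local Notation gc := (gcut x0 kap).

Lemma gcut_ept (rho : R) (e : edge G) (s : R) : 0 <= s <= len e ->
  gc rho (ept e s) = edgeprof (vc rho (ini e)) (vc rho (fin e)) (len e) s.
Proof.
move=> /andP[]; rewrite le_eqVlt => /predU1P[<- _|s0].
  by rewrite ept_ini//= /edgeprof /smoothstep mul0r !expr0n/= !mulr0 subrr mulr0 addr0.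
rewrite le_eqVlt => /predU1P[->|sl].
  rewrite ept_fin//= /edgeprof /smoothstep divff ?gt_eqF ?len_gt0//.
  by rewrite !expr1n; ring.
have H : 0 < s < len e by rewrite s0.
by rewrite (ept_itv H).
Qed.

Lemma vcut_itv (rho : R) v : 0 <= vc rho v <= 1.
Proof. exact: cutd_itv. Qed.

Lemma edgeprof_vcut_itv (rho : R) e (s : R) : 0 <= s <= len e ->
  0 <= edgeprof (vc rho (ini e)) (vc rho (fin e)) (len e) s <= 1.
Proof.
by move=> sl; apply: edgeprof_itv => //; rewrite ?len_gt0// vcut_itv.
Qed.

Lemma gcut_itv (rho : R) x : 0 <= gc rho x <= 1.
Proof.
case: (gpointP x) => [v|e s sl]; first exact: vcut_itv.
have sl' : 0 <= s <= len e by case/andP: sl => *; rewrite !ltW.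
by rewrite gcut_ept//; exact: edgeprof_vcut_itv.
Qed.

Lemma dist_ini e (s : R) : 0 <= s <= len e ->
  `|delta (ept e s) - delta (vpt (ini e))| <= j.
Proof.
move=> /andP[s0 sl].
have := @dist_edge R G conn e s 0 (vpt x0).
rewrite s0 sl lexx (ltW (len_gt0 e)) (@ept_ini _ _ _ 0)//= => /(_ isT isT)/le_trans; apply.
by rewrite subr0 ger0_norm// (le_trans sl).
Qed.

Lemma dist_fin e (s : R) : 0 <= s <= len e ->
  `|delta (ept e s) - delta (vpt (fin e))| <= j.
Proof.
move=> /andP[s0 sl].
have := @dist_edge R G conn e s (len e) (vpt x0).
rewrite s0 sl lexx (ltW (len_gt0 e)) (@ept_fin _ _ _ (len e))//= => /(_ isT isT)/le_trans; apply.
rewrite distrC ger0_norm ?subr_ge0//.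
by rewrite (le_trans _ (lenj e))// gerBl.
Qed.

Lemma dist_ends e : `|delta (vpt (fin e)) - delta (vpt (ini e))| <= j.
Proof.
by rewrite -(@ept_fin _ _ e (len e))//; apply: dist_ini; rewrite lexx (ltW (len_gt0 e)).
Qed.

Lemma dist_adjacent v w : gadjacent v w ->
  `|delta (vpt v) - delta (vpt w)| <= j.
Proof.
by case=> e [] [<- <-]; rewrite 1?distrC ?dist_ends// distrC dist_ends.
Qed.

(** The cutoff on an edge is governed by the ends of the edge, which are at most
    [j] away; hence the shift of the radius by [j], here and below. *)
Lemma gcut_supp (rho : R) x : 0 < rho -> gc rho x != 0 ->
  delta x < kap * rho + j.
Proof.
move=> r0; rewrite ltNge; apply: contraNN => hx; apply/eqP.
case: (gpointP x) hx => [v|e s sl] hx.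
  rewrite /=; apply: cutd_eq0 => //; by apply: le_trans hx; rewrite lerDl.
have sl' : 0 <= s <= len e by case/andP: sl => *; rewrite !ltW.
have := dist_ini sl'; have := dist_fin sl'.
rewrite !ler_norml => /andP[_ h1] /andP[_ h2].
rewrite gcut_ept// /vcut !cutd_eq0//; last 2 first.
- by move: hx h1; lra.
- by move: hx h2; lra.
by rewrite /edgeprof; ring.
Qed.

Lemma gcut_eq1 (rho : R) x : 0 < rho -> delta x <= rho - j -> gc rho x = 1.
Proof.
move=> r0; case: (gpointP x) => [v|e s sl] hx.
  by rewrite /= /vcut cutd_eq1// (le_trans hx)// gerBl.
have sl' : 0 <= s <= len e by case/andP: sl => *; rewrite !ltW.
have := dist_ini sl'; have := dist_fin sl'.
rewrite !ler_norml => /andP[h1 _] /andP[h2 _].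
rewrite gcut_ept// /vcut !cutd_eq1//; last 2 first.
- by move: hx h1; lra.
- by move: hx h2; lra.
by rewrite /edgeprof; ring.
Qed.

Lemma vcut_mono (rho rho' : R) v : 0 < rho' -> rho' <= rho ->
  vc rho' v <= vc rho v.
Proof. by move=> r0 rr; apply: cutd_mono => //; exact: dist_ge0. Qed.

Lemma gcut_mono (rho rho' : R) x : 0 < rho' -> rho' <= rho ->
  gc rho' x <= gc rho x.
Proof.
move=> r0 rr; case: (gpointP x) => [v|e s sl]; first exact: vcut_mono.
have sl' : 0 <= s <= len e by case/andP: sl => *; rewrite !ltW.
rewrite !gcut_ept// !edgeprofE.
have /andP[a0 a1] : 0 <= smoothstep (s / len e) <= 1.
  apply: smoothstep_itv; case/andP: sl => *.
  rewrite ler_pdivrMr ?len_gt0// mul1r.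
  by apply/andP; split; [rewrite divr_ge0 ?ltW ?len_gt0|exact: ltW].
have h v := vcut_mono v r0 rr.
have b0 : 0 <= 1 - smoothstep (s / len e) by rewrite subr_ge0.
exact: lerD (ler_wpM2l b0 (h _)) (ler_wpM2l a0 (h _)).
Qed.

Lemma vcut_lip (rho : R) v w : 0 < rho ->
  `|delta (vpt v) - delta (vpt w)| <= j ->
  `|vc rho v - vc rho w| <= j / ((kap - 1) * rho).
Proof.
move=> r0 h; apply: (le_trans (cutd_lip kap1 _ _ r0)).
by rewrite ler_wpM2r// invr_ge0 mulr_ge0 ?subr_ge0 ?(ltW r0)// ltW.
Qed.

(** Two points on the same side of the annulus see the same constant. *)
Lemma vcut_annulus (rho : R) v w : 0 < rho ->
  `|delta (vpt v) - delta (vpt w)| <= j -> vc rho v != vc rho w ->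
  rho - j <= delta (vpt v) <= kap * rho + j.
Proof.
move=> r0; rewrite ler_norml => /andP[h1 h2] vw.
have rk : rho <= kap * rho by rewrite ler_peMl// ltW.
apply/andP; split; rewrite leNgt; apply: contraNN vw => hv; apply/eqP;
  rewrite /vcut.
  by rewrite !cutd_eq1//; move: hv h1 h2; lra.
by rewrite !cutd_eq0//; move: hv h1 h2; lra.
Qed.

Lemma gcut_far (rho : R) x : 0 < rho -> kap * rho + j <= delta x -> gc rho x = 0.
Proof.
move=> r0 hx; apply/eqP; apply: contraTT hx => /gcut_supp -/(_ r0).
by rewrite ltNge.
Qed.

End Gcut.

(** * The test functions *)

Lemma tcut_itv (R : realType) k (T t : R) : 0 <= tcut k T t <= 1.
Proof.
rewrite /tcut ppow_ge0/= /ppow exprn_ile1 ?le_max ?lexx// ge_max ler01/=.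
by rewrite /tprof gerBl ppow_ge0.
Qed.

Lemma tprof_eq1 (R : realType) (T t : R) : 0 < T -> t <= T -> tprof T t = 1.
Proof.
move=> T0 tT; rewrite /tprof ppow_neg ?subr0// subr_le0.
by rewrite ler_pdivrMr// mul1r.
Qed.

Lemma tcut_eq1 (R : realType) k (T t : R) : 0 < T -> t <= T -> tcut k T t = 1.
Proof.
by move=> T0 tT; rewrite /tcut tprof_eq1// ppow_pos// expr1n.
Qed.

Lemma tprof_le0 (R : realType) (T t : R) : 0 < T -> 2 * T <= t ->
  tprof T t <= 0.
Proof.
move=> T0 tT; have h : 1 <= t / T - 1.
  rewrite lerBrDr ler_pdivlMr//; lra.
rewrite /tprof ppow_pos ?subr_le0 ?exprn_ege1//; lra.
Qed.

Lemma tcut_eq0 (R : realType) k (T t : R) : 0 < T -> 2 * T <= t ->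
  tcut k T t = 0.
Proof. by move=> T0 tT; rewrite /tcut ppow_neg// tprof_le0. Qed.

Lemma tcut2_eq0 (R : realType) k (T t : R) : 0 < T -> 2 * T <= t ->
  tcut2 k T t = 0.
Proof.
by move=> T0 tT; rewrite /tcut2 !ppow_neg ?tprof_le0// !(mulr0, mul0r) addr0.
Qed.

Lemma tcut1_0 (R : realType) k (T : R) : 0 < T -> tcut1 k T 0 = 0.
Proof.
by move=> T0; rewrite /tcut1 /tprof1 mul0r sub0r (@ppow_neg _ 1) ?oppr_le0// mulr0 mul0r oppr0 mulr0.
Qed.

Lemma tcut2_early (R : realType) k (T t : R) : 0 < T -> t <= T -> tcut2 k T t = 0.
Proof.
move=> T0 tT; have h : t / T - 1 <= 0 by rewrite subr_le0 ler_pdivrMr// mul1r.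
by rewrite /tcut2 /tprof1 /tprof2 !(ppow_neg _ h) !(mulr0, mul0r, oppr0) addr0.
Qed.

Lemma tprof_mono (R : realType) (T T' t : R) : 0 < T' -> T' <= T -> 0 <= t ->
  tprof T' t <= tprof T t.
Proof.
move=> T0 TT t0; rewrite /tprof lerB// /ppow.
have h : t / T <= t / T'.
  by rewrite ler_wpM2l// lef_pV2// posrE// (lt_le_trans T0).
apply: lerXn2r; first (by rewrite nnegrE le_max lexx);
  first by rewrite nnegrE le_max lexx.
by apply: le_max2 => //; exact: lerB.
Qed.

Lemma tcut_mono (R : realType) k (T T' t : R) : 0 < T' -> T' <= T -> 0 <= t ->
  tcut k T' t <= tcut k T t.
Proof.
move=> T0 TT t0; rewrite /tcut /ppow; apply: lerXn2r; first (by rewrite nnegrE le_max lexx);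
  first by rewrite nnegrE le_max lexx.
by apply: le_max2 => //; exact: tprof_mono.
Qed.

Lemma tcut2_bounded (R : realType) k (T : R) : 0 < T ->
  exists M : R, forall t, 0 <= t -> `|tcut2 k T t| <= M.
Proof.
move=> T0.
have /compact_bounded[M [Mr hM]] : compact (tcut2 k T @` `[0, 2 * T]).
  apply: continuous_compact; last exact: segment_compact.
  by apply: continuous_subspaceT; exact: continuous_tcut2.
exists (`|M| + 1) => t t0.
have [tT|Tt] := leP (2 * T) t; first by rewrite tcut2_eq0// normr0 addr_ge0.
apply: hM; first by rewrite (le_lt_trans (ler_norm _))// ltrDl.
by exists t => //=; rewrite in_itv/= t0 ltW.
Qed.

(** Two derivatives of a power [k.+3] of a cutoff leave at least its power
    [k.+1], which [young_absorption] turns back into the power [k.+3]. *)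
Definition cutoff (R : realType) (G : metric_graph R) (x0 : vertex G)
    (kap rho : R) (k : nat) (T : R) (x : gpoint G) (t : R) : R :=
  gcut x0 kap rho x ^+ k.+3 * tcut k T t.

Section Cutoff.
Context {R : realType} {G : metric_graph R}.
Variables (x0 : vertex G) (kap : R) (kap1 : 1 < kap).
Hypothesis conn : graph_connected G.
Variables (j : R).
Hypothesis j0 : 0 <= j.
Hypothesis lenj : forall e : edge G, len e <= j.
Variables (k : nat) (rho T : R).
Hypothesis rho0 : 0 < rho.
Hypothesis T0 : 0 < T.
Hypothesis fin_ball : forall r : R, 0 < r -> meets_finitely_many (gball (vpt x0) r).

Local Notation gc := (gcut x0 kap).
Local Notation phi := (cutoff x0 kap rho k T).

Lemma cutoff_C2 x :
  [/\ C2_on `[0, +oo[ (phi x),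
      forall t, 0 <= t -> dt phi x t = gc rho x ^+ k.+3 * tcut1 k T t &
      forall t, 0 <= t -> dt (dt phi) x t = gc rho x ^+ k.+3 * tcut2 k T t].
Proof.
apply: C2_on_ray.
- by move=> t; apply: is_derive1Ml; exact: is_derive_tcut.
- by move=> t; apply: is_derive1Ml; exact: is_derive_tcut1.
- by apply: continuous1M; [exact: continuous1_cst|exact: continuous_tcut2].
Qed.

Lemma cutoff_itv x t : 0 <= phi x t <= 1.
Proof.
have /andP[a0 a1] := gcut_itv x0 kap rho x.
have /andP[b0 b1] := tcut_itv k T t.
rewrite /cutoff; apply/andP; split.
  by apply: mulr_ge0 => //; exact: exprn_ge0.
rewrite -[leRHS]mulr1; apply: ler_pM => //; first exact: exprn_ge0.
exact: exprn_ile1.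
Qed.

Lemma measurable_gcut_ept e : measurable_fun `]0, len e[ (gc rho \o ept e).
Proof.
apply: (eq_measurable_fun
  (edgeprof (vcut x0 kap rho (ini e)) (vcut x0 kap rho (fin e)) (len e))).
  move=> s /set_mem /=; rewrite in_itv/= => /andP[s0 s1].
  by rewrite gcut_ept// !ltW.
apply: measurable_funTS; apply: continuous_measurable_fun.
exact: is_derive_continuous (is_derive_edgeprof _ _ _).
Qed.

Lemma cutoff_measurable : measurable_xt phi.
Proof.
have mt : measurable_fun setT (tcut k T).
  apply: continuous_measurable_fun; exact: is_derive_continuous (is_derive_tcut _ _).
split=> [v|e].
  apply: measurable_funTS; apply: measurable_funM => //.
apply: (@measurable_funM _ _ _ _ (fun p : R * R => gc rho (ept e p.1) ^+ k.+3)
   (fun p => tcut k T p.2)).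
  apply: measurable_funX.
  apply: (measurable_comp (F := `]0, len e[%classic) (f := gc rho \o ept e) (g := fst)) => //.
  - by move=> _ [[s t] [/= h _] <-].
  - exact: measurable_gcut_ept.
  - by apply: measurable_funTS; exact: measurable_fst.
apply: measurable_funTS; apply: measurableT_comp => //; exact: measurable_snd.
Qed.

(** The support lies in the product of a closed ball, compact because it meets
    finitely many vertices and edges, and of the time interval [[0, 2 * T]]. *)
Lemma test_function_cutoff : test_function phi.
Proof.
split.
- by move=> x t _; case/andP: (cutoff_itv x t).
- exists [set x : gpoint G | dist x (vpt x0) <= kap * rho + j], (2 * T).
  have kr0 : 0 < kap * rho + j + 1.
    by rewrite ltr_pwDr// addr_ge0// mulr_ge0 ?(ltW rho0)// ltW// (lt_trans ltr01).
  split.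
  + apply: compact_cball => //; exact: fin_ball.
  + by rewrite mulr_gt0.
  + set A := mkset (fun x : gpoint G => _ <= kap * rho + j); set B := `[0, 2 * T]%classic.
    have clAB : closed (A `*` B).
      rewrite (_ : A `*` B = fst @^-1` A `&` snd @^-1` B)//.
      apply: closedI; apply: preimage_closed.
      * by move=> p _; exact: cvg_fst.
      * exact: closed_cball.
      * by move=> p _; exact: cvg_snd.
      * exact: interval_closed.
    rewrite [X in _ `<=` X](closure_id _).1//; apply: closureS.
    move=> [x t] [/= t0]; rewrite /cutoff mulf_eq0 negb_or => /andP[gx tx].
    split; rewrite /A /B /=.
      have gx0 : gc rho x != 0 by apply: contraNN gx => /eqP ->; rewrite expr0n.
      exact/ltW/gcut_supp.
    rewrite in_itv/= t0/= leNgt; apply: contraNN tx => tT.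
    by rewrite tcut_eq0// ltW.
- by move=> x; case: (cutoff_C2 x).
- exact: cutoff_measurable.
- have [M hM] := tcut2_bounded k T0.
  exists (1 + M) => x t t0; have M0 : 0 <= M by exact: le_trans (hM _ t0).
  have /andP[a0 a1] := cutoff_itv x t.
  split; first by rewrite ger0_norm// (le_trans a1)// lerDl.
  case: (cutoff_C2 x) => _ _ ->//.
  have /andP[b0 b1] := gcut_itv x0 kap rho x.
  rewrite normrM ger0_norm ?exprn_ge0//.
  apply: (@le_trans _ _ M); last by rewrite lerDr.
  rewrite -[leRHS]mul1r ler_pM ?exprn_ge0 ?exprn_ile1//; exact: hM.
Qed.
End Cutoff.

(** * Green's formula on the graph *)

Lemma esum_seq (R : realType) (T : choiceType) (f : T -> \bar R) (r : seq T) :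
  uniq r -> (forall x, (0 <= f x)%E) -> (forall x, x \notin r -> f x = 0%E) ->
  (\esum_(x in [set: T]) f x = \sum_(x <- r) f x)%E.
Proof.
move=> ur f0 fr; rewrite fsbig_seq// -(esum_fset (F := [set` r])) //.
rewrite [RHS]esum_mkcond; apply: eq_esum => x _.
by case: ifPn => // h; rewrite fr//; apply: contraNN h => h; rewrite inE.
Qed.

Lemma esum_ge_seq (R : realType) (T : choiceType) (f : T -> \bar R) (r : seq T) :
  uniq r -> (\sum_(x <- r) f x <= \esum_(x in [set: T]) f x)%E.
Proof.
by move=> ur; apply: esum_ge; exists [set` r] => //; rewrite fsbig_seq.
Qed.

Section GraphIntegral.
Context {R : realType} {G : metric_graph R} (W : graph_weights G).
Implicit Types (f g : gpoint G -> R).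

Local Notation mu := (@lebesgue_measure R).

Definition edge_integrable f (e : edge G) : Prop :=
  mu.-integrable `]0, len e[ (EFin \o (f \o ept e)).

Lemma gintegrable_edge f : gintegrable W f -> forall e, edge_integrable f e.
Proof.
move=> [mf ff] e; rewrite /edge_integrable; apply/integrableP; split.
  apply/measurable_EFinP; exact: (mf e).
apply: le_lt_trans ff; apply: (@le_trans _ _
  (\esum_(e in [set: edge G]) \int[mu]_(s in `]0%R, len e[) `|f (ept e s)|%:E)%E).
  have := @esum_ge_seq R _ (fun e : edge G =>
    (\int[mu]_(s in `]0%R, len e[) `|f (ept e s)|%:E)%E) [:: e] isT.
  by rewrite big_seq1.
rewrite /gintegral_ge0 leeDr//; apply: esum_ge0 => x _.
by rewrite mule_ge0// lee_fin ltW// vmu_gt0.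
Qed.

Definition gsum (VF : seq (vertex G)) (EF : seq (edge G)) f : R :=
  \sum_(x <- VF) vmu W x * f (vpt x) +
  \sum_(e <- EF) (\int[mu]_(s in `]0, len e[) f (ept e s))%R.

Variables (VF : seq (vertex G)) (EF : seq (edge G)).
Hypothesis uV : uniq VF.
Hypothesis uE : uniq EF.

Definition gsupported f : Prop :=
  (forall x, x \notin VF -> f (vpt x) = 0) /\
  (forall e s, e \notin EF -> 0 < s < len e -> f (ept e s) = 0).

Lemma gintegral_ge0_sum (F : gpoint G -> \bar R) :
  (forall x, (0 <= F x)%E) ->
  (forall x, x \notin VF -> F (vpt x) = 0%E) ->
  (forall e s, e \notin EF -> 0 < s < len e -> F (ept e s) = 0%E) ->
  (gintegral_ge0 W F = \sum_(x <- VF) (vmu W x)%:E * F (vpt x) +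
   \sum_(e <- EF) \int[mu]_(s in `]0%R, len e[) F (ept e s))%E.
Proof.
move=> F0 FV FE; rewrite /gintegral_ge0; congr (_ + _)%E; apply: esum_seq => //.
- by move=> x; rewrite mule_ge0// lee_fin ltW// vmu_gt0.
- by move=> x xV; rewrite FV// mule0.
- by move=> e; apply: integral_ge0.
- move=> e eE; rewrite integral0_eq// => s /=; rewrite in_itv/=.
  exact: FE.
Qed.

(** For a finitely supported function the two series of the definition are finite
    sums of finite integrals, and the positive and negative parts recombine term
    by term. *)
Lemma gintegralE f : gsupported f -> (forall e, edge_integrable f e) ->
  gintegral W f = (gsum VF EF f)%:E.
Proof.
move=> [fV fE] intf; rewrite /gintegral.
pose fp x := Num.max (f x) 0; pose fn x := Num.max (- f x) 0.
have Ep : ((EFin \o f)^\+)%E = EFin \o fp.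
  by apply/funext => x; rewrite /fp /= funeposE /= EFin_max.
have En : ((EFin \o f)^\-)%E = EFin \o fn.
  by apply/funext => x; rewrite /fn /= funenegE /= EFin_max.
have ip e : edge_integrable fp e.
  have : mu.-integrable `]0, len e[ ((EFin \o (f \o ept e))^\+)%E.
    by apply: integrable_funepos => //; exact: intf.
  by apply: eq_integrable => // x _; rewrite funeposE /= /fp EFin_max.
have iN e : edge_integrable fn e.
  have : mu.-integrable `]0, len e[ ((EFin \o (f \o ept e))^\-)%E.
    by apply: integrable_funeneg => //; exact: intf.
  by apply: eq_integrable => // x _; rewrite funenegE /= /fn EFin_max.
rewrite Ep En !gintegral_ge0_sum; first last.
- by move=> e s eE sl; rewrite /= /fp fE// maxxx.
- by move=> x xV; rewrite /= /fp fV// maxxx.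
- by move=> x; rewrite /= lee_fin le_max lexx orbT.
- by move=> e s eE sl; rewrite /= /fn fE// oppr0 maxxx.
- by move=> x xV; rewrite /= /fn fV// oppr0 maxxx.
- by move=> x; rewrite /= lee_fin le_max lexx orbT.
have S (q : gpoint G -> R) : (forall e, edge_integrable q e) ->
   (\sum_(x <- VF) (vmu W x)%:E * (EFin \o q) (vpt x) +
   \sum_(e <- EF) \int[mu]_(s in `]0%R, len e[) (EFin \o q) (ept e s))%E =
   (gsum VF EF q)%:E.
  move=> iq; rewrite /gsum EFinD -!sumEFin; congr (_ + _)%E.
  apply: eq_bigr => e _; rewrite /Rintegral fineK//.
  exact: integrable_fin_num (iq e).
rewrite !S// -EFinB; congr EFin; rewrite /gsum opprD addrACA -!sumrB.
congr (_ + _); apply: eq_bigr => i _.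
  rewrite -mulrBr; congr (_ * _); rewrite /fp /fn.
  by case: (leP (f _) 0); case: (leP (- f _) 0); lra.
rewrite -RintegralB//; last 2 first.
- exact: ip.
- exact: iN.
apply: eq_Rintegral => s _; rewrite /fp /fn.
by case: (leP (f _) 0); case: (leP (- f _) 0); lra.
Qed.

Lemma omega_nadj x y : ~ gadjacent x y -> omega W x y = 0.
Proof.
move=> nxy; apply/eqP; rewrite eq_le omega_ge0 andbT leNgt.
by apply/negP => /omega_gt0.
Qed.

(** Both sides are the same double sum over [VF], by the symmetry of [omega];
    the neighbours of the support of [a] must be in [VF] for the Laplacian to be
    a sum over [VF]. *)
Lemma vertex_green (a w : vertex G -> R) (w' : gpoint G -> R) :
  (forall x, w' (vpt x) = w x) ->
  (forall x, a x != 0 -> forall y, gadjacent x y -> y \in VF) ->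
  \sum_(x <- VF) vmu W x * (a x * vlaplacian W w' x) =
  \sum_(x <- VF) w x * \sum_(y <- VF) omega W x y * (a y - a x).
Proof.
move=> wE aV.
transitivity (\sum_(x <- VF) \sum_(y <- VF) (omega W x y * a x * w y
    - omega W x y * a x * w x)).
  apply: eq_bigr => x _; have [ax|ax] := eqVneq (a x) 0.
    by rewrite ax mul0r mulr0 big1// => y _; rewrite mulr0 !mul0r subrr.
  rewrite /vlaplacian (@fsbig_fwiden _ _ _ _ VF)//; last 2 first.
  - by move=> y /= xy; exact: aV xy.
  - by move=> y [_ /omega_nadj]/= ->; rewrite mul0r.
  rewrite mulrCA mulVKf ?gt_eqF ?vmu_gt0// big_distrr/=.
  by apply: eq_bigr => y _; rewrite !wE; ring.
under eq_bigr do rewrite sumrB.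
rewrite sumrB exchange_big/= -sumrB; apply: eq_bigr => x _.
rewrite -sumrB big_distrr/=; apply: eq_bigr => y _.
by rewrite [omega W y x]omega_sym; ring.
Qed.

(** Grouped by vertices instead of edges, this sum has the Kirchhoff operator as
    coefficient of each [a x]. A loop enters through both of its ends on either
    side. *)
Lemma kirchhoff_sum (a : vertex G -> R) (w : gpoint G -> R) :
  (forall x, kirchhoff w x = 0) ->
  (forall x, a x != 0 -> x \in VF) ->
  (forall x e, a x != 0 -> incident e x -> e \in EF) ->
  \sum_(e <- EF) (a (fin e) * closed_edge_derive w e (len e)
                  - a (ini e) * closed_edge_derive w e 0) = 0.
Proof.
move=> Kw aV aE.
transitivity (\sum_(e <- EF) \sum_(x <- VF) a x * normal_derivative w e x).
  apply: eq_bigr => e _.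
  have pick (v : vertex G) (c : R) :
      \sum_(x <- VF) a x * (if v == x then c else 0) = a v * c.
    have [av|av] := eqVneq (a v) 0.
      rewrite av mul0r big1// => x _; case: eqVneq => [<-|_]; rewrite ?mulr0//.
      by rewrite av mul0r.
    rewrite (bigD1_seq v) ?aV//= eqxx big1 ?addr0// => x.
    by rewrite eq_sym => /negPf ->; rewrite mulr0.
  by rewrite /normal_derivative -!pick -sumrB; apply: eq_bigr => x _; rewrite mulrBr.
rewrite exchange_big/= big1// => x _; rewrite -big_distrr/=.
have [->|ax] := eqVneq (a x) 0; first by rewrite mul0r.
rewrite -(@fsbig_fwiden _ _ _ _ EF [set e | incident e x])//.
- by rewrite -/(kirchhoff w x) Kw mulr0.
- by move=> e /=; exact: aE.
- move=> e [_ /= ne]; rewrite /normal_derivative.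
  rewrite ifF; last by apply/negP => /eqP h; apply: ne; right.
  by rewrite ifF ?subrr//; apply/negP => /eqP h; apply: ne; left.
Qed.

(** The terms that [edge_green] leaves at the ends of the edges add up to the sum
    of [kirchhoff_sum], which is zero. *)
Lemma green_formula (w a : gpoint G -> R) (A A1 A2 : edge G -> R -> R) :
  domain_DG w -> (forall x, kirchhoff w x = 0) ->
  (forall e (s : R), 0 <= s <= len e -> a (ept e s) = A e s) ->
  (forall e (s : R), is_derive s 1 (A e) (A1 e s)) ->
  (forall e (s : R), is_derive s 1 (A1 e) (A2 e s)) ->
  (forall e, continuous (A2 e)) ->
  (forall e, A1 e 0 = 0) -> (forall e, A1 e (len e) = 0) ->
  (forall x, a (vpt x) != 0 -> x \in VF) ->
  (forall x, a (vpt x) != 0 -> forall y, gadjacent x y -> y \in VF) ->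
  (forall x e, a (vpt x) != 0 -> incident e x -> e \in EF) ->
  gsum VF EF (fun x => a x * glaplacian W w x) =
  \sum_(x <- VF) w (vpt x) *
     (\sum_(y <- VF) omega W x y * (a (vpt y) - a (vpt x))) +
  \sum_(e <- EF) (\int[mu]_(s in `]0, len e[) (A2 e s * w (ept e s)))%R.
Proof.
move=> Dw Kw aA dA dA1 cA2 A10 A1l aV aV' aE; rewrite /gsum; congr (_ + _).
  exact: (@vertex_green (fun x => a (vpt x)) (fun x => w (vpt x))).
have K := @kirchhoff_sum (fun x => a (vpt x)) w Kw aV aE.
rewrite -[RHS]add0r -[X in _ = X + _]K -big_split/=; apply: eq_bigr => e _.
have [cw [d1 d2 d3] [_ cg] hN] := Dw e.
rewrite -(@ept_ini _ _ e 0)// -(@ept_fin _ _ e (len e))//.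
rewrite !aA ?lexx ?(ltW (len_gt0 e))//.
transitivity (\int[mu]_(s in `]0, len e[)
    (A e s * derive1 (derive1 (w \o ept e)) s))%R.
  apply: eq_Rintegral => s; rewrite inE/= in_itv/= => sl.
  rewrite aA; last by case/andP: sl => *; rewrite !ltW.
  by rewrite (ept_itv sl).
have h1 (s : R) : 0 < s < len e -> derivable (w \o ept e) s 1.
  by move=> sl; apply: d1; rewrite in_itv.
have h2 (s : R) : 0 < s < len e -> derivable (derive1 (w \o ept e)) s 1.
  by move=> sl; apply: d2; rewrite in_itv.
have h3 (s : R) : 0 < s < len e ->
    {for s, continuous (derive1 (derive1 (w \o ept e)))}.
  by move=> sl; apply: d3; rewrite in_itv.
exact: (@edge_green R (len e) (w \o ept e) (A e) (A1 e) (A2 e) (len_gt0 e)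
  cw h1 h2 h3 cg hN (dA e) (dA1 e) (cA2 e) (A10 e) (A1l e)).
Qed.
End GraphIntegral.

(** * Young's inequality at a point *)

(** Young's inequality with the exponent [sigma] and its conjugate, applied to
    the product of [(Lam h)^(1/sigma) z^(k+1) w] and [c (Lam h)^(-1/sigma)]. The
    first factor produces [z^(sigma (k+1))], and the condition on [k] bounds this
    by [z^(k+3)]. *)
Lemma young_absorption (R : realType) (sigma Lam h c w z : R) (k : nat) :
  1 < sigma -> 0 < Lam -> 0 < h -> 0 <= c -> 0 <= w -> 0 <= z <= 1 ->
  k.+3%:R <= sigma * k.+1%:R ->
  c * z ^+ k.+1 * w <= Lam * (h * w `^ sigma * z ^+ k.+3) +
    c `^ (sigma / (sigma - 1)) * Lam `^ (- (sigma - 1)^-1)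
      * h `^ (- (sigma - 1)^-1).
Proof.
move=> s1 L0 h0 c0 w0 /andP[z0 z1] ks.
have s0 : 0 < sigma by rewrite (lt_trans ltr01).
have sm0 : 0 < sigma - 1 by rewrite subr_gt0.
set q := sigma / (sigma - 1).
have q0 : 0 < q by rewrite divr_gt0.
have Lh : 0 < Lam * h by rewrite mulr_gt0.
pose a := (Lam * h) `^ sigma^-1 * (z ^+ k.+1 * w).
pose b := c * (Lam * h) `^ (- sigma^-1).
have a0 : 0 <= a by rewrite mulr_ge0 ?powR_ge0// mulr_ge0// exprn_ge0.
have b0 : 0 <= b by rewrite mulr_ge0 ?powR_ge0.
have E : c * z ^+ k.+1 * w = a * b.
  have : (Lam * h) `^ sigma^-1 * (Lam * h) `^ (- sigma^-1) = 1.
    by rewrite powRN mulfV// gt_eqF// powR_gt0.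
  rewrite /a /b => e.
  transitivity (c * (z ^+ k.+1 * w) *
    ((Lam * h) `^ sigma^-1 * (Lam * h) `^ (- sigma^-1))); last by ring.
  by rewrite e; ring.
have conj : sigma^-1 + q^-1 = 1.
  by rewrite /q; field; rewrite !gt_eqF.
have := conjugate_powR a0 b0 s0 q0 conj.
rewrite E => /le_trans; apply; apply: lerD.
- apply: (@le_trans _ _ (a `^ sigma)).
    by rewrite ler_pdivrMr// ler_peMr// ?powR_ge0// ltW.
  rewrite /a powRM ?powR_ge0 ?mulr_ge0 ?exprn_ge0//.
  rewrite -powRrM mulVf ?gt_eqF// powRr1 ?(ltW Lh)// powRM ?exprn_ge0//.
  have -> : Lam * (h * w `^ sigma * z ^+ k.+3) =
    Lam * h * (z ^+ k.+3 * w `^ sigma) by ring.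
  apply: ler_wpM2l; first exact: ltW.
  apply: ler_wpM2r; first exact: powR_ge0.
  rewrite -!powR_mulrn// -powRrM.
  have [->|zn0] := eqVneq z 0.
    by rewrite !powR0 ?mulf_neq0 ?pnatr_eq0 ?gt_eqF.
  have zp : 0 < z by rewrite lt_neqAle eq_sym zn0.
  by apply: ger_powR; rewrite ?zp// mulrC.
- apply: (@le_trans _ _ (b `^ q)).
    rewrite ler_pdivrMr// ler_peMr ?powR_ge0//.
    by rewrite /q ler_pdivlMr// mul1r gerBl.
  rewrite /b powRM ?powR_ge0// -powRrM -mulrA -powRM ?(ltW L0) ?(ltW h0)//.
  rewrite (_ : - sigma^-1 * q = - (sigma - 1)^-1)//.
  by rewrite /q; field; rewrite !gt_eqF.
Qed.

(** Here [z ^+ k.+3] and [phi'] are the values at one point of the cutoffs at a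
    large and at a small scale. Wherever [X] is positive the small cutoff
    vanishes, so the term that Young's inequality produces is absorbed by the
    difference of the two scales, and the remainder is charged to the region
    [1 <= S]. *)
Lemma point_absorb (R : realType) (sigma Lam h c w z X phi' S : R) (k : nat) :
  1 < sigma -> 0 < Lam -> 0 < h -> 0 <= c -> 0 <= w -> 0 <= z <= 1 ->
  k.+3%:R <= sigma * k.+1%:R -> 0 <= S -> phi' <= z ^+ k.+3 ->
  X <= c * z ^+ k.+1 -> (X <= 0 \/ phi' = 0 /\ 1 <= S) ->
  X * w <= Lam * (h * w `^ sigma * (z ^+ k.+3 - phi')) +
    c `^ (sigma / (sigma - 1)) * Lam `^ (- (sigma - 1)^-1)
      * (h `^ (- (sigma - 1)^-1) * S).
Proof.
move=> s1 L0 h0 c0 w0 z01 ks S0 phz Xc; case=> [X0|[p0 S1]].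
  apply: (@le_trans _ _ 0); first by rewrite mulr_le0_ge0.
  rewrite addr_ge0 ?mulr_ge0 ?powR_ge0 ?(ltW L0) ?(ltW h0)//.
  by rewrite subr_ge0.
rewrite p0 subr0; apply: (@le_trans _ _ (c * z ^+ k.+1 * w)).
  exact: ler_wpM2r.
apply: (le_trans (young_absorption s1 L0 h0 c0 w0 z01 ks)).
rewrite lerD2l mulrA -[leLHS]mulr1; apply: ler_wpM2l => //.
by rewrite !mulr_ge0 ?powR_ge0.
Qed.

(** * Second derivatives of the cutoffs *)

(** The profile is concave, which gives the term with [tprof2] the good sign. The
    other term has the factor [tprof1], bounded by [3 / T] wherever the profile
    is positive. *)
Lemma tcut2_le (R : realType) k (T t : R) : 0 < T ->
  tcut2 k T t <= 9 * k.+3%:R ^+ 2 / T ^+ 2 * ppow k.+1 (tprof T t).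
Proof.
move=> T0; have [hn|hp] := leP (tprof T t) 0.
  by rewrite /tcut2 !ppow_neg// !(mulr0, mul0r) addr0.
have t1 : ppow 2 (t / T - 1) <= 1.
  have : ppow 3 (t / T - 1) < 1 by move: hp; rewrite /tprof subr_gt0.
  rewrite /ppow => h.
  have m0 : 0 <= Num.max 0 (t / T - 1) by rewrite le_max lexx.
  apply: exprn_ile1 => //; rewrite leNgt; apply: contraTN h => h.
  by rewrite -leNgt exprn_ege1// ltW.
have p20 := ppow_ge0 2 (t / T - 1).
have e1 : tprof1 T t ^+ 2 <= 9 / T ^+ 2.
  rewrite /tprof1 sqrrN; move: (ppow 2 _) t1 p20 => u u1 u0.
  rewrite !exprMn exprVn ler_wpM2r ?invr_ge0 ?sqr_ge0//.
  rewrite (_ : 9 = 3 ^+ 2 * 1 :> R); last by ring.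
  by rewrite ler_wpM2l ?sqr_ge0// exprn_ile1.
have e2 : tprof2 T t <= 0.
  by rewrite oppr_le0 !(mulr_ge0, divr_ge0)// ?ppow_ge0// ?invr_ge0 ltW.
have P1 := ppow_ge0 k.+1 (tprof T t); have P2 := ppow_ge0 k.+2 (tprof T t).
rewrite /tcut2.
apply: (@le_trans _ _ (k.+3%:R * (k.+2%:R * ppow k.+1 (tprof T t) * tprof1 T t) *
  tprof1 T t)).
  by rewrite gerDl mulr_ge0_le0// mulr_ge0.
rewrite (_ : _ * tprof1 T t = k.+3%:R * k.+2%:R * tprof1 T t ^+ 2 * ppow k.+1 (tprof T t));
  last by ring.
rewrite ler_wpM2r// (_ : 9 * _ / _ = k.+3%:R * k.+3%:R * (9 / T ^+ 2)); last by ring.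
apply: ler_pM => //.
- exact: sqr_ge0.
- by apply: ler_wpM2l => //; rewrite ler_nat.
Qed.

(** Powers of the edge profile joining the values [p] and [q], with their first
    two derivatives. *)
Section EdgeBounds.
Context {R : realType}.
Variables (p q l r L : R) (n : nat).
Hypotheses (r0 : 0 < r) (rl : r <= l).
Hypotheses (p01 : 0 <= p <= 1) (q01 : 0 <= q <= 1) (pqL : `|p - q| <= L).

Local Notation P := (edgeprof p q l).
Local Notation P1 := (edgeprof1 p q l).
Local Notation P2 := (edgeprof2 p q l).

Definition epow (s : R) : R := P s ^+ n.+3.
Definition epow1 (s : R) : R := n.+3%:R * P s ^+ n.+2 * P1 s.
Definition epow2 (s : R) : R :=
  n.+3%:R * (n.+2%:R * P s ^+ n.+1 * P1 s) * P1 s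
  + n.+3%:R * P s ^+ n.+2 * P2 s.

Lemma is_derive_epow (s : R) : is_derive s 1 epow (epow1 s).
Proof. exact: is_derive1_expn (is_derive_edgeprof _ _ _ _). Qed.

Lemma is_derive_epow1 (s : R) : is_derive s 1 epow1 (epow2 s).
Proof.
have h := is_derive1_expn n.+1 (is_derive_edgeprof p q l s).
exact: (is_derive1M (is_derive1Ml n.+3%:R h) (is_derive_edgeprof1 p q l s)).
Qed.

Lemma continuous_epow2 : continuous epow2.
Proof.
have c0 := is_derive_continuous (is_derive_edgeprof p q l).
have c1 := is_derive_continuous (is_derive_edgeprof1 p q l).
have ct := @continuous1_cst R.
have cX m : continuous (fun s => P s ^+ m).
  elim: m => [|m IHm]; first exact: ct.
  rewrite (_ : (fun s => _) = (fun s => P s * P s ^+ m)); first exact: continuous1M.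
  by apply/funext => s; rewrite exprS.
have c2 : continuous P2.
  have cs := is_derive_continuous (is_derive_scale l).
  rewrite (_ : P2 = fun s => (q - p) * (6 + -12 * (s / l)) * (l ^+ 2)^-1).
    apply: continuous1M => //; apply: continuous1M => //; apply: continuous1D => //.
    exact: continuous1M.
  by apply/funext => s; rewrite /edgeprof2; ring.
apply: continuous1D.
  apply: continuous1M => //; apply: continuous1M => //.
  by apply: continuous1M => //; exact: continuous1M.
by apply: continuous1M => //; exact: continuous1M.
Qed.

Lemma epow1_0 : epow1 0 = 0.
Proof. by rewrite /epow1 /edgeprof1; ring. Qed.

Lemma epow1_l : epow1 l = 0.
Proof.
have l0 : 0 < l by exact: lt_le_trans rl.
by rewrite /epow1 /edgeprof1 divff ?gt_eqF//; ring.
Qed.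

(** The term with the square of [P1] has the good sign, and [P2] is at most
    [6 * `|p - q| / l ^+ 2]. *)
Lemma epow2_ge (s : R) : 0 <= s <= l ->
  - epow2 s <= n.+3%:R * (6 / r ^+ 2 * L) * P s ^+ n.+2.
Proof.
move=> /andP[s0 sl]; have l0 : 0 < l by exact: lt_le_trans rl.
have /andP[P0 _] : 0 <= P s <= 1 by apply: edgeprof_itv; rewrite ?s0.
have P2b : `|P2 s| <= 6 / r ^+ 2 * L.
  have t0 : 0 <= s / l by rewrite divr_ge0// ltW.
  have t1 : s / l <= 1 by rewrite ler_pdivrMr// mul1r.
  rewrite /edgeprof2 normrM normrM.
  have a1 : `|6 - 12 * (s / l)| <= 6 by rewrite ler_norml; apply/andP; split; lra.
  have a2 : `|(l ^+ 2)^-1| <= (r ^+ 2)^-1.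
    rewrite ger0_norm ?invr_ge0 ?sqr_ge0// lef_pV2 ?posrE ?exprn_gt0//.
    by rewrite lerXn2r ?nnegrE// ltW.
  rewrite (_ : 6 / r ^+ 2 * L = L * 6 * (r ^+ 2)^-1); last by ring.
  by rewrite distrC ler_pM// ?mulr_ge0// ler_pM.
rewrite /epow2 opprD; apply: (@le_trans _ _ (- (n.+3%:R * P s ^+ n.+2 * P2 s))).
  rewrite gerDr oppr_le0 (_ : _ * _ * _ = n.+3%:R * n.+2%:R * P s ^+ n.+1 * P1 s ^+ 2);
    last by ring.
  apply: mulr_ge0; last exact: sqr_ge0.
  by apply: mulr_ge0; [exact: mulr_ge0|exact: exprn_ge0].
rewrite -mulrN -[leRHS]mulrA [6 / _ * _ * _]mulrC [leRHS]mulrA; apply: ler_wpM2l.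
  by apply: mulr_ge0 => //; exact: exprn_ge0.
by apply: le_trans P2b; rewrite -normrN ler_norm.
Qed.

Lemma epow2_flat (s : R) : p = q -> epow2 s = 0.
Proof. by move=> pq; rewrite /epow2 /edgeprof2 /edgeprof1 pq; ring. Qed.

End EdgeBounds.

(** * Covering by the annuli *)

Lemma dyadic_cover (R : realType) (b D : R) (K : nat) : b <= D ->
  D <= 2 ^+ K.+1 * b ->
  exists i : 'I_K.+1, 2 ^+ i * b <= D <= 2 * (2 ^+ i * b).
Proof.
move=> bD; elim: K => [|K IHK] hD.
  by exists ord0; rewrite expr0 mul1r bD.
have [/IHK[i hi]|h] := leP D (2 ^+ K.+1 * b).
  by exists (widen_ord (leqnSn _) i).
by exists ord_max; rewrite /= (ltW h)/= mulrA -exprS.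
Qed.

(** Chosen so that the powers [theta1] of the radii are in ratio [2]: consecutive
    annuli [E_set] are then adjacent. *)
Definition ring_radius (R : realType) (theta1 rho : R) (i : nat) : R :=
  (2 ^+ i) `^ theta1^-1 * (rho / 2).

Lemma ring_radiusX (R : realType) (theta1 rho : R) i : 0 < theta1 -> 0 < rho ->
  ring_radius theta1 rho i `^ theta1 = 2 ^+ i * (rho / 2) `^ theta1.
Proof.
move=> t0 r0; rewrite [LHS]powRM ?powR_ge0 ?divr_ge0 ?(ltW r0)//.
by rewrite -powRrM mulVf ?gt_eqF// powRr1// exprn_ge0.
Qed.

(** A sum of indicators instead of the indicator of the union, so that its
    integral against a weight is a sum of the integrals bounded by hypothesis. *)
Definition annuli (R : realType) (G : metric_graph R) (x0 : vertex G)
    (theta1 theta2 rho : R) (K : nat) (x : gpoint G) (t : R) : R :=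
  \sum_(i < K.+1) \1_(E_set x0 theta1 theta2 (ring_radius theta1 rho i)) (x, t).

Lemma annuli_ge0 (R : realType) (G : metric_graph R) (x0 : vertex G)
    (theta1 theta2 rho : R) (K : nat) x t :
  0 <= annuli x0 theta1 theta2 rho K x t.
Proof. by apply: sumr_ge0 => i _; rewrite indicE. Qed.

Lemma ler_sum_term (R : realType) (n : nat) (f : 'I_n -> R) (i : 'I_n) :
  (forall i, 0 <= f i) -> f i <= \sum_(i < n) f i.
Proof. by move=> f0; rewrite (bigD1 i)//= lerDl sumr_ge0. Qed.

(** As [T ^ theta2 = rho ^ theta1], on this region the quantity defining the
    annuli lies between [(rho / 2) ^ theta1] and a multiple of it that depends
    only on the exponents; [K] is the number of doublings needed. *)
Lemma annuli_ge1 (R : realType) (G : metric_graph R) (x0 : vertex G)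
    (theta1 theta2 rho : R) (K : nat) x t : 0 < theta1 -> 0 < theta2 ->
  0 < rho -> 3 `^ theta1 + 2 `^ theta2 <= 2 ^+ K.+1 / 2 `^ theta1 ->
  0 <= t -> t <= 2 * rho `^ (theta1 / theta2) ->
  dist x (vpt x0) <= 3 * rho ->
  (rho `^ (theta1 / theta2) <= t \/ rho / 2 <= dist x (vpt x0)) ->
  1 <= annuli x0 theta1 theta2 rho K x t.
Proof.
move=> t1 t2 r0 hK t0 tT d3 hor.
set d := dist _ _ in d3 hor; have d0 : 0 <= d by exact: dist_ge0.
set T := rho `^ (theta1 / theta2) in tT hor.
have T0 : 0 <= T by exact: powR_ge0.
have TE : T `^ theta2 = rho `^ theta1.
  by rewrite /T -powRrM divfK// gt_eqF.
have mono a b th : 0 < th -> 0 <= a -> a <= b -> a `^ th <= b `^ th :> R.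
  by move=> th0 a0 ab; apply: ge0_ler_powR; rewrite ?nnegrE// ?(ltW th0)// (le_trans a0).
have r2 : 0 <= rho / 2 by rewrite divr_ge0// ltW.
have lo : (rho / 2) `^ theta1 <= d `^ theta1 + t `^ theta2.
  case: hor => [Tt|dr].
    apply: (@le_trans _ _ (t `^ theta2)); last by rewrite lerDr powR_ge0.
    apply: (@le_trans _ _ (T `^ theta2)); last exact: mono.
    rewrite TE; apply: mono => //.
    by rewrite ler_pdivrMr// ler_pMr// ler1n.
  apply: (@le_trans _ _ (d `^ theta1)); last by rewrite lerDl powR_ge0.
  exact: mono.
have up : d `^ theta1 + t `^ theta2 <= 2 ^+ K.+1 * (rho / 2) `^ theta1.
  apply: (@le_trans _ _ ((3 `^ theta1 + 2 `^ theta2) * rho `^ theta1)).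
    rewrite mulrDl -TE -[2 `^ _ * _]powRM// TE -powRM ?(ltW r0)//.
    by apply: lerD; apply: mono.
  rewrite [in leRHS]powRM ?invr_ge0 ?(ltW r0)//.
  rewrite [_ * 2^-1 `^ _]mulrC mulrA; apply: ler_wpM2r; first exact: powR_ge0.
  by rewrite -powR_inv1// -powRrM mulN1r powRN.
have [i hi] := dyadic_cover lo up.
apply: (@le_trans _ _
  (\1_(E_set x0 theta1 theta2 (ring_radius theta1 rho i)) (x, t))).
  rewrite indicE mem_set//; split => //=; rewrite ring_radiusX//.
exact: (@ler_sum_term _ _ (fun i => \1_(E_set x0 theta1 theta2 (ring_radius theta1 rho i)) (x, t))).
Qed.

(** * The inequality at a fixed time *)

(** The mean value inequality for a power; the derivative may be taken at [p],
    because the left side is positive only if [p] is the larger number. *)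
Lemma subX_le (R : realType) (n : nat) (p q : R) : 0 <= p -> 0 <= q ->
  p ^+ n.+1 - q ^+ n.+1 <= n.+1%:R * p ^+ n * `|p - q|.
Proof.
move=> p0 q0; have [qp|pq] := leP q p; last first.
  apply: (@le_trans _ _ 0).
    by rewrite subr_le0 lerXn2r ?nnegrE// ltW.
  by rewrite !mulr_ge0// exprn_ge0.
rewrite ger0_norm ?subr_ge0//; elim: n => [|n IHn].
  by rewrite !expr1 expr0 !mul1r.
have h : q ^+ n.+1 <= p ^+ n.+1 by rewrite lerXn2r.
have E : p ^+ n.+2 - q ^+ n.+2 =
    p * (p ^+ n.+1 - q ^+ n.+1) + (p - q) * q ^+ n.+1 by rewrite !exprS; ring.
rewrite E (_ : _ * _ * _ = p * (n.+1%:R * p ^+ n * (p - q)) + (p - q) * p ^+ n.+1).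
  by apply: lerD; rewrite ler_wpM2l// subr_ge0.
by rewrite !exprS -[n.+2%:R]natr1; ring.
Qed.

Lemma expr_le_expr (R : realType) (x : R) (a b : nat) : 0 <= x <= 1 ->
  (a <= b)%N -> x ^+ b <= x ^+ a.
Proof. by move=> /andP[x0 x1] ab; exact: ler_wiXn2l. Qed.

Section Slice.
Context {R : realType} {G : metric_graph R} (W : graph_weights G).
Variables (x0 : vertex G) (kap : R).
Hypotheses (kap1 : 1 < kap) (kap2 : kap <= 2).
Hypothesis conn : graph_connected G.
Variables (j r C0 : R).
Hypothesis j0 : 0 <= j.
Hypothesis lenj : forall e : edge G, len e <= j.
Hypothesis r0 : 0 < r.
Hypothesis lenr : forall e : edge G, r <= len e.
Hypothesis C00 : 0 < C0.
Hypothesis omegaC : forall x : vertex G,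
  \sum_(y \in [set y | gadjacent x y]) omega W x y <= C0 * vmu W x.
Variables (k : nat) (rho T : R).
Hypotheses (rho1 : 1 <= rho) (rho4j : 4 * j <= rho) (T0 : 0 < T)
  (T2 : rho <= T ^+ 2).
Variables (VF : seq (vertex G)) (EF : seq (edge G)).
Hypothesis uV : uniq VF.
Hypothesis uE : uniq EF.

Local Notation mu := (@lebesgue_measure R).
Local Notation delta x := (dist x (vpt x0)).
Local Notation vc := (vcut x0 kap).
Local Notation gc := (gcut x0 kap).
Local Notation m := k.+3.

Hypothesis VFball : forall v, delta (vpt v) < kap * rho + 2 * j + 1 -> v \in VF.
Hypothesis EFball : forall e (s : R), 0 < s < len e ->
  delta (ept e s) < kap * rho + 2 * j + 1 -> e \in EF.

Let rho0 : 0 < rho. Proof. exact: lt_le_trans rho1. Qed.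

Lemma gcut_VF v : gc rho (vpt v) != 0 -> v \in VF.
Proof.
by move=> /(gcut_supp kap1 conn j0 lenj rho0) h; apply: VFball; move: h j0; lra.
Qed.

Lemma gcut_adj v : gc rho (vpt v) != 0 -> forall y, gadjacent v y -> y \in VF.
Proof.
move=> /(gcut_supp kap1 conn j0 lenj rho0) h y /(dist_adjacent x0 conn lenj).
rewrite ler_norml => /andP[h1 h2]; apply: VFball; move: h h1 h2 j0; lra.
Qed.

Lemma gcut_inc v e : gc rho (vpt v) != 0 -> incident e v -> e \in EF.
Proof.
move=> /(gcut_supp kap1 conn j0 lenj rho0) h inc.
have l0 := len_gt0 e.
have sl : 0 < len e / 2 < len e by apply/andP; split; lra.
have sl' : 0 <= len e / 2 <= len e by apply/andP; split; lra.
apply: (EFball sl).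
have := dist_ini x0 conn lenj sl'; have := dist_fin x0 conn lenj sl'.
rewrite !ler_norml => /andP[a1 a2] /andP[b1 b2].
by case: inc => E; rewrite -E in h; move: h a1 a2 b1 b2 j0; lra.
Qed.

Lemma gcut_nEF e (s : R) : e \notin EF -> 0 < s < len e -> gc rho (ept e s) = 0.
Proof.
move=> eE sl; apply/eqP; apply: contraNT eE => /(gcut_supp kap1 conn j0 lenj rho0) h.
by apply: (EFball sl); move: h j0; lra.
Qed.

(** The variation of the cutoff along an edge. The edges do not shrink with the
    scale, so both parts of the Laplacian of the cutoff are of order [1 / rho]
    and not smaller. *)
Definition liplen : R := j / ((kap - 1) * rho).

Lemma liplen_ge0 : 0 <= liplen.
Proof. by rewrite divr_ge0// mulr_ge0 ?(ltW rho0)// subr_ge0 ltW. Qed.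

(** Minus the vertex Laplacian of the power of the cutoff, multiplied by the
    vertex measure. *)
Definition vflux (x : vertex G) : R :=
  - \sum_(y <- VF) omega W x y * (gc rho (vpt y) ^+ m - gc rho (vpt x) ^+ m).

(** By [subX_le] each neighbour contributes at most its variation [liplen] times
    the power [k.+2] of the cutoff at [x], and the total weight of the neighbours
    is at most [C0] times the vertex measure. *)
Lemma vflux_le x :
  vflux x <= vmu W x * (C0 * (m%:R * liplen) * gc rho (vpt x) ^+ k.+2).
Proof.
rewrite /vflux -sumrN; have [gx|gx] := eqVneq (gc rho (vpt x)) 0.
  rewrite gx [_ ^+ k.+2]expr0n !mulr0; apply: sumr_le0 => y _.
  rewrite oppr_le0 mulr_ge0 ?omega_ge0// expr0n subr0 exprn_ge0//.
  by case/andP: (gcut_itv x0 kap rho (vpt y)).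
have /andP[g0 g1] := gcut_itv x0 kap rho (vpt x).
apply: (@le_trans _ _ (\sum_(y <- VF) omega W x y *
   (m%:R * liplen * gc rho (vpt x) ^+ k.+2))).
  apply: ler_sum => y _; have [xy|nxy] := pselect (gadjacent x y); last first.
    by rewrite (omega_nadj W nxy) !mul0r oppr0.
  rewrite -mulrN opprB; apply: ler_wpM2l; first exact: omega_ge0.
  have /andP[y0 _] := gcut_itv x0 kap rho (vpt y).
  apply: (le_trans (subX_le _ g0 y0)).
  rewrite -mulrA [_ ^+ _ * _]mulrC mulrA; apply: ler_wpM2r; first exact: exprn_ge0.
  apply: ler_wpM2l => //.
  by apply: vcut_lip => //; exact: dist_adjacent.
rewrite -big_distrl/= -(@fsbig_fwiden _ _ _ _ VF [set y | gadjacent x y])//.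
- apply: (@le_trans _ _ (C0 * vmu W x * (m%:R * liplen * gc rho (vpt x) ^+ k.+2))).
    apply: ler_wpM2r; last exact: omegaC.
    by rewrite mulr_ge0 ?exprn_ge0// mulr_ge0// liplen_ge0.
  by rewrite le_eqVlt; apply/orP; left; apply/eqP; ring.
- by move=> y /=; exact: gcut_adj.
- by move=> y [_ nxy] /=; exact: omega_nadj.
Qed.

(** Away from the annulus all the neighbours have the same cutoff as [x]. *)
Lemma vflux_annulus x :
  vflux x <= 0 \/ rho - j <= delta (vpt x) <= kap * rho + j.
Proof.
have [h|h] := pselect (rho - j <= delta (vpt x) <= kap * rho + j); first by right.
left; rewrite /vflux big1 ?oppr0// => y _.
have [xy|nxy] := pselect (gadjacent x y); last by rewrite (omega_nadj W nxy) mul0r.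
suff -> : gc rho (vpt y) = gc rho (vpt x) by rewrite subrr mulr0.
apply/eqP; rewrite eq_sym; apply: contra_notT h => h.
by apply: vcut_annulus h => //; exact: dist_adjacent.
Qed.

Local Notation EP e := (epow2 (vc rho (ini e)) (vc rho (fin e)) (len e) k).

Lemma eflux_le e (s : R) : 0 < s < len e ->
  - EP e s <= 6 / r ^+ 2 * (m%:R * liplen) * gc rho (ept e s) ^+ k.+2.
Proof.
move=> sl; have sl' : 0 <= s <= len e by case/andP: sl => *; rewrite !ltW.
rewrite gcut_ept//.
have pq : `|vc rho (ini e) - vc rho (fin e)| <= liplen.
  by apply: vcut_lip => //; rewrite distrC; exact: dist_ends.
apply: le_trans (epow2_ge k r0 (lenr e) (vcut_itv _ _ _ _) (vcut_itv _ _ _ _) pq sl') _.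
by rewrite le_eqVlt; apply/orP; left; apply/eqP; ring.
Qed.

Lemma eflux_annulus e (s : R) : 0 < s < len e ->
  - EP e s <= 0 \/ rho - j <= delta (ept e s) <= kap * rho + j.
Proof.
move=> sl; have sl' : 0 <= s <= len e by case/andP: sl => *; rewrite !ltW.
have [h|h] := pselect (rho - j <= delta (ept e s) <= kap * rho + j); first by right.
left; rewrite epow2_flat ?oppr0//; apply/eqP; apply: contra_notT h => h.
have := dist_ini x0 conn lenj sl'; have := dist_fin x0 conn lenj sl'.
rewrite !ler_norml => /andP[a1 a2] /andP[b1 b2].
have rk : rho <= kap * rho by rewrite ler_peMl ?(ltW rho0)// ltW.
apply/andP; split; rewrite leNgt; apply: contraNN h => h; apply/eqP.
  by rewrite /vcut !cutd_eq1//; move: h a1 a2 b1 b2; lra.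
by rewrite /vcut !cutd_eq0//; move: h a1 a2 b1 b2; lra.
Qed.

(** Up to the factor [1 / rho], a bound for the wave operator applied to the
    cutoff: the first term comes from the time derivatives, [C0] from the
    vertices and [6 / r ^+ 2] from the edges. *)
Definition slicec : R :=
  9 * m%:R ^+ 2 + (C0 + 6 / r ^+ 2) * (m%:R * (j / (kap - 1))).

Lemma slicec_ge0 : 0 <= slicec.
Proof.
rewrite /slicec addr_ge0 ?mulr_ge0 ?sqr_ge0//.
  by rewrite addr_ge0 ?(ltW C00)// divr_ge0 ?sqr_ge0.
by rewrite invr_ge0 subr_ge0 ltW.
Qed.

Variables (theta1 theta2 : R) (K : nat).
Hypotheses (th1 : 0 < theta1) (th2 : 0 < theta2).
Hypothesis TE : T = rho `^ (theta1 / theta2).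
Hypothesis hK : 3 `^ theta1 + 2 `^ theta2 <= 2 ^+ K.+1 / 2 `^ theta1.
Variables (rho' T' : R).
Hypotheses (rho'0 : 0 < rho') (rho'E : 4 * rho' <= rho)
  (T'0 : 0 < T') (T'T : 2 * T' <= T).
Variables (sigma Lam : R).
Hypotheses (s1 : 1 < sigma) (Lam0 : 0 < Lam)
  (ks : k.+3%:R <= sigma * k.+1%:R).

Local Notation phi := (cutoff x0 kap rho k T).
Local Notation phi' := (cutoff x0 kap rho' k T').
Local Notation ann := (annuli x0 theta1 theta2 rho K).

Definition slicek : R :=
  (slicec / rho) `^ (sigma / (sigma - 1)) * Lam `^ (- (sigma - 1)^-1).

Lemma cutoff_small_le x (t : R) : 0 <= t -> phi' x t <= phi x t.
Proof.
move=> t0; have /andP[g0 _] := gcut_itv x0 kap rho' x.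
have /andP[b0 _] := tcut_itv k T' t.
have rr : rho' <= rho by move: rho'E rho'0; lra.
have TT : T' <= T by move: T'T T'0; lra.
have gg := gcut_mono x0 kap1 x rho'0 rr.
apply: ler_pM => //.
- exact: exprn_ge0.
- apply: lerXn2r => //; rewrite nnegrE//; exact: le_trans gg.
- exact: tcut_mono.
Qed.

(** [Y] stands for minus the Laplacian of the space factor, at a vertex or inside
    an edge. The wave operator of the cutoff can be positive only after time [T]
    or in the annulus in space: in both cases the cutoff of the smaller scale is
    zero and the point is in one of the annuli, as [point_absorb] requires. *)
Lemma slice_point (x : gpoint G) (t w h Y D : R) : 0 <= t -> 0 <= w -> 0 < h ->
  0 <= D -> D <= C0 + 6 / r ^+ 2 ->
  Y <= D * (m%:R * liplen) * gc rho x ^+ k.+2 ->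
  (Y <= 0 \/ rho - j <= delta x <= kap * rho + j) ->
  (tcut2 k T t * gc rho x ^+ m + tcut k T t * Y) * w <=
    Lam * (h * w `^ sigma * (phi x t - phi' x t)) +
    slicek * (h `^ (- (sigma - 1)^-1) * ann x t).
Proof.
move=> t0 w0 h0 D0 DC hY hY2.
pose eta := Num.max 0 (tprof T t).
have eta0 : 0 <= eta by rewrite le_max lexx.
have eta1 : eta <= 1 by rewrite ge_max ler01/= /tprof gerBl ppow_ge0.
have /andP[g0 g1] := gcut_itv x0 kap rho x.
set g := gc rho x in hY g0 g1 *.
have L0 := liplen_ge0.
have z01 : 0 <= g * eta <= 1.
  by rewrite mulr_ge0//= -[leRHS]mulr1; apply: ler_pM.
have bE : tcut k T t = eta ^+ k.+3 by [].
have phE : phi x t = (g * eta) ^+ k.+3 by rewrite exprMn.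
rewrite phE; apply: point_absorb => //.
- by rewrite divr_ge0 ?slicec_ge0 ?(ltW rho0).
- exact: annuli_ge0.
- by rewrite -phE; exact: cutoff_small_le.
- have hb := tcut2_le k t T0; rewrite -/(eta ^+ k.+1) /ppow -/eta in hb.
  have hB : 9 * m%:R ^+ 2 / T ^+ 2 <= 9 * m%:R ^+ 2 / rho.
    apply: ler_wpM2l; first by rewrite mulr_ge0// sqr_ge0.
    by rewrite lef_pV2 ?posrE// exprn_gt0.
  have e1 : tcut2 k T t * g ^+ m <= 9 * m%:R ^+ 2 / rho * (g * eta) ^+ k.+1.
    apply: (@le_trans _ _ (9 * m%:R ^+ 2 / rho * eta ^+ k.+1 * g ^+ m)).
      apply: ler_wpM2r; first exact: exprn_ge0.
      apply: (le_trans hb); apply: ler_wpM2r => //; exact: exprn_ge0.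
    rewrite exprMn -[leLHS]mulrA; apply: ler_wpM2l.
      by rewrite divr_ge0 ?(ltW rho0)// mulr_ge0// sqr_ge0.
    rewrite mulrC; apply: ler_wpM2r; first exact: exprn_ge0.
    by apply: expr_le_expr; rewrite ?g0// ltnW.
  have e2 : tcut k T t * Y <= D * (m%:R * liplen) * (g * eta) ^+ k.+1.
    rewrite bE; apply: (@le_trans _ _ (eta ^+ m * (D * (m%:R * liplen) * g ^+ k.+2))).
      by apply: ler_wpM2l => //; exact: exprn_ge0.
    rewrite mulrCA exprMn [g ^+ _ * eta ^+ _]mulrC; apply: ler_wpM2l.
      by rewrite mulr_ge0// mulr_ge0.
    apply: ler_pM; rewrite ?exprn_ge0//; apply: expr_le_expr; rewrite ?g0 ?eta0//.
    by rewrite ltnW.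
  apply: le_trans (lerD e1 e2) _; rewrite -mulrDl; apply: ler_wpM2r.
    by apply: exprn_ge0; case/andP: z01.
  rewrite /slicec [leRHS]mulrDl lerD2l.
  rewrite (_ : _ / rho = (C0 + 6 / r ^+ 2) * (m%:R * liplen)).
    by apply: ler_wpM2r => //; rewrite mulr_ge0.
  by rewrite /liplen; field; rewrite !gt_eqF// subr_gt0.
have [tT|Tt] := leP (2 * T) t.
  by left; rewrite tcut2_eq0// tcut_eq0// !mul0r addr0.
have bpos : 0 <= tcut k T t by case/andP: (tcut_itv k T t).
have rk2 : kap * rho <= 2 * rho by rewrite ler_wpM2r// ltW.
have d3 : delta x <= kap * rho + j -> delta x <= 3 * rho by move: rk2 rho4j j0; lra.
have [tT|tT] := leP t T.
  rewrite tcut2_early// mul0r add0r.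
  case: hY2 => [Y0|/andP[h1 h2]]; first by left; rewrite mulr_ge0_le0.
  right; split.
    rewrite /cutoff (@gcut_far _ _ x0 _ kap1 conn j)// ?expr0n ?mul0r//.
    have rk' : kap * rho' <= 2 * rho' by rewrite ler_wpM2r// ltW.
    by move: h1 rk' rho4j rho'E; lra.
  apply: annuli_ge1 => //; rewrite -?TE ?(ltW Tt) ?d3//.
  by right; move: h1 rho4j j0; lra.
have p'0 : phi' x t = 0.
  by rewrite /cutoff tcut_eq0 ?mulr0// (le_trans T'T)// ltW.
have [dk|dk] := leP (delta x) (kap * rho + j).
  right; split=> //; apply: annuli_ge1 => //; rewrite -?TE ?(ltW Tt) ?d3//.
  by left; exact: ltW.
left; have gz : g = 0 by rewrite /g (@gcut_far _ _ x0 _ kap1 conn j)// ltW.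
rewrite gz expr0n mulr0 add0r.
case: hY2 => [Y0|/andP[_ hd]]; first by rewrite mulr_ge0_le0.
by move: dk; rewrite ltNge hd.
Qed.

Lemma phi_supported (F : gpoint G -> R) (t : R) :
  gsupported VF EF (fun x => F x * phi x t).
Proof.
split=> [v vV|e s eE sl].
  have -> : phi (vpt v) t = 0; last by rewrite mulr0.
  rewrite /cutoff; have [->|/gcut_VF h] := eqVneq (gc rho (vpt v)) 0.
    by rewrite expr0n mul0r.
  by rewrite h in vV.
by rewrite /cutoff gcut_nEF// expr0n mul0r mulr0.
Qed.

(** Green's formula puts the Laplacian on the cutoff, and [slice_point] is then
    summed over the vertices and integrated over the edges. *)
Lemma slice_integral (w h : gpoint G -> R) (t : R) : 0 <= t ->
  (forall x, 0 <= w x) -> (forall x, 0 < h x) ->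
  domain_DG w -> (forall x, kirchhoff w x = 0) ->
  gintegrable W (fun x => gc rho x ^+ m * tcut2 k T t * w x) ->
  gintegrable W (fun x => phi x t * glaplacian W w x) ->
  gintegrable W (fun x => h x * `|w x| `^ sigma * phi x t) ->
  gintegrable W (fun x => h x * `|w x| `^ sigma * phi' x t) ->
  (gintegral W (fun x => (gc rho x ^+ m * tcut2 k T t * w x)%R)
   - gintegral W (fun x => (phi x t * glaplacian W w x)%R)
   <= Lam%:E * (gintegral W (fun x => (h x * `|w x| `^ sigma * phi x t)%R)
        - gintegral W (fun x => (h x * `|w x| `^ sigma * phi' x t)%R)) +
      (\sum_(x <- VF)
         (vmu W x * (slicek * (h (vpt x) `^ (- (sigma - 1)^-1) * ann (vpt x) t)))%:E
       + \sum_(e <- EF) \int[mu]_(s in `]0%R, len e[)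
           (slicek * (h (ept e s) `^ (- (sigma - 1)^-1) * ann (ept e s) t))%:E))%E.
Proof.
move=> t0 w0 h0 Dw Kw iJ iK iI iI'.
have sJ : gsupported VF EF (fun x => gc rho x ^+ m * tcut2 k T t * w x).
  split=> [v vV|e s eE sl]; last by rewrite gcut_nEF// expr0n !mul0r.
  have [->|/gcut_VF hv] := eqVneq (gc rho (vpt v)) 0; first by rewrite expr0n !mul0r.
  by rewrite hv in vV.
have sK : gsupported VF EF (fun x => phi x t * glaplacian W w x).
  have := phi_supported (glaplacian W w) t.
  by congr gsupported; apply/funext => x; rewrite mulrC.
have sI := phi_supported (fun x => h x * `|w x| `^ sigma) t.
have sI' : gsupported VF EF (fun x => h x * `|w x| `^ sigma * phi' x t).
  have hp x : 0 <= phi' x t <= phi x t.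
    rewrite cutoff_small_le// andbT; by case/andP: (cutoff_itv x0 kap k rho' T' x t).
  have [s1' s2'] := phi_supported (fun=> 1) t.
  split=> [v vV|e s eE sl].
    have := s1' _ vV; rewrite mul1r => e0; have := hp (vpt v).
    by rewrite e0 -eq_le => /eqP <-; rewrite mulr0.
  have := s2' _ _ eE sl; rewrite mul1r => e0; have := hp (ept e s).
  by rewrite e0 -eq_le => /eqP <-; rewrite mulr0.
rewrite (gintegralE W uV uE sJ (gintegrable_edge iJ)).
rewrite (gintegralE W uV uE sK (gintegrable_edge iK)).
rewrite (gintegralE W uV uE sI (gintegrable_edge iI)).
rewrite (gintegralE W uV uE sI' (gintegrable_edge iI')).
have := @green_formula R G W VF EF uV uE w (phi ^~ t)
  (fun e s => tcut k T t * epow (vc rho (ini e)) (vc rho (fin e)) (len e) k s)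
  (fun e s => tcut k T t * epow1 (vc rho (ini e)) (vc rho (fin e)) (len e) k s)
  (fun e s => tcut k T t * EP e s) Dw Kw.
have cEP e : continuous (fun s => tcut k T t * EP e s).
  by apply: continuous1M; [exact: continuous1_cst|exact: continuous_epow2].
have dP1 e (s : R) := is_derive1Ml (tcut k T t)
  (is_derive_epow (vc rho (ini e)) (vc rho (fin e)) (len e) k s).
have dP2 e (s : R) := is_derive1Ml (tcut k T t)
  (is_derive_epow1 (vc rho (ini e)) (vc rho (fin e)) (len e) k s).
have pn0 x : phi x t != 0 -> gc rho x != 0.
  by apply: contraNN => /eqP e0; rewrite /cutoff e0 expr0n mul0r.
move=> /(_ _ dP1 dP2 cEP).
have hA e (s : R) : 0 <= s <= len e -> phi (ept e s) t =
    tcut k T t * epow (vc rho (ini e)) (vc rho (fin e)) (len e) k s.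
  by move=> sl; rewrite /cutoff gcut_ept// mulrC.
have h10 e : tcut k T t * epow1 (vc rho (ini e)) (vc rho (fin e)) (len e) k 0 = 0.
  by rewrite epow1_0 mulr0.
have h1l e : tcut k T t * epow1 (vc rho (ini e)) (vc rho (fin e)) (len e) k (len e) = 0.
  by rewrite (epow1_l _ _ _ r0 (lenr e)) mulr0.
move=> /(_ hA h10 h1l).
have hv1 x : phi (vpt x) t != 0 -> x \in VF by move/pn0/gcut_VF.
have hv2 x : phi (vpt x) t != 0 -> forall y, gadjacent x y -> y \in VF.
  by move/pn0/gcut_adj.
have hv3 x e : phi (vpt x) t != 0 -> incident e x -> e \in EF.
  by move/pn0/gcut_inc => hi; exact: hi.
move=> /(_ hv1 hv2 hv3) ->.
have wabs x : `|w x| = w x by rewrite ger0_norm.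
pose I x := h x * `|w x| `^ sigma * phi x t.
pose I' x := h x * `|w x| `^ sigma * phi' x t.
pose J x := gc rho x ^+ m * tcut2 k T t * w x.
pose H x := slicek * (h x `^ (- (sigma - 1)^-1) * ann x t).
rewrite -/I -/I' -/J.
have slicek0 : 0 <= slicek by rewrite mulr_ge0 ?powR_ge0.
have H0 x : 0 <= H x.
  by rewrite /H mulr_ge0// mulr_ge0 ?powR_ge0// annuli_ge0.
(* The left side minus the absorbed term, at a vertex and inside an edge. *)
pose QV x := vmu W x * J (vpt x) - w (vpt x) *
    (\sum_(y <- VF) omega W x y * (phi (vpt y) t - phi (vpt x) t))
  - Lam * (vmu W x * I (vpt x) - vmu W x * I' (vpt x)).
pose QE e (s : R) := J (ept e s) - tcut k T t * EP e s * w (ept e s)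
  - Lam * (I (ept e s) - I' (ept e s)).
have QVle x : QV x <= vmu W x * H (vpt x).
  have m0 := vmu_gt0 W x.
  have E : QV x = vmu W x * ((tcut2 k T t * gc rho (vpt x) ^+ m
      + tcut k T t * (vflux x / vmu W x)) * w (vpt x)
      - Lam * (h (vpt x) * w (vpt x) `^ sigma * (phi (vpt x) t - phi' (vpt x) t))).
    rewrite /QV.
    have -> : \sum_(y <- VF) omega W x y * (phi (vpt y) t - phi (vpt x) t) =
        - (tcut k T t * vflux x).
      rewrite /vflux mulrN opprK big_distrr/=; apply: eq_bigr => y _.
      by rewrite /cutoff; ring.
    rewrite /J /I /I' wabs.
    rewrite (_ : vmu W x * ((tcut2 k T t * gc rho (vpt x) ^+ m
      + tcut k T t * (vflux x / vmu W x)) * w (vpt x) - _) =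
      vmu W x * (gc rho (vpt x) ^+ m * tcut2 k T t * w (vpt x))
      + (vmu W x / vmu W x) * (tcut k T t * vflux x * w (vpt x))
      - vmu W x * (Lam * (h (vpt x) * w (vpt x) `^ sigma *
          (phi (vpt x) t - phi' (vpt x) t)))); last by ring.
    by rewrite divff ?gt_eqF//; ring.
  rewrite E; apply: ler_wpM2l; first exact: ltW.
  rewrite lerBlDl; apply: (@slice_point _ t _ _ _ C0) => //.
  - exact: ltW.
  - by rewrite lerDl divr_ge0 ?sqr_ge0.
  - by rewrite ler_pdivrMr// [leRHS]mulrC; exact: vflux_le.
  - case: (vflux_annulus x) => [?|?]; last by right.
    by left; rewrite pmulr_lle0// invr_gt0.
have iJe e := gintegrable_edge iJ e; rewrite -/J in iJe.
have iIe e := gintegrable_edge iI e; rewrite -/I in iIe.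
have iI'e e := gintegrable_edge iI' e; rewrite -/I' in iI'e.
have iEe e : mu.-integrable `]0, len e[
    (EFin \o (fun s => tcut k T t * EP e s * w (ept e s))).
  apply: continuous_within_integrable_oo => s; apply: cvgM.
    exact: (continuous_subspaceT (cEP e)).
  by case: (Dw e) => cw _ _ _; exact: cw.
have iII e : mu.-integrable `]0, len e[
    (EFin \o (fun s => I (ept e s) - I' (ept e s))).
  exact: (integrableB _ (iIe e) (iI'e e)).
have iLII e : mu.-integrable `]0, len e[
    (EFin \o (fun s => Lam * (I (ept e s) - I' (ept e s)))).
  exact: (integrableZl _ Lam (iII e)).
have iJE e : mu.-integrable `]0, len e[
    (EFin \o (fun s => J (ept e s) - tcut k T t * EP e s * w (ept e s))).
  exact: (integrableB _ (iJe e) (iEe e)).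
have iQE e : mu.-integrable `]0, len e[ (EFin \o QE e).
  exact: (integrableB _ (iJE e) (iLII e)).
have QEle e : ((\int[mu]_(s in `]0, len e[) QE e s)%:E <=
    \int[mu]_(s in `]0%R, len e[) (H (ept e s))%:E)%E.
  rewrite /Rintegral fineK; last exact: (integrable_fin_num _ (iQE e)).
  apply: le_integral_lower => //.
  - by move=> s _; rewrite lee_fin.
  - apply: aeW => s /=; rewrite in_itv/= lee_fin => sl.
    have -> : QE e s = (tcut2 k T t * gc rho (ept e s) ^+ m
       + tcut k T t * (- EP e s)) * w (ept e s)
      - Lam * (h (ept e s) * w (ept e s) `^ sigma * (phi (ept e s) t - phi' (ept e s) t)).
      by rewrite /QE /J /I /I' wabs; ring.
    rewrite lerBlDl; apply: (@slice_point _ t _ _ _ (6 / r ^+ 2)) => //.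
    + by rewrite divr_ge0 ?sqr_ge0.
    + by rewrite lerDr ltW.
    + exact: eflux_le.
    + exact: eflux_annulus.
have key : gsum W VF EF J - (\sum_(x <- VF) w (vpt x) *
     (\sum_(y <- VF) omega W x y * (phi (vpt y) t - phi (vpt x) t)) +
   \sum_(e <- EF) (\int[mu]_(s in `]0, len e[) (tcut k T t * EP e s * w (ept e s)))%R)
   = Lam * (gsum W VF EF I - gsum W VF EF I') +
    (\sum_(x <- VF) QV x + \sum_(e <- EF) (\int[mu]_(s in `]0, len e[) QE e s)%R).
  have -> : \sum_(e <- EF) (\int[mu]_(s in `]0, len e[) QE e s)%R =
    \sum_(e <- EF) ((\int[mu]_(s in `]0, len e[) J (ept e s))%R -
      (\int[mu]_(s in `]0, len e[) (tcut k T t * EP e s * w (ept e s)))%R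
     - Lam * ((\int[mu]_(s in `]0, len e[) I (ept e s))%R -
       (\int[mu]_(s in `]0, len e[) I' (ept e s))%R)).
    apply: eq_bigr => e _; rewrite /QE.
    rewrite (RintegralB _ (iJE e) (iLII e))// (RintegralB _ (iJe e) (iEe e))//.
    by rewrite (RintegralZl Lam _ (iII e))// (RintegralB _ (iIe e) (iI'e e)).
  rewrite /QV /gsum !sumrB -!big_distrr/= !sumrB; ring.
rewrite -!EFinB -EFinM key EFinD; apply: leeD => //.
rewrite EFinD -!sumEFin; apply: leeD.
  by apply: lee_sum => x _; rewrite lee_fin.
by apply: lee_sum => e _; exact: QEle.
Qed.
End Slice.

(** * The weight integrals *)

Section WeightMeasurability.
Context {R : realType} {G : metric_graph R}.
Variables (x0 : vertex G).
Hypothesis conn : graph_connected G.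
Variables (h : gpoint G -> R -> R) (p theta1 theta2 rho : R).
Hypothesis mh : measurable_xt h.

Local Notation mu := (@lebesgue_measure R).

Definition weight (x : gpoint G) (t : R) : R :=
  h x t `^ p * \1_(E_set x0 theta1 theta2 rho) (x, t).

Lemma weight_ge0 x t : 0 <= weight x t.
Proof. by rewrite /weight mulr_ge0 ?powR_ge0// indicE. Qed.

Lemma indic_E_set x t : 0 <= t ->
  \1_(E_set x0 theta1 theta2 rho) (x, t) =
  \1_(`[rho `^ theta1, 2 * rho `^ theta1]%classic)
    (dist x (vpt x0) `^ theta1 + t `^ theta2) :> R.
Proof.
move=> t0; rewrite !indicE; congr (nat_of_bool _)%:R.
apply/idP/idP => /set_mem hx; apply/mem_set.
  by move: hx => [_]; rewrite /= in_itv.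
by split => //; move: hx; rewrite /= in_itv.
Qed.

Lemma measurable_weight_ept e :
  measurable_fun (`]0, len e[ `*` `[(0:R), +oo[)
    (fun q : R * R => weight (ept e q.1) q.2).
Proof.
apply: (@measurable_funM _ _ _ _ (fun q : R * R => h (ept e q.1) q.2 `^ p)).
  apply: (measurableT_comp (f := fun x : R => x `^ p)); last exact: mh.2.
  exact: measurable_powR.
have md : measurable_fun (`]0, len e[ `*` `[(0:R), +oo[)
    (fun q : R * R => dist (ept e q.1) (vpt x0) `^ theta1 + q.2 `^ theta2).
  apply: (@measurable_funD _ _ _ _ (fun q : R * R => dist (ept e q.1) (vpt x0) `^ theta1)).
    apply: (measurableT_comp (f := fun x : R => x `^ theta1)).
      exact: measurable_powR.
    apply: (measurable_comp (F := `]0, len e[%classic)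
      (f := fun s => dist (ept e s) (vpt x0)) (g := fst)) => //.
    - by move=> _ [[s t] [/= hs _] <-].
    - apply: (@measurable_funS _ _ _ _ `[0, len e]%classic) => //.
        exact: subset_itv_oo_cc.
      apply: subspace_continuous_measurable_fun => //.
      exact: dist_ept_continuous.
    - by apply: measurable_funTS; exact: measurable_fst.
  apply: (measurableT_comp (f := fun x : R => x `^ theta2)).
    exact: measurable_powR.
  by apply: measurable_funTS; exact: measurable_snd.
apply: (eq_measurable_fun (fun q : R * R =>
  \1_(`[rho `^ theta1, 2 * rho `^ theta1]%classic)
    (dist (ept e q.1) (vpt x0) `^ theta1 + q.2 `^ theta2) : R)).
  move=> [s t] /set_mem [_ /=]; rewrite in_itv/= andbT => t0.
  by rewrite indic_E_set.
apply: (measurableT_comp (f := \1_(`[rho `^ theta1, 2 * rho `^ theta1]%classic) : R -> R)) => //.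
Qed.

Lemma measurable_weight_vpt v :
  measurable_fun `[(0:R), +oo[ (weight (vpt v)).
Proof.
apply: measurable_funM.
  apply: (measurableT_comp (f := fun x : R => x `^ p)); last exact: mh.1.
  exact: measurable_powR.
apply: (eq_measurable_fun (fun t : R =>
  \1_(`[rho `^ theta1, 2 * rho `^ theta1]%classic)
    (dist (vpt v) (vpt x0) `^ theta1 + t `^ theta2) : R)).
  by move=> t /set_mem /=; rewrite in_itv/= andbT => t0; rewrite indic_E_set.
apply: (measurableT_comp (f := \1_(`[rho `^ theta1, 2 * rho `^ theta1]%classic) : R -> R)) => //.
by apply: measurable_funTS; apply: measurable_funD.
Qed.

Lemma measurable_weight_section e (t : R) : 0 <= t ->
  measurable_fun `]0, len e[ (fun s => weight (ept e s) t).
Proof.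
move=> t0; apply: (measurable_comp (F := `]0, len e[ `*` `[(0:R), +oo[)
  (f := fun q : R * R => weight (ept e q.1) q.2) (g := fun s => (s, t))) => //.
- exact: measurableX.
- by move=> _ [s hs <-]; split => //=; rewrite in_itv/= t0.
- exact: measurable_weight_ept.
- by apply: measurable_funTS; exact: pair2_measurable.
Qed.

(** Tonelli's theorem for the extension of the weight by zero. *)
Lemma measurable_weight_integral e :
  measurable_fun `[(0:R), +oo[
    (fun t => (\int[mu]_(s in `]0%R, len e[) (weight (ept e s) t)%:E)%E).
Proof.
set D := `]0, len e[ `*` `[(0:R), +oo[.
pose F := (EFin \o (fun q : R * R => weight (ept e q.1) q.2)) \_ D.
have mD : measurable D by exact: measurableX.
have mF : measurable_fun setT F.
  apply/(measurable_restrictT _ _).1 => //.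
  by apply/measurable_EFinP; exact: measurable_weight_ept.
have F0 q : (0 <= F q)%E.
  by apply: erestrict_ge0 => x _; rewrite lee_fin weight_ge0.
have := @measurable_fun_fubini_tonelli_G _ _ (measurableTypeR R) (measurableTypeR R) R mu F mF F0.
move=> /(@measurable_funTS _ _ _ _ `[(0:R), +oo[%classic).
apply: eq_measurable_fun => t /set_mem; rewrite /= in_itv/= andbT => t0.
rewrite /fubini_G [RHS]integral_mkcond; apply: eq_integral => s _.
rewrite /F !patchE; congr (if _ then _ else _).
apply/idP/idP => /set_mem hs; apply/mem_set; first by case: hs.
by split => //=; rewrite in_itv/= t0.
Qed.
End WeightMeasurability.

Section WeightIntegral.
Context {R : realType} {G : metric_graph R} (W : graph_weights G).
Variables (x0 : vertex G).
Hypothesis conn : graph_connected G.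
Variables (h : gpoint G -> R -> R) (p theta1 theta2 rho : R) (K : nat).
Hypothesis mh : measurable_xt h.
Variables (VF : seq (vertex G)) (EF : seq (edge G)).
Hypotheses (uV : uniq VF) (uE : uniq EF).

Local Notation mu := (@lebesgue_measure R).
Local Notation wt i := (weight x0 h p theta1 theta2 (ring_radius theta1 rho i)).
Local Notation ann := (annuli x0 theta1 theta2 rho K).

Definition vweight (r : R) : \bar R :=
  (\int[mu]_(t in `[0%R, +oo[)
     \esum_(x in [set: vertex G])
       (vmu W x * h (vpt x) t `^ p * \1_(E_set x0 theta1 theta2 r) (vpt x, t))%:E)%E.

Definition eweight (r : R) : \bar R :=
  (\int[mu]_(t in `[0%R, +oo[)
     \esum_(e in [set: edge G])
       \int[mu]_(s in `]0%R, len e[)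
         (h (ept e s) t `^ p * \1_(E_set x0 theta1 theta2 r) (ept e s, t))%:E)%E.

Lemma annuli_weight c x t :
  (c * (h x t `^ p * ann x t))%:E = (\sum_(i < K.+1) c%:E * (wt i x t)%:E)%E.
Proof.
rewrite /annuli big_distrr/= big_distrr/= -sumEFin; apply: eq_bigr => i _.
by rewrite -EFinM.
Qed.

(** The measurability of the weights allows the finite sums to be taken out of
    the time integral; each finite sum is then at most the series over the whole
    graph. *)
Lemma weight_integral_le (c : R) : 0 <= c ->
  (\int[mu]_(t in `[0%R, +oo[)
    (\sum_(x <- VF) (vmu W x * (c * (h (vpt x) t `^ p * ann (vpt x) t)))%:E
     + \sum_(e <- EF) \int[mu]_(s in `]0%R, len e[)
         (c * (h (ept e s) t `^ p * ann (ept e s) t))%:E)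
   <= c%:E * \sum_(i < K.+1) (vweight (ring_radius theta1 rho i)
                              + eweight (ring_radius theta1 rho i)))%E.
Proof.
move=> c0.
pose SV (i : 'I_K.+1) t := (\sum_(x <- VF) (vmu W x)%:E * (wt i (vpt x) t)%:E)%E.
pose SE (i : 'I_K.+1) t :=
  (\sum_(e <- EF) \int[mu]_(s in `]0%R, len e[) (wt i (ept e s) t)%:E)%E.
have SV0 i t : (0 <= SV i t)%E.
  by apply: sume_ge0 => x _; rewrite mule_ge0 ?lee_fin ?weight_ge0// ltW// vmu_gt0.
have SE0 i t : (0 <= SE i t)%E.
  apply: sume_ge0 => e _; apply: integral_ge0 => s _.
  by rewrite lee_fin weight_ge0.
have mSV i : measurable_fun `[(0:R), +oo[ (SV i).
  apply: emeasurable_sum => x; apply: measurable_funeM.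
  by apply/measurable_EFinP; exact: measurable_weight_vpt.
have mSE i : measurable_fun `[(0:R), +oo[ (SE i).
  by apply: emeasurable_sum => e; exact: measurable_weight_integral.
have mSD i : measurable_fun `[(0:R), +oo[ (fun t => SV i t + SE i t)%E.
  exact: emeasurable_funD.
under eq_integral => t tin.
  have t0 : 0 <= t by move: tin; rewrite inE/= in_itv/= andbT.
  rewrite (_ : (_ + _)%E = (\sum_(i < K.+1) c%:E * (SV i t + SE i t))%E); last first.
    under [RHS]eq_bigr do rewrite ge0_muleDr//.
    rewrite [RHS]big_split/=; congr (_ + _)%E.
      transitivity (\sum_(i < K.+1) \sum_(x <- VF)
          c%:E * ((vmu W x)%:E * (wt i (vpt x) t)%:E))%E.
        rewrite exchange_big/=; apply: eq_bigr => x _.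
        rewrite EFinM annuli_weight ge0_sume_distrr; last first.
          by move=> i _; rewrite mule_ge0 ?lee_fin ?weight_ge0.
        by apply: eq_bigr => i _; rewrite muleCA.
      apply: eq_bigr => i _; rewrite /SV ge0_sume_distrr// => x _.
      by rewrite mule_ge0 ?lee_fin ?weight_ge0// ltW// vmu_gt0.
    transitivity (\sum_(i < K.+1) \sum_(e <- EF)
        c%:E * \int[mu]_(s in `]0%R, len e[) (wt i (ept e s) t)%:E)%E.
      rewrite exchange_big/=; apply: eq_bigr => e _.
      have mw i : measurable_fun `]0, len e[ (fun s => (wt i (ept e s) t)%:E).
        by apply/measurable_EFinP; exact: measurable_weight_section.
      under eq_integral do rewrite annuli_weight.
      rewrite ge0_integral_sum//; last 2 first.
      - by move=> i; apply: measurable_funeM; exact: mw.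
      - by move=> i s _; rewrite mule_ge0 ?lee_fin ?weight_ge0.
      have w0 i (s : R) : `]0, len e[%classic s -> (0 <= (wt i (ept e s) t)%:E)%E.
        by move=> _; rewrite lee_fin weight_ge0.
      apply: eq_bigr => i _; apply: ge0_integralZl_EFin => //; [exact: w0|exact: mw].
    apply: eq_bigr => i _; rewrite /SE ge0_sume_distrr// => e _.
    by apply: integral_ge0 => s _; rewrite lee_fin weight_ge0.
  over.
rewrite ge0_integral_sum//; last 2 first.
- by move=> i; apply: measurable_funeM; exact: mSD.
- by move=> i t _; rewrite mule_ge0// ?lee_fin// adde_ge0.
have vw0 r : (0 <= vweight r)%E.
  apply: integral_ge0 => t _; apply: esum_ge0 => x _.
  by rewrite lee_fin -mulrA mulr_ge0 ?weight_ge0// ltW// vmu_gt0.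
have ew0 r : (0 <= eweight r)%E.
  apply: integral_ge0 => t _; apply: esum_ge0 => e _; apply: integral_ge0 => s _.
  by rewrite lee_fin weight_ge0.
rewrite ge0_sume_distrr; last by move=> i _; exact: adde_ge0.
apply: lee_sum => i _; rewrite ge0_integralZl_EFin//; last 2 first.
- by move=> t _; rewrite adde_ge0.
- exact: mSD.
apply: lee_wpmul2l; first by rewrite lee_fin.
have -> : (\int[mu]_(t in `[0%R, +oo[) (SV i t + SE i t) =
    \int[mu]_(t in `[0%R, +oo[) SV i t + \int[mu]_(t in `[0%R, +oo[) SE i t)%E.
  by apply: ge0_integralD => //; first [exact: mSV|exact: mSE].
apply: leeD; apply: ge0_le_lower_integral => // t _.
  apply: le_trans (esum_ge_seq _ uV); apply: lee_sum => x _.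
  by rewrite -EFinM lee_fin /weight mulrA.
exact: (esum_ge_seq (fun e => \int[mu]_(s in `]0%R, len e[) (wt i (ept e s) t)%:E)%E uE).
Qed.
End WeightIntegral.

(** * Order properties of the integral over the graph *)

Section GIntegralOrder.
Context {R : realType} {G : metric_graph R} (W : graph_weights G).
Local Notation mu := (@lebesgue_measure R).

Lemma gintegral_ge0_le (F F' : gpoint G -> \bar R) :
  (forall x, (0 <= F x)%E) -> (forall x, (F x <= F' x)%E) ->
  (gintegral_ge0 W F <= gintegral_ge0 W F')%E.
Proof.
move=> F0 FF; apply: leeD.
  apply: le_esum => x _; apply: lee_wpmul2l => //.
  by rewrite lee_fin ltW// vmu_gt0.
by apply: le_esum => e _; exact: ge0_le_lower_integral.
Qed.

Lemma gintegral_le (f g : gpoint G -> R) : (forall x, f x <= g x) ->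
  (gintegral W f <= gintegral W g)%E.
Proof.
move=> fg; apply: leeB; apply: gintegral_ge0_le => x.
- exact: funepos_ge0.
- by rewrite !funeposE le_max2// lee_fin.
- exact: funeneg_ge0.
- by rewrite !funenegE le_max2// leeN2 lee_fin.
Qed.

Lemma gintegral_ge0_0 : gintegral_ge0 W (cst 0%E) = 0%E.
Proof.
rewrite /gintegral_ge0 !esum1 ?adde0// => [e _|x _]; last by rewrite mule0.
exact: integral0.
Qed.

Lemma gintegral_nneg (f : gpoint G -> R) : (forall x, 0 <= f x) ->
  gintegral W f = gintegral_ge0 W (EFin \o f).
Proof.
move=> f0; rewrite /gintegral.
have -> : ((EFin \o f)^\+)%E = EFin \o f.
  by apply/funext => x; rewrite funeposE max_l// lee_fin.
have -> : ((EFin \o f)^\-)%E = cst 0%E.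
  by apply/funext => x; rewrite funenegE max_r// -EFinN lee_fin oppr_le0.
by rewrite gintegral_ge0_0 sube0.
Qed.

Lemma gintegral0 : gintegral W (fun=> 0) = 0%E.
Proof. by rewrite gintegral_nneg//; exact: gintegral_ge0_0. Qed.

Lemma gintegral_split (f : gpoint G -> R) :
  gintegral W f = (gintegral W (fun x => Num.max (f x) 0%R)
                   + gintegral W (fun x => Num.min (f x) 0%R))%E.
Proof.
rewrite [X in (X + _)%E]gintegral_nneg; last by move=> x; rewrite le_max lexx orbT.
rewrite /gintegral; congr (_ + _)%E.
  by congr gintegral_ge0; apply/funext => x; rewrite funeposE /= EFin_max.
have -> : ((EFin \o (fun x => (Num.min (f x) 0)%R))^\+)%E = cst 0%E.
  apply/funext => x; rewrite funeposE max_r//= lee_fin ge_min lexx orbT//.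
rewrite gintegral_ge0_0 sub0e; congr (- gintegral_ge0 _ _)%E.
apply/funext => x; rewrite !funenegE /= -!EFin_max; congr EFin.
have [fx|fx] := leP (f x) 0; first by [].
by rewrite oppr0 maxxx max_r// oppr_le0 ltW.
Qed.

Lemma gintegrable_fin_num (f : gpoint G -> R) : gintegrable W f ->
  gintegral W f \is a fin_num.
Proof.
move=> [_ fi]; rewrite /gintegral fin_numB; apply/andP; split;
  rewrite ge0_fin_numE.
- apply: le_lt_trans fi; apply: gintegral_ge0_le => x; first exact: funepos_ge0.
  by rewrite funeposE /= ge_max !lee_fin ler_norm normr_ge0.
- apply: adde_ge0; apply: esum_ge0 => *; last by apply: integral_ge0 => s _; exact: funepos_ge0.
  by rewrite mule_ge0 ?funepos_ge0// lee_fin ltW// vmu_gt0.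
- apply: le_lt_trans fi; apply: gintegral_ge0_le => x; first exact: funeneg_ge0.
  by rewrite funenegE /= ge_max !lee_fin -normrN ler_norm normr_ge0.
- apply: adde_ge0; apply: esum_ge0 => *; last by apply: integral_ge0 => s _; exact: funeneg_ge0.
  by rewrite mule_ge0 ?funeneg_ge0// lee_fin ltW// vmu_gt0.
Qed.

Lemma gintegral_eq0_vertex (f : gpoint G -> R) : (forall x, 0 <= f x) ->
  gintegral W f = 0%E -> forall v, f (vpt v) = 0.
Proof.
move=> f0; rewrite gintegral_nneg// => If v.
have : ((vmu W v)%:E * (f (vpt v))%:E <= 0)%E.
  rewrite -If /gintegral_ge0; apply: (@le_trans _ _
    (\esum_(x in [set: vertex G]) ((vmu W x)%:E * (f (vpt x))%:E))%E).
    have := @esum_ge_seq R _ (fun x : vertex G => (vmu W x)%:E * (f (vpt x))%:E)%E [:: v] isT.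
    by rewrite big_seq1.
  by rewrite leeDl//; apply: esum_ge0 => e _; apply: integral_ge0 => s _; rewrite lee_fin.
rewrite -EFinM lee_fin pmulr_rle0 ?vmu_gt0// => h.
by apply/eqP; rewrite eq_le h f0.
Qed.

Lemma gintegral_eq0_edge (f : gpoint G -> R) : (forall x, 0 <= f x) ->
  gmeasurable f -> gintegral W f = 0%E ->
  forall e, {ae mu, forall s, 0 < s < len e -> f (ept e s) = 0}.
Proof.
move=> f0 mf; rewrite gintegral_nneg// => If e.
have I0 : (\int[mu]_(s in `]0%R, len e[) `|(f (ept e s))%:E|)%E = 0%E.
  under eq_integral do rewrite gee0_abs ?lee_fin//.
  apply/eqP; rewrite eq_le; apply/andP; split; last first.
    by apply: integral_ge0 => s _; rewrite lee_fin.
  rewrite -If /gintegral_ge0; apply: (@le_trans _ _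
    (\esum_(e in [set: edge G]) \int[mu]_(s in `]0%R, len e[) (f (ept e s))%:E)%E).
    have := @esum_ge_seq R _ (fun e : edge G =>
      (\int[mu]_(s in `]0%R, len e[) (f (ept e s))%:E)%E) [:: e] isT.
    by rewrite big_seq1.
  rewrite leeDr//; apply: esum_ge0 => x _.
  by rewrite mule_ge0 ?lee_fin// ltW// vmu_gt0.
have h : measurable_fun `]0, len e[ (EFin \o (f \o ept e)).
  by apply/measurable_EFinP; exact: mf.
have [h1 _] := @ae_eq_integral_abs _ _ R mu _ (measurable_itv `]0, len e[) _ h.
have := h1 I0; apply: filterS => s /= hs sl.
by apply: EFin_inj; apply: hs; rewrite in_itv.
Qed.
End GIntegralOrder.

(** * Vanishing criteria *)

(** A point where a continuous function does not vanish has a neighbourhood of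
    positive measure with the same property. *)
Lemma ae_zero_continuous (R : realType) (f : R -> R) (l : R) :
  (forall s : R, 0 < s < l -> {for s, continuous f}) ->
  {ae (@lebesgue_measure R), forall s, 0 < s < l -> f s = 0} ->
  forall s : R, 0 < s < l -> f s = 0.
Proof.
move=> cf [N [mN N0 hN]] s sl; apply/eqP; apply/negP => /negP fs0.
have n1 : \forall z \near s, f z != 0.
  have /cvgrPdist_lt h := cf s sl.
  have fp : 0 < `|f s| by rewrite normr_gt0.
  have := h _ fp; apply: filterS => z.
  by apply: contraTneq => ->; rewrite subr0 ltxx.
have /andP[s0 s1] := sl.
have n2 : \forall z \near s, 0 < z < l.
  near=> z; apply/andP; split; near: z; [exact: lt_nbhsr|exact: lt_nbhsl].
have [d /= d0 hd] : nbhs s [set z | f z != 0 /\ 0 < z < l].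
  by apply: filterS2 n1 n2.
have sub : `]s - d, s + d[%classic `<=` N.
  move=> z; rewrite /= in_itv/= => /andP[z1 z2]; apply: hN => /= hz.
  have [fz zl] : f z != 0 /\ 0 < z < l.
    by apply: hd; rewrite /= ltr_norml; apply/andP; split; lra.
  by move: fz; rewrite hz// eqxx.
have : (@lebesgue_measure R `](s - d)%R, (s + d)%R[ <= 0)%E.
  by rewrite -N0; apply: le_measure; rewrite ?inE.
rewrite lebesgue_measure_itv/= lte_fin ifT; last by lra.
by rewrite -EFinB lee_fin; apply/negP; rewrite -ltNge; lra.
Unshelve. all: by end_near. Qed.

(** With [Lam = 1/2] the sequence is bounded, so it converges and its increments
    tend to [0]. Then a large [Lam] makes [B * Lam `^ (- a)] small, and a late [n]
    makes [Lam] times the increment small. *)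
Lemma seq_vanish (R : realType) (M : nat -> R) (B a : R) :
  0 < a -> 0 <= B -> (forall n, 0 <= M n) -> (forall n, M n <= M n.+1) ->
  (forall eps, 0 < eps -> exists N, forall n, (N <= n)%N ->
     forall Lam, 0 < Lam ->
       M n.+1 <= Lam * (M n.+1 - M n) + B * Lam `^ (- a) + eps) ->
  forall n, M n = 0.
Proof.
move=> a0 B0 M0 Mmono H.
have ndM : nondecreasing_seq M by apply/nondecreasing_seqP.
have [N1 hN1] := H 1 ltr01.
pose B1 := 2 * (B * 2^-1 `^ (- a) + 1).
have ubM n : M n <= B1.
  have h m : (N1 <= m)%N -> M m.+1 <= B1.
    move=> Nm; have := hN1 m Nm 2^-1; rewrite invr_gt0 ltr0n => /(_ isT).
    have := M0 m; rewrite /B1; lra.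
  apply: (@le_trans _ _ (M (maxn n N1).+1)).
    by apply: ndM; rewrite (leq_trans (leq_maxl n N1)).
  by apply: h; rewrite leq_maxr.
pose l := sup (range M).
have hsM : has_sup (range M).
  by split; [exists (M 0%N), 0%N|exists B1 => _ [n _ <-]].
have Ml n : M n <= l by apply: ub_le_sup; [exact: hsM.2|exists n].
suff l0 : l <= 0.
  by move=> n; apply/eqP; rewrite eq_le M0 (le_trans (Ml n)).
rewrite leNgt; apply/negP => l0.
(* The errors below are at most [e], [e], [e] and [B * e], and [(B + 3) * e] is
   half of the limit. *)
pose e := l / (2 * (B + 3)).
have e0 : 0 < e by rewrite divr_gt0// mulr_gt0// ltr_wpDl.
have [N hN] := H e e0.
pose Lam := e `^ (- a^-1).
have L0 : 0 < Lam by rewrite powR_gt0.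
have LE : Lam `^ (- a) = e.
  by rewrite /Lam -powRrM mulrNN mulVf ?gt_eqF// powRr1// ltW.
pose d := Num.min e (e / Lam).
have d0 : 0 < d by rewrite lt_min e0 divr_gt0.
have [_ [n0 _ <-] hn0] := sup_adherent d0 hsM; rewrite -/l in hn0.
pose n := maxn n0 N.
have hn : l - d < M n by apply: lt_le_trans hn0 _; apply: ndM; exact: leq_maxl.
have := hN n (leq_maxr _ _) Lam L0; rewrite LE => hm.
have de : d <= e by rewrite ge_min lexx.
have dL : Lam * d <= e.
  by rewrite mulrC -ler_pdivlMr// ge_min lexx orbT.
have q1 : Lam * (M n.+1 - M n) <= Lam * d.
  by apply: ler_wpM2l; [exact: ltW|have := Ml n.+1; lra].
have q2 : l <= (B + 3) * e.
  have := Mmono n; lra.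
have q3 : (B + 3) * e = l / 2 by rewrite /e; field; lra.
by move: q2; rewrite q3; lra.
Qed.

(** * Iteration over the scales *)

Lemma ae_mono (R : realType) (P Q : R -> Prop) :
  {ae (@lebesgue_measure R), forall t, P t} -> (forall t, P t -> Q t) ->
  {ae (@lebesgue_measure R), forall t, Q t}.
Proof. by move=> [A [mA A0 PA]] PQ; exists A; split => // t nQ; apply: PA => /PQ. Qed.

Lemma ae_and (R : realType) (P Q : R -> Prop) :
  {ae (@lebesgue_measure R), forall t, P t} ->
  {ae (@lebesgue_measure R), forall t, Q t} ->
  {ae (@lebesgue_measure R), forall t, P t /\ Q t}.
Proof.
move=> [A [mA A0 PA]] [B [mB B0 QB]]; exists (A `|` B); split.
- exact: measurableU.
- by rewrite measureU0.
- move=> t; apply: contra_notP => /not_orP[tA tB].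
  by split; apply: contrapT => h; [apply: tA; exact: PA|apply: tB; exact: QB].
Qed.

Lemma leeB_of_leeD (R : realType) (a c d e : \bar R) (L : R) :
  c \is a fin_num -> d \is a fin_num ->
  (a <= L%:E * (c - d) + e -> a - L%:E * (c - d) <= e)%E.
Proof.
by move=> cf df ac; rewrite leeBlDr ?fin_numM ?fin_numB ?cf// addeC.
Qed.

Lemma weak_balance (R : realType) (a b : \bar R) (m m' U X L : R) :
  a \is a fin_num -> b \is a fin_num ->
  (- a + b + m%:E + U%:E <= 0)%E ->
  (a - b - L%:E * (m%:E - m'%:E) <= X%:E)%E ->
  m <= L * (m - m') + X - U.
Proof.
move=> /fineK <- /fineK <-; move: (fine a) (fine b) => {}a {}b i1 i2.
have {i1} : - a + b + m + U <= 0 by exact: i1.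
have {i2} : a - b - L * (m - m') <= X by exact: i2.
lra.
Qed.

Lemma limf_einf_pinfty (R : realType) (f : R -> \bar R) :
  (0 <= limf_einf f (pinfty_nbhs R))%E ->
  forall eps : R, 0 < eps -> exists A : R, forall x, A < x -> ((- eps)%:E <= f x)%E.
Proof.
move=> f0 eps e0; have : ((- eps)%:E < limf_einf f (pinfty_nbhs R))%E.
  by apply: lt_le_trans f0; rewrite lte_fin oppr_lt0.
rewrite limf_einfE => /ereal_sup_gt[_ [V [A [_ hA]] <-] hV].
exists A => x Ax; apply: (le_trans (ltW hV)).
by apply: ereal_inf_lbound; exists x => //; exact: hA.
Qed.

Section Main.
Context {R : realType} {G : metric_graph R} (W : graph_weights G)
  (x0 : vertex G) (C0 sigma theta1 theta2 C : R)
  (h : gpoint G -> R -> R) (u0 u1 : gpoint G -> R) (u : gpoint G -> R -> R).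
Hypothesis conn : graph_connected G.
Hypothesis len_ub : has_ubound (range (@len R G)).
Hypothesis inf_gt0 : 0 < inf_len G.
Hypothesis fin_ball : forall rho : R, 0 < rho -> meets_finitely_many (gball (vpt x0) rho).
Hypothesis C00 : 0 < C0.
Hypothesis omegaC : forall x : vertex G,
  \sum_(y \in [set y | gadjacent x y]) omega W x y <= C0 * vmu W x.
Hypothesis mh : measurable_xt h.
Hypothesis h0 : forall x t, 0 <= t -> 0 < h x t.
Hypothesis s1 : 1 < sigma.
Hypothesis th1 : 2 <= theta1.
Hypothesis th2 : 2 <= theta2.
Hypothesis th12 : theta2 / 2 <= theta1.
Hypothesis C_gt0 : 0 < C.
Local Notation R0 := (Num.max (2 * sup_len G) 1).
Hypothesis weights : forall rho : R, R0 <= rho ->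
  (vweight W x0 h (- (sigma - 1)^-1) theta1 theta2 rho
     <= (C * rho `^ (sigma / (sigma - 1)))%:E)%E /\
  (eweight x0 h (- (sigma - 1)^-1) theta1 theta2 rho
     <= (C * rho `^ (sigma / (sigma - 1)))%:E)%E.
Hypothesis sol : very_weak_solution W h sigma u0 u1 u.
Hypothesis u_ge0 : forall x t, 0 <= t -> 0 <= u x t.
Variables (k K : nat).
Hypothesis ks : k.+3%:R <= sigma * k.+1%:R.
Hypothesis hK : 3 `^ theta1 + 2 `^ theta2 <= 2 ^+ K.+1 / 2 `^ theta1.

Local Notation mu := (@lebesgue_measure R).
Local Notation j := (sup_len G).
Local Notation r := (inf_len G).
Local Notation kap := (2 `^ theta1^-1 : R).
Local Notation T rho := (rho `^ (theta1 / theta2)).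
Local Notation phi rho := (cutoff x0 kap rho k (T rho)).

Lemma len_le_sup (e : edge G) : len e <= sup_len G.
Proof. by apply: ub_le_sup => //; exists e. Qed.

Lemma inf_le_len (e : edge G) : inf_len G <= len e.
Proof.
apply: ge_inf; last by exists e.
by exists 0 => _ [e' _ <-]; exact/ltW/len_gt0.
Qed.

Lemma sup_len_ge0 : 0 <= sup_len G.
Proof.
have [[e _]|n0] := pselect (exists e : edge G, True).
  exact: le_trans (ltW (len_gt0 e)) (len_le_sup e).
rewrite /sup_len sup_out// => -[[_ [e _ _]] _]; apply: n0; by exists e.
Qed.

Let t1p : 0 < theta1. Proof. by move: th1; lra. Qed.
Let t2p : 0 < theta2. Proof. by move: th2; lra. Qed.

Lemma kap_gt1 : 1 < kap.
Proof.
have : 1 `^ theta1^-1 < kap.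
  by apply: gt0_ltr_powR; rewrite ?invr_gt0 ?nnegrE ?ltr1n.
by rewrite powR1.
Qed.

Lemma kap_le2 : kap <= 2.
Proof.
rewrite -[leRHS](@powRr1 R 2)//; apply: ler_powR; rewrite ?ler1n//.
by rewrite invf_le1//; move: th1; lra.
Qed.

Lemma half_le_ratio : 2^-1 <= theta1 / theta2.
Proof. by rewrite ler_pdivlMr// mulrC. Qed.

Lemma T_gt0 (rho : R) : 0 < rho -> 0 < T rho.
Proof. exact: powR_gt0. Qed.

(** The second time derivative of the cutoff is of order [T ^- 2]; the relation
    between the exponents makes this at most of the order [1 / rho] of the
    Laplacian. *)
Lemma T_sq (rho : R) : 1 <= rho -> rho <= T rho ^+ 2.
Proof.
move=> r1; rewrite -powR_mulrn ?powR_ge0// -powRrM.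
rewrite -[leLHS]powRr1 ?(le_trans ler01)//; apply: ler_powR => //.
have := half_le_ratio; lra.
Qed.

(** The time cutoff of the scale [rho / 4] is over before that of the scale [rho]
    starts to decrease. *)
Lemma T_quarter (rho : R) : 0 < rho -> 2 * T (rho / 4) <= T rho.
Proof.
move=> r0; have E : rho = 4 * (rho / 4) by field.
have -> : T rho = 4 `^ (theta1 / theta2) * T (rho / 4).
  by rewrite -powRM ?divr_ge0 ?(ltW r0)// -E.
apply: ler_wpM2r; first exact: powR_ge0.
have -> : 2 = 4 `^ 2^-1 :> R.
  rewrite (_ : 4 = 2 `^ 2%:R :> R); last by rewrite powR_mulrn//; ring.
  by rewrite -powRrM mulfV// powRr1.
by apply: ler_powR; rewrite ?ler1n//; exact: half_le_ratio.
Qed.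

Lemma R0_gt0 : 0 < R0. Proof. by rewrite lt_max ltr01 orbT. Qed.

Lemma phi_test (rho : R) : 0 < rho -> test_function (phi rho).
Proof.
move=> r0; apply: (test_function_cutoff kap_gt1 conn sup_len_ge0 len_le_sup) => //.
exact: T_gt0.
Qed.

Definition slice_mass (rho t : R) : \bar R :=
  gintegral W (fun x => h x t * `|u x t| `^ sigma * phi rho x t).

Definition mass (rho : R) : R :=
  fine (\int[mu]_(t in `[0%R, +oo[) slice_mass rho t)%E.

Lemma mass_integrable (rho : R) : 0 < rho ->
  {ae mu, forall t, 0 <= t ->
     gintegrable W (fun x => h x t * `|u x t| `^ sigma * phi rho x t)} /\
  mu.-integrable `[0, +oo[ (slice_mass rho).
Proof. by move=> r0; have [_ _ + _ _] := vws_integrable sol (phi_test r0). Qed.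

Lemma slice_fun_ge0 (rho t : R) x : 0 <= t ->
  0 <= h x t * `|u x t| `^ sigma * phi rho x t.
Proof.
move=> t0; rewrite mulr_ge0//; last by case/andP: (cutoff_itv x0 kap k rho (T rho) x t).
by rewrite mulr_ge0 ?powR_ge0// ltW// h0.
Qed.

Lemma mass_ge0 (rho : R) : 0 <= mass rho.
Proof.
rewrite /mass fine_ge0// integral_ge0// => t /=; rewrite in_itv/= andbT => t0.
rewrite /slice_mass -(gintegral0 W); apply: gintegral_le => x; exact: slice_fun_ge0.
Qed.

Lemma massE (rho : R) : 0 < rho ->
  (\int[mu]_(t in `[0%R, +oo[) slice_mass rho t = (mass rho)%:E)%E.
Proof.
move=> r0; have [_ iM] := mass_integrable r0; rewrite /mass fineK//.
exact: (integrable_fin_num _ iM).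
Qed.

Lemma phi_quarter_le (rho t : R) x : 0 < rho -> 0 <= t ->
  phi (rho / 4) x t <= phi rho x t.
Proof.
move=> r0 t0.
have r40 : 0 < rho / 4 by rewrite divr_gt0.
apply: cutoff_small_le => //.
- exact: kap_gt1.
- by rewrite mulrC divfK.
- exact: T_gt0.
- exact: T_quarter.
Qed.

Lemma mass_mono (rho : R) : 0 < rho -> mass (rho / 4) <= mass rho.
Proof.
move=> r0; have r40 : 0 < rho / 4 by rewrite divr_gt0.
rewrite -lee_fin -[leLHS](massE r40) -[leRHS](massE r0).
apply: ge0_le_lower_integral => t; rewrite /= in_itv/= andbT => t0.
  rewrite /slice_mass -(gintegral0 W); apply: gintegral_le => x.
  exact: slice_fun_ge0.
apply: gintegral_le => x.
apply: ler_wpM2l; first by rewrite mulr_ge0 ?powR_ge0// ltW// h0.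
exact: phi_quarter_le.
Qed.

Definition massC : R :=
  slicec kap j r C0 k `^ (sigma / (sigma - 1)) *
    (K.+1%:R * (2 * C * ((2 ^+ K) `^ theta1^-1) `^ (sigma / (sigma - 1)))).

Lemma massC_ge0 : 0 <= massC.
Proof.
by rewrite /massC mulr_ge0 ?powR_ge0// mulr_ge0// mulr_ge0 ?powR_ge0// mulr_ge0// ltW.
Qed.

(** The derivatives of the cutoff contribute the power [- sigma / (sigma - 1)] of
    [rho] and the hypothesis on the weights the opposite power, so that the bound
    does not depend on the scale. *)
Lemma rings_le (rho Lam : R) : 2 * R0 <= rho -> 0 < Lam ->
  ((slicek kap j r C0 k rho sigma Lam)%:E *
    \sum_(i < K.+1) (vweight W x0 h (- (sigma - 1)^-1) theta1 theta2 (ring_radius theta1 rho i)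
      + eweight x0 h (- (sigma - 1)^-1) theta1 theta2 (ring_radius theta1 rho i))
   <= (massC * Lam `^ (- (sigma - 1)^-1))%:E)%E.
Proof.
move=> rR L0; set q := sigma / (sigma - 1).
have r0 : 0 < rho by have := R0_gt0; move: rR; lra.
have sm0 : 0 < sigma - 1 by rewrite subr_gt0.
have q0 : 0 <= q by rewrite divr_ge0 ?(ltW sm0)//; move: s1; lra.
pose B := C * (((2 ^+ K) `^ theta1^-1) `^ q * rho `^ q).
have ringB (i : 'I_K.+1) :
    (vweight W x0 h (- (sigma - 1)^-1) theta1 theta2 (ring_radius theta1 rho i)
      + eweight x0 h (- (sigma - 1)^-1) theta1 theta2 (ring_radius theta1 rho i)
     <= (B + B)%:E)%E.
  have p1 : 1 <= (2 ^+ i) `^ theta1^-1 :> R.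
    rewrite -[X in X <= _](@powRr0 R (2 ^+ i)); apply: ler_powR.
      by rewrite exprn_ege1// ler1n.
    by rewrite invr_ge0 ltW.
  have rl : R0 <= ring_radius theta1 rho i.
    rewrite /ring_radius; apply: (@le_trans _ _ (1 * (rho / 2))); first by move: rR; lra.
    by apply: ler_wpM2r => //; rewrite divr_ge0// ltW.
  have [v e] := weights rl.
  have rB : C * ring_radius theta1 rho i `^ q <= B.
    apply: ler_wpM2l; first exact: ltW.
    rewrite -powRM ?powR_ge0 ?(ltW r0)//; apply: ge0_ler_powR => //;
      rewrite ?nnegrE /ring_radius ?mulr_ge0 ?powR_ge0 ?divr_ge0 ?(ltW r0)//.
    apply: ler_pM; rewrite ?powR_ge0 ?divr_ge0 ?(ltW r0)//.
      apply: ge0_ler_powR; rewrite ?invr_ge0 ?(ltW t1p) ?nnegrE ?exprn_ge0//.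
      by rewrite ler_weXn2l ?ler1n// -ltnS.
    by rewrite ler_pdivrMr// ler_pMr// ler1n.
  rewrite EFinD; apply: leeD; [apply: (le_trans v)|apply: (le_trans e)];
    by rewrite lee_fin.
have sl0 : 0 <= slicek kap j r C0 k rho sigma Lam by rewrite mulr_ge0 ?powR_ge0.
apply: (@le_trans _ _ ((slicek kap j r C0 k rho sigma Lam)%:E *
    \sum_(i < K.+1) (B + B)%:E)%E).
  by apply: lee_wpmul2l; [rewrite lee_fin|apply: lee_sum => i _; exact: ringB].
rewrite sumEFin -EFinM lee_fin sumr_const card_ord.
have sc0 : 0 <= slicec kap j r C0 k.
  by apply: slicec_ge0; [exact: kap_gt1|exact: sup_len_ge0|exact: C00].
rewrite /slicek /massC powRM ?invr_ge0 ?(ltW r0)// -/q.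
rewrite le_eqVlt; apply/orP; left; apply/eqP; rewrite /B -mulr_natl.
have E : rho^-1 `^ q * rho `^ q = 1.
  by rewrite -powRM ?invr_ge0 ?(ltW r0)// mulVf ?gt_eqF// powR1.
set a := slicec _ _ _ _ _ `^ q; set b := rho^-1 `^ q in E *; set c := Lam `^ _.
set d := (_ `^ _) `^ q; set f := rho `^ q in E *.
transitivity (a * (K.+1%:R * (2 * C * d)) * c * (b * f)); first by ring.
by rewrite E; ring.
Qed.

Definition initial_mass (rho : R) : \bar R :=
  gintegral W (fun x => u1 x * phi rho x 0).

Lemma initial_mass_fin (rho : R) : 0 < rho -> initial_mass rho \is a fin_num.
Proof.
move=> r0; apply: gintegrable_fin_num.
by have [_ _ _ + _] := vws_integrable sol (phi_test r0).
Qed.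

(** The cutoff is [1] on the ball of the positive part and [0] outside the ball of
    the negative part. *)
Lemma initial_mass_ge (rho : R) : 0 < rho ->
  (gintegral_pos W (gball (vpt x0) (rho - j)) u1
   + gintegral_neg W (gball (vpt x0) (kap * rho + j)) u1 <= initial_mass rho)%E.
Proof.
move=> r0; rewrite /initial_mass [leRHS]gintegral_split.
have p01 x : 0 <= phi rho x 0 <= 1 by exact: cutoff_itv.
apply: leeD; apply: gintegral_le => x; have /andP[p0 p1] := p01 x.
- rewrite indicE; case: (boolP (x \in _)) => [/set_mem hx|_]; last first.
    by rewrite mulr0 le_max lexx orbT.
  have -> : phi rho x 0 = 1; last by rewrite !mulr1.
  rewrite /cutoff (gcut_eq1 kap_gt1 conn sup_len_ge0 len_le_sup r0 (ltW hx)).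
  by rewrite expr1n mul1r tcut_eq1 ?T_gt0// ltW// T_gt0.
- rewrite indicE; case: (boolP (x \in _)) => [_|hx].
    rewrite mulr1; have [ux|ux] := leP (u1 x) 0.
      by rewrite le_min ux andbT -[leLHS]mulr1 ler_wnM2l.
    by rewrite le_min lexx andbT mulr_ge0// ltW.
  have -> : phi rho x 0 = 0; last by rewrite !mulr0 minxx.
  rewrite /cutoff (@gcut_far _ _ x0 _ kap_gt1 conn _ sup_len_ge0 len_le_sup)//.
    by rewrite expr0n mul0r.
  by rewrite leNgt; apply: contraNN hx => hx; apply/mem_set.
Qed.

(** [slice_integral] holds for almost every time; its integral is combined with
    the weak inequality for the cutoff, whose term in [u0] vanishes because the
    cutoff is constant in time near [0]. *)
Lemma time_step (rho Lam : R) : 2 * R0 <= rho -> 0 < Lam ->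
  mass rho <= Lam * (mass rho - mass (rho / 4))
    + massC * Lam `^ (- (sigma - 1)^-1) - fine (initial_mass rho).
Proof.
move=> rR L0.
have r1 : 1 <= rho.
  have : 1 <= R0 by rewrite le_max lexx orbT.
  by move: rR; lra.
have r0 : 0 < rho by exact: lt_le_trans r1.
have r40 : 0 < rho / 4 by rewrite divr_gt0.
have r4j : 4 * j <= rho.
  have : 2 * j <= R0 by rewrite le_max lexx.
  by move: rR; lra.
have tphi := phi_test r0.
have [[aeJ intJ] [aeK intK] [aeI intI] iU iU0] := vws_integrable sol tphi.
have [aeI' intI'] := mass_integrable r40.
pose Jt t := gintegral W (fun x => dt (dt (phi rho)) x t * u x t).
pose Kt t := gintegral W (fun x => phi rho x t * glaplacian W (u ^~ t) x).
have intJ' : mu.-integrable `[0, +oo[ Jt by exact: intJ.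
have intK' : mu.-integrable `[0, +oo[ Kt by exact: intK.
have intM : mu.-integrable `[0, +oo[ (slice_mass rho) by exact: intI.
have intM' : mu.-integrable `[0, +oo[ (slice_mass (rho / 4)) by exact: intI'.
(* A ball containing the support of the cutoff together with its neighbours. *)
set M := kap * rho + 2 * j + 1.
have M0 : 0 < M.
  rewrite /M ltr_wpDl// addr_ge0 ?mulr_ge0 ?(ltW r0) ?sup_len_ge0 ?powR_ge0//.
have [/finite_seqP[sV sVE] /finite_seqP[sE sEE]] := fin_ball M0.
pose VF := undup sV; pose EF := undup sE.
have hV v : dist (vpt v) (vpt x0) < M -> v \in VF.
  by move=> hv; rewrite mem_undup; move: (sVE) => /seteqP[+ _]; apply.
have hE e (s : R) : 0 < s < len e -> dist (ept e s) (vpt x0) < M -> e \in EF.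
  move=> sl he; rewrite mem_undup; move: (sEE) => /seteqP[+ _]; apply.
  by exists s.
have uV : uniq VF by exact: undup_uniq.
have uE : uniq EF by exact: undup_uniq.
pose p := - (sigma - 1)^-1.
pose sk := slicek kap j r C0 k rho sigma Lam.
pose H t : \bar R := (\sum_(x <- VF)
      (vmu W x * (sk * (h (vpt x) t `^ p * annuli x0 theta1 theta2 rho K (vpt x) t)))%:E
     + \sum_(e <- EF) \int[mu]_(s in `]0%R, len e[)
         (sk * (h (ept e s) t `^ p * annuli x0 theta1 theta2 rho K (ept e s) t))%:E)%E.
have sk0 : 0 <= sk by rewrite mulr_ge0 ?powR_ge0.
have intH : (\int[mu]_(t in `[0%R, +oo[) H t <= (massC * Lam `^ p)%:E)%E.
  apply: (le_trans (@weight_integral_le _ _ W x0 conn h p theta1 theta2 rho K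
    mh VF EF uV uE sk sk0)).
  exact: rings_le.
have H0 t : (0 <= H t)%E.
  apply: adde_ge0; apply: sume_ge0 => i _.
    rewrite lee_fin mulr_ge0 ?(ltW (vmu_gt0 _ _))// mulr_ge0// mulr_ge0 ?powR_ge0//.
    exact: annuli_ge0.
  apply: integral_ge0 => s _; rewrite lee_fin mulr_ge0// mulr_ge0 ?powR_ge0//.
  exact: annuli_ge0.
pose f t := (Jt t - Kt t - Lam%:E * (slice_mass rho t - slice_mass (rho / 4) t))%E.
have iMM : mu.-integrable `[0, +oo[ (fun t => slice_mass rho t - slice_mass (rho / 4) t)%E.
  exact: (integrableB _ intM intM').
have iLMM : mu.-integrable `[0, +oo[
    (fun t => Lam%:E * (slice_mass rho t - slice_mass (rho / 4) t))%E.
  exact: (integrableZl _ Lam iMM).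
have iJK : mu.-integrable `[0, +oo[ (fun t => Jt t - Kt t)%E.
  exact: (integrableB _ intJ' intK').
have intf : mu.-integrable `[0, +oo[ f by exact: (integrableB _ iJK iLMM).
have aeH : {ae mu, forall t, `[0, +oo[%classic t -> (f t <= H t)%E}.
  apply: (ae_mono (ae_and (ae_and aeJ aeK) (ae_and aeI aeI'))) => t [[gJ gK] [gI gI']] t0'.
  have t0 : 0 <= t by move: t0'; rewrite /= in_itv/= andbT.
  have {}gJ := gJ t0; have {}gK := gK t0; have {}gI := gI t0; have {}gI' := gI' t0.
  have EJ : (fun x => dt (dt (phi rho)) x t * u x t) =
      (fun x => gcut x0 kap rho x ^+ k.+3 * tcut2 k (T rho) t * u x t).
    apply/funext => x.
    by have [_ _ ->] := cutoff_C2 x0 kap k rho (T rho) x.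
  rewrite EJ in gJ.
  have fI : slice_mass rho t \is a fin_num by exact: gintegrable_fin_num gI.
  have fI' : slice_mass (rho / 4) t \is a fin_num by exact: gintegrable_fin_num gI'.
  apply: leeB_of_leeD fI fI' _; rewrite /Jt EJ.
  have rq : 4 * (rho / 4) <= rho by rewrite mulrC divfK.
  exact: (slice_integral kap_gt1 kap_le2 conn sup_len_ge0 len_le_sup inf_gt0
    inf_le_len C00 omegaC r1 r4j (T_gt0 r0) (T_sq r1) uV uE hV hE t1p t2p erefl hK
    r40 rq (T_gt0 r40) (T_quarter r0) s1 L0 ks t0 (fun x => u_ge0 x t0)
    (fun x => h0 x t0) (vws_domain sol t0) (vws_kirchhoff sol t0) gJ gK gI gI').
have fH : (\int[mu]_(t in `[0%R, +oo[) f t <= (massC * Lam `^ p)%:E)%E.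
  by apply: le_trans intH; apply: le_integral_lower.
have E : (\int[mu]_(t in `[0%R, +oo[) f t =
    (\int[mu]_(t in `[0%R, +oo[) Jt t - \int[mu]_(t in `[0%R, +oo[) Kt t)
    - Lam%:E * ((mass rho)%:E - (mass (rho / 4))%:E))%E.
  have e1 : (\int[mu]_(t in `[0%R, +oo[) (slice_mass rho t - slice_mass (rho / 4) t) =
      (mass rho)%:E - (mass (rho / 4))%:E)%E.
    exact: (etrans (integralB _ intM intM')
      (congr2 (fun a b : \bar R => a - b)%E (massE r0) (massE r40))).
  have e2 : (\int[mu]_(t in `[0%R, +oo[)
      (Lam%:E * (slice_mass rho t - slice_mass (rho / 4) t)) =
      Lam%:E * ((mass rho)%:E - (mass (rho / 4))%:E))%E.
    by rewrite -e1; exact: (integralZl _ iMM).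
  have e3 : (\int[mu]_(t in `[0%R, +oo[) (Jt t - Kt t) =
      \int[mu]_(t in `[0%R, +oo[) Jt t - \int[mu]_(t in `[0%R, +oo[) Kt t)%E.
    exact: (integralB _ intJ' intK').
  rewrite -e2 -e3; exact: (integralB _ iJK iLMM).
have Uf := initial_mass_fin r0.
have ineq := vws_ineq sol tphi.
have U00 : gintegral W (fun x => u0 x * dt (phi rho) x 0) = 0%E.
  rewrite (_ : (fun x => _) = (fun=> 0)); first exact: gintegral0.
  apply/funext => x; have [_ -> // _] := cutoff_C2 x0 kap k rho (T rho) x.
  by rewrite tcut1_0 ?T_gt0// !mulr0.
rewrite U00 sube0 in ineq.
have {}ineq : (- (\int[mu]_(t in `[0%R, +oo[) Jt t) + \int[mu]_(t in `[0%R, +oo[) Kt t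
    + (mass rho)%:E + initial_mass rho <= 0)%E.
  rewrite -(massE r0); exact: ineq.
rewrite E in fH; rewrite -(fineK Uf) in ineq.
exact: weak_balance (integrable_fin_num _ intJ') (integrable_fin_num _ intK') ineq fH.
Qed.

Hypothesis data : (0 <= limf_einf
     (fun rho : R =>
        gintegral_pos W (gball (vpt x0) (rho - sup_len G)) u1
        + gintegral_neg W
            (gball (vpt x0) (2 `^ theta1^-1 * rho + sup_len G)) u1)
     (pinfty_nbhs R))%E.

Lemma initial_mass_liminf (eps : R) : 0 < eps ->
  exists A : R, forall rho, A < rho -> 0 < rho -> - eps <= fine (initial_mass rho).
Proof.
move=> e0; have [A hA] := limf_einf_pinfty data e0; exists A => rho Ar r0.
rewrite -lee_fin fineK ?initial_mass_fin//.
exact: le_trans (hA _ Ar) (initial_mass_ge r0).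
Qed.

Definition scale (n : nat) : R := 4 ^+ n * (2 * R0).

Lemma scale_ge (n : nat) : 2 * R0 <= scale n.
Proof.
by rewrite /scale ler_peMl ?exprn_ege1 ?ler1n// mulr_ge0 ?(ltW R0_gt0).
Qed.

Lemma scale_gt0 (n : nat) : 0 < scale n.
Proof. by apply: lt_le_trans (scale_ge n); rewrite mulr_gt0 ?R0_gt0. Qed.

Lemma scaleS (n : nat) : scale n.+1 / 4 = scale n.
Proof. by rewrite /scale exprS; field. Qed.

Lemma scale_geS (n : nat) : n%:R <= scale n.
Proof.
have q : n%:R <= 4 ^+ n :> R by rewrite -natrX ler_nat ltnW// ltn_expl.
apply: (le_trans q); rewrite /scale ler_peMr ?exprn_ge0//.
have : 1 <= R0 by rewrite le_max lexx orbT.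
lra.
Qed.

Lemma mass_eq0 (n : nat) : mass (scale n) = 0.
Proof.
have sm0 : 0 < (sigma - 1)^-1 by rewrite invr_gt0 subr_gt0.
apply: (seq_vanish (M := fun n => mass (scale n)) sm0 massC_ge0) => [m|m|eps e0].
- exact: mass_ge0.
- by rewrite -scaleS; apply: mass_mono; exact: scale_gt0.
have [A hA] := initial_mass_liminf e0.
exists (Num.truncn (`|A|)).+1 => m Nm Lam L0.
have Am : A < scale m.+1.
  apply: le_lt_trans (ler_norm A) _; apply: lt_le_trans (scale_geS _).
  have := truncnS_gt `|A|; move/lt_le_trans; apply.
  by rewrite ler_nat (leq_trans Nm).
have := time_step (scale_ge m.+1) L0; rewrite scaleS.
move/le_trans; apply; rewrite lerD2l lerNl.
exact: hA _ Am (scale_gt0 _).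
Qed.

Lemma slice_mass_eq0 (n : nat) : {ae mu, forall t, 0 <= t ->
  gintegrable W (fun x => h x t * `|u x t| `^ sigma * phi (scale n) x t) /\
  slice_mass (scale n) t = 0%E}.
Proof.
have r0 := scale_gt0 n; have [aeI intI] := mass_integrable r0.
have mf : measurable_fun `[(0:R), +oo[ (slice_mass (scale n)).
  exact: (measurable_int _ intI).
have [h1 _] := @ae_eq_integral_abs _ _ R mu _ (measurable_itv `[0, +oo[) _ mf.
have I0 : (\int[mu]_(t in `[0%R, +oo[) `|slice_mass (scale n) t|)%E = 0%E.
  rewrite -[RHS](congr1 EFin (mass_eq0 n)) -(massE r0).
  apply: eq_integral => t; rewrite inE/= in_itv/= andbT => t0.
  rewrite gee0_abs// /slice_mass -(gintegral0 W); apply: gintegral_le => x.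
  exact: slice_fun_ge0.
apply: (ae_mono (ae_and aeI (h1 I0))) => t [gt st] t0.
by split; [exact: gt|apply: st; rewrite /= in_itv/= andbT].
Qed.

Lemma phi_eq1 x (t : R) : 0 <= t -> exists n, phi (scale n) x t = 1.
Proof.
move=> t0; pose N := Num.max (dist x (vpt x0) + j) (t ^+ 2).
pose n := (Num.truncn N).+1; exists n.
have Nn : N <= scale n.
  by apply: le_trans (scale_geS n); exact/ltW/truncnS_gt.
have r0 := scale_gt0 n.
have r1 : 1 <= scale n.
  have : 1 <= R0 by rewrite le_max lexx orbT.
  by have := scale_ge n; lra.
rewrite /cutoff (gcut_eq1 kap_gt1 conn sup_len_ge0 len_le_sup r0); last first.
  by rewrite lerBrDr (le_trans _ Nn)// le_max lexx.
rewrite expr1n mul1r tcut_eq1 ?T_gt0//.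
rewrite -(@ler_pXn2r _ 2) ?nnegrE ?powR_ge0//.
by apply: le_trans (T_sq r1); rewrite (le_trans _ Nn)// le_max lexx orbT.
Qed.

Lemma density_eq0 x (t : R) : 0 <= t -> h x t * `|u x t| `^ sigma = 0 -> u x t = 0.
Proof.
move=> t0 /eqP; rewrite mulf_eq0 gt_eqF ?h0//= powR_eq0 normr_eq0.
by case/andP => /eqP.
Qed.

(** At almost every time all the masses vanish at once. This gives zero at every
    vertex, and almost everywhere on the edges, hence everywhere by the
    continuity of the solution in space. *)
Lemma u_eq0 : {ae mu, forall t, 0 <= t -> forall x, u x t = 0}.
Proof.
apply: (ae_mono (ae_foralln slice_mass_eq0)) => t ht t0 x.
case: (gpointP x) => [v|e s sl].
  have [n phin] := phi_eq1 (vpt v) t0; have [_ gz] := ht n t0.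
  apply: density_eq0 => //.
  have := gintegral_eq0_vertex (fun x => slice_fun_ge0 (scale n) x t0) gz v.
  by rewrite phin mulr1.
have zero_ae : {ae mu, forall s, 0 < s < len e -> u (ept e s) t = 0}.
  have edge_n n : {ae mu, forall s, 0 < s < len e ->
      h (ept e s) t * `|u (ept e s) t| `^ sigma * phi (scale n) (ept e s) t = 0}.
    have [[gm _] gz] := ht n t0.
    exact: (gintegral_eq0_edge (fun x => slice_fun_ge0 (scale n) x t0) gm gz e).
  apply: (ae_mono (ae_foralln edge_n)) => z hz zl.
  have [n phin] := phi_eq1 (ept e z) t0.
  by apply: density_eq0 => //; have := hz n zl; rewrite phin mulr1.
apply: (ae_zero_continuous _ zero_ae sl) => z zl.
have [_ [dz _ _] _ _] := vws_domain sol t0 e.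
have := dz z; rewrite in_itv => /(_ zl) dz1.
by apply: differentiable_continuous; exact/derivable1_diffP.
Qed.
End Main.

Lemma weak_exponents (R : realType) (sigma theta1 theta2 : R) : 1 < sigma ->
  exists k K : nat, k.+3%:R <= sigma * k.+1%:R /\
    3 `^ theta1 + 2 `^ theta2 <= 2 ^+ K.+1 / 2 `^ theta1.
Proof.
move=> s1; have sm0 : 0 < sigma - 1 by rewrite subr_gt0.
pose k := Num.truncn (2 / (sigma - 1)); exists k.
pose A := (3 `^ theta1 + 2 `^ theta2) * 2 `^ theta1.
exists (Num.truncn A); split.
  have : 2 / (sigma - 1) < k.+1%:R by exact: truncnS_gt.
  rewrite ltr_pdivrMr// => /ltW.
  rewrite (_ : k.+3%:R = k.+1%:R + 2 :> R); last by rewrite -natrD addn2.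
  by lra.
rewrite ler_pdivlMr ?powR_gt0// -/A.
apply: (le_trans (ltW (truncnS_gt A))).
by rewrite -natrX ler_nat ltnW// ltn_expl.
Qed.

Theorem theorem2p10 (R : realType) (G : metric_graph R) (W : graph_weights G)
    (x0 : vertex G) (C0 sigma theta1 theta2 : R)
    (h : gpoint G -> R -> R) (u0 u1 : gpoint G -> R) (u : gpoint G -> R -> R) :
  infinite_set [set: vertex G] ->
  graph_connected G ->
  locally_finite G ->
  has_ubound (range (@len R G)) ->
  0 < inf_len G ->
  (exists xs : nat -> vertex G,
     dist (vpt x0) (vpt (xs n)) @[n --> \oo] --> +oo) ->
  (forall rho : R, 0 < rho -> meets_finitely_many (gball (vpt x0) rho)) ->
  0 < C0 ->
  (forall x : vertex G,
     \sum_(y \in [set y | gadjacent x y]) omega W x y <= C0 * vmu W x) ->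
  measurable_xt h ->
  (forall x t, 0 <= t -> 0 < h x t) ->
  1 < sigma ->
  2 <= theta1 ->
  2 <= theta2 ->
  theta2 / 2 <= theta1 ->
  (exists2 C : R, 0 < C & forall rho : R, Num.max (2 * sup_len G) 1 <= rho ->
     ((\int[lebesgue_measure]_(t in `[0%R, +oo[)
         \esum_(x in [set: vertex G])
           (vmu W x * h (vpt x) t `^ (- (sigma - 1)^-1)
              * \1_(E_set x0 theta1 theta2 rho) (vpt x, t))%:E)
      <= (C * rho `^ (sigma / (sigma - 1)))%:E)%E /\
     ((\int[lebesgue_measure]_(t in `[0%R, +oo[)
         \esum_(e in [set: edge G])
           \int[lebesgue_measure]_(s in `]0%R, len e[)
             (h (ept e s) t `^ (- (sigma - 1)^-1)
                * \1_(E_set x0 theta1 theta2 rho) (ept e s, t))%:E)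
      <= (C * rho `^ (sigma / (sigma - 1)))%:E)%E) ->
  very_weak_solution W h sigma u0 u1 u ->
  (forall x t, 0 <= t -> 0 <= u x t) ->
  (0 <= limf_einf
     (fun rho : R =>
        gintegral_pos W (gball (vpt x0) (rho - sup_len G)) u1
        + gintegral_neg W
            (gball (vpt x0) (2 `^ theta1^-1 * rho + sup_len G)) u1)
     (pinfty_nbhs R))%E ->
  {ae (@lebesgue_measure R), forall t, 0 <= t -> forall x, u x t = 0}.
Proof.
move=> _ conn _ len_ub inf_gt0 _ fin_ball C00 omegaC mh h0 s1 th1 th2 th12.
move=> [C C_gt0 weights] sol u_ge0 data.
have [k [K [ks hK]]] := weak_exponents theta1 theta2 s1.
exact: (@u_eq0 R G W x0 C0 sigma theta1 theta2 C h u0 u1 u conn len_ub inf_gt0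
  fin_ball C00 omegaC mh h0 s1 th1 th2 th12 C_gt0 weights sol u_ge0 k K ks hK data).
Qed.
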